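(* Let $E$ be a row-finite directed graph without sinks, and let $\mathcal{G}_E$ be its path groupoid. The following are equivalent: (1) $C^*(\mathcal{G}_E)$ is purely infinite; (2) $\mathcal{G}_E$ is essentially principal and for every finite path $\alpha \in E^*$, the cylinder set $Z(\alpha)$ is paradoxical; (3) $E$ satisfies Conditions (K) and (DI); (4) $E$ satisfies Conditions (K) and (DL).
   Context: **Graphs and paths.** A directed graph $E=(E^0,E^1,t,s)$ consists of countable sets $E^0$ (vertices), $E^1$ (edges) and maps $t,s:E^1\to E^0$ (target and source). $E$ is row-finite if $s^{-1}(v)$ is finite for every $v\in E^0$; a sink is a vertex $v$ with $s^{-1}(v)=\emptyset$. A finite path of length $k\ge 1$ is a sequence $\mu=(\mu_1,\dots,\mu_k)$ of edges with $s(\mu_{i+1})=t(\mu_i)$ for $1\le i\le k-1$; put $s(\mu)=s(\mu_1)$, $t(\mu)=t(\mu_k)$, $|\mu|=k$. Vertices are regarded as paths of length $0$ with $s(v)=t(v)=v$. $E^*$ is the set of all finite paths, including those of length $0$. A loop (or cycle) is a finite path $\mu$ of length at least $1$ with $s(\mu)=t(\mu)$; it is based at $v=s(\mu)=t(\mu)$. **Infinite path space.** $E^\infty$ is the set of sequences $x=(x_1,x_2,\dots)$ of edges with $t(x_i)=s(x_{i+1})$ for all $i\ge1$, and $s(x)=s(x_1)$. For $\mu\in E^*$, the cylinder set is $Z(\mu)=\{x\in E^\infty: x_1=\mu_1,\dots,x_{|\mu|}=\mu_{|\mu|}\}$; for a vertex $v$, $Z(v)=\{x\in E^\infty: s(x)=v\}$.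 Cylinder sets form a basis of a locally compact Hausdorff totally disconnected topology on $E^\infty$. **Path groupoid.** $\mathcal{G}_E=\{(x,k,y): x,y\in E^\infty,\ k\in\mathbb{Z},\ \exists N\in\mathbb{N}\ \text{with}\ x_i=y_{i+k}\ \forall i\ge N\}$, with $d(x,k,y)=y$, $r(x,k,y)=x$, $(x,k,y)(y,l,z)=(x,k+l,z)$, $(x,k,y)^{-1}=(y,-k,x)$, and unit space $\mathcal{G}_E^{(0)}\cong E^\infty$. Its topology has as basis the sets $Z(\alpha,\beta)=\{(x,k,y): x\in Z(\alpha),\ y\in Z(\beta),\ k=|\beta|-|\alpha|,\ x_i=y_{i+k}\text{ for } i>|\alpha|\}$ for $\alpha,\beta\in E^*$ with $t(\alpha)=t(\beta)$; these are compact open bisections. $\mathcal{G}_E$ is an ample, amenable, second countable locally compact Hausdorff étale groupoid, so its full and reduced groupoid $C^*$-algebras coincide; $C^*(\mathcal{G}_E)$ denotes this $C^*$-algebra. **Essentially principal.** An étale groupoid $\mathcal{G}$ is topologically principal if the set of units with trivial isotropy is dense in $\mathcal{G}^{(0)}$. A subset $D\subset\mathcal{G}^{(0)}$ is invariant if for every $g\in\mathcal{G}$, $d(g)\in D$ implies $r(g)\in D$. For closed invariant $D$ let $\mathcal{G}_D=\{g\in\mathcal{G}: d(g)\in D\}$, a closed étale subgroupoid with unit space $D$. $\mathcal{G}$ is essentially principal if $\mathcal{G}_D$ is topologically principal for every closed invariant $D\subset\mathcal{G}^{(0)}$. **Purely infinite.** For positive $a\in M_n(A)$ and $b\in M_m(A)$,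 where $A$ is a $C^*$-algebra, write $a\precsim b$ if there is a sequence $(r_k)$ in $M_{m,n}(A)$ with $\|r_k^*br_k-a\|\to0$. $A$ is purely infinite if $a\oplus a\precsim a$ for every nonzero positive $a\in A$, where $a\oplus a=\mathrm{diag}(a,a)\in M_2(A)$. **Paradoxical.** For $\mu\in E^*$, $Z(\mu)$ is paradoxical if there exist $m,n\in\mathbb{N}$ and compact open bisections $Z(\alpha_1,\beta_1),\dots,Z(\alpha_n,\beta_n)$, $Z(\gamma_1,\delta_1),\dots,Z(\gamma_m,\delta_m)$ (so $t(\alpha_i)=t(\beta_i)$, $t(\gamma_j)=t(\delta_j)$) such that $\bigcup_{i=1}^nZ(\beta_i)=\bigcup_{j=1}^mZ(\delta_j)=Z(\mu)$ and the sets $Z(\alpha_1),\dots,Z(\alpha_n),Z(\gamma_1),\dots,Z(\gamma_m)$ are contained in $Z(\mu)$ and pairwise disjoint. **Conditions on $E$.** A first-return cycle at $v$ is a cycle $\mu$ based at $v$ with $t(\mu_i)=v$ if and only if $i=|\mu|$. $V^2$, $V^1$, $V^0$ are the sets of vertices $v$ at which there are, respectively, at least two distinct, exactly one, and no first-return cycles. - Condition (K): $V^1=\emptyset$, equivalently $E^0=V^0\cup V^2$. - Condition (DI): for every $v\in E^0$ there is a finite decomposition $Z(v)=\bigsqcup_{i=1}^nZ(\beta_i)$, $\beta_i\in E^*$, such that for every $i$ there is $\alpha_i\in E^*$ with $s(\alpha_i)=v$, $t(\alpha_i)=t(\beta_i)$, and $\alpha_i$ passes through $V^2$ (i.e. some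 vertex on $\alpha_i$, endpoints included, lies in $V^2$). - Condition (DL): for every $v\in E^0$ there is a finite decomposition $Z(v)=\bigsqcup_{i=1}^nZ(\beta_i)$, $\beta_i\in E^*$, such that for every $i$ there is $\alpha_i\in E^*$ with $s(\alpha_i)=v$, $t(\alpha_i)=t(\beta_i)$, and $\alpha_i$ passes through a loop (i.e. some vertex on $\alpha_i$, endpoints included, lies on a loop). *)

(* Defs.v *)
From HB Require Import structures.
From mathcomp Require Import all_boot all_order all_algebra.
From mathcomp Require Import complex.
From mathcomp Require Import all_classical all_reals all_analysis.

Set Implicit Arguments.
Unset Strict Implicit.
Unset Printing Implicit Defensive.

Import Order.TTheory GRing.Theory Num.Theory.
Import numFieldNormedType.Exports.

Local Open Scope classical_set_scope.
Local Open Scope complex_scope.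
Local Open Scope ring_scope.

Record digraph := Digraph {
  vertex : countType;
  edge : countType;
  src : edge -> vertex;
  tgt : edge -> vertex
}.
Arguments src {d}.
Arguments tgt {d}.

Definition row_finite (E : digraph) :=
  forall v : vertex E, finite_set [set e : edge E | src e = v].

Definition no_sinks (E : digraph) :=
  forall v : vertex E, [set e : edge E | src e = v] !=set0.

Fixpoint is_path (E : digraph) (v : vertex E) (p : seq (edge E)) : bool :=
  if p is e :: p' then (src e == v) && is_path (tgt e) p' else true.

(* A finite path is stored with its source, so that (v, [::]) is the path of
   length 0 at v; for nonempty p the source is forced by p. *)
Definition finpath (E : digraph) :=
  {p : vertex E * seq (edge E) | is_path p.1 p.2}.

Section Paths.
Variable E : digraph.
Implicit Types (mu : finpath E) (v w : vertex E).

Definition fsrc mu : vertex E := (val mu).1.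
Definition fedges mu : seq (edge E) := (val mu).2.
Definition flen mu : nat := size (fedges mu).
Definition ftgt mu : vertex E := last (fsrc mu) (map tgt (fedges mu)).
Definition fverts mu : seq (vertex E) := fsrc mu :: map tgt (fedges mu).

Definition is_cycle mu := (0 < flen mu)%N /\ fsrc mu = ftgt mu.

Definition first_return v mu :=
  [/\ is_cycle mu, fsrc mu = v &
      forall i, (i < flen mu)%N ->
        (nth v (map tgt (fedges mu)) i = v <-> i.+1 = flen mu)].

Definition V1 : set (vertex E) :=
  [set v | exists mu, first_return v mu /\
             forall nu, first_return v nu -> nu = mu].
Definition V2 : set (vertex E) :=
  [set v | exists mu nu, [/\ mu <> nu, first_return v mu & first_return v nu]].

Definition on_cycle w := exists mu, is_cycle mu /\ w \in fverts mu.

(* The edges of an infinite path are numbered from 0 instead of 1. *)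
Definition ipath :=
  {x : nat -> edge E | forall i, tgt (x i) = src (x i.+1)}.

Definition iedge (x : ipath) : nat -> edge E := sval x.
Definition isrc (x : ipath) : vertex E := src (iedge x 0).

(* The first conjunct matters only when flen mu = 0. *)
Definition cyl mu : set ipath :=
  [set x | isrc x = fsrc mu /\ mkseq (iedge x) (flen mu) = fedges mu].

(* Z(v), for a vertex v. *)
Definition vpath v : finpath E := exist _ (v, [::]) isT.

End Paths.

Arguments V1 : clear implicits.
Arguments V2 : clear implicits.
Arguments on_cycle : clear implicits.

HB.instance Definition _ (E : digraph) := gen_eqMixin (ipath E).
HB.instance Definition _ (E : digraph) := gen_choiceMixin (ipath E).

(* The cylinder sets cover, and two of them are nested or disjoint: the
   topology they generate as a subbase has them as a basis. *)
HB.instance Definition _ (E : digraph) :=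
  @isSubBaseTopological.Build (ipath E) (set (ipath E)) (range (@cyl E)) id.

Section Conditions.
Variable E : digraph.

Definition condK := V1 E = set0.

(* Z(v) is a finite disjoint union of cylinders Z(beta_i) such that each
   t(beta_i) is the target of a path from v through a vertex satisfying P. *)
Definition cond_decomposition (P : vertex E -> Prop) :=
  forall v : vertex E, exists (n : nat) (beta : 'I_n -> finpath E),
    [/\ cyl (vpath v) = \bigcup_i cyl (beta i),
        trivIset setT (fun i => cyl (beta i)) &
        forall i, exists alpha : finpath E,
          [/\ fsrc alpha = v, ftgt alpha = ftgt (beta i) &
              exists2 w, w \in fverts alpha & P w]].

Definition condDI := cond_decomposition (V2 E).
Definition condDL := cond_decomposition (on_cycle E).

Definition paradoxical (mu : finpath E) :=
  exists (m n : nat) (alpha beta : 'I_n -> finpath E)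
         (gamma delta : 'I_m -> finpath E),
    [/\ (forall i, ftgt (alpha i) = ftgt (beta i)) /\
          (forall j, ftgt (gamma j) = ftgt (delta j)),
        \bigcup_i cyl (beta i) = cyl mu /\ \bigcup_j cyl (delta j) = cyl mu,
        (forall i, cyl (alpha i) `<=` cyl mu) /\
          (forall j, cyl (gamma j) `<=` cyl mu) &
        trivIset setT (fun k : 'I_n + 'I_m =>
          match k with inl i => cyl (alpha i) | inr j => cyl (gamma j) end)].

End Conditions.

Arguments condK : clear implicits.
Arguments condDI : clear implicits.
Arguments condDL : clear implicits.

(* The constraint 0 <= N + k makes the absolute value in the index of y
   harmless. *)
Definition tail_eq (E : digraph) (x : ipath E) (k : int) (y : ipath E) :=
  exists N : nat, 0 <= N%:Z + k /\
    forall i : nat, (N <= i)%N -> iedge x i = iedge y (absz (i%:Z + k)).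

Record path_groupoid (E : digraph) := Arrow {
  gr : ipath E;
  gk : int;
  gd : ipath E;
  gP : tail_eq gr gk gd
}.

Lemma tail_eq_refl (E : digraph) (x : ipath E) : tail_eq x 0 x.
Proof. by exists 0%N; split=> // i _; rewrite addr0. Qed.

Lemma tail_eq_sym (E : digraph) (x : ipath E) (k : int) (y : ipath E) :
  tail_eq x k y -> tail_eq y (- k) x.
Proof.
move=> [N [Nk xy]]; exists (absz (N%:Z + k)); rewrite gez0_abs// addrK; split=> //.
move=> j; rewrite -lez_nat gez0_abs// => Nkj.
have Nj : N%:Z <= j%:Z - k by rewrite lerBrDr.
have jk : 0 <= j%:Z - k by exact: le_trans Nj.
by rewrite xy ?gez0_abs ?subrK// -lez_nat gez0_abs.
Qed.

Definition gunit (E : digraph) (x : ipath E) : path_groupoid E :=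
  Arrow (tail_eq_refl x).

Definition ginv (E : digraph) (g : path_groupoid E) : path_groupoid E :=
  Arrow (tail_eq_sym (gP g)).

(* gcomp a b g: the pair (a, b) is composable with product g. *)
Definition gcomp (E : digraph) (a b g : path_groupoid E) :=
  [/\ gd a = gr b, gr g = gr a, gk g = gk a + gk b & gd g = gd b].

Definition gcyl (E : digraph) (alpha beta : finpath E) : set (path_groupoid E) :=
  [set g | [/\ cyl alpha (gr g), cyl beta (gd g),
               gk g = (flen beta)%:Z - (flen alpha)%:Z &
               forall i : nat, iedge (gr g) (flen alpha + i)%N =
                               iedge (gd g) (flen beta + i)%N]].

HB.instance Definition _ (E : digraph) := gen_eqMixin (path_groupoid E).
HB.instance Definition _ (E : digraph) := gen_choiceMixin (path_groupoid E).

(* As for cylinder sets, the sets Z(alpha, beta) cover and are pairwise nested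
   or disjoint, so they are a basis of the topology generated here. *)
HB.instance Definition _ (E : digraph) :=
  @isSubBaseTopological.Build (path_groupoid E) (set (path_groupoid E))
    [set U | exists alpha beta : finpath E,
               ftgt alpha = ftgt beta /\ U = gcyl alpha beta] id.

(* The unit space is identified with [ipath E] through [gunit]. *)
Section EssentiallyPrincipal.
Variable E : digraph.
Implicit Types D : set (ipath E).

Definition ginvariant D := forall g : path_groupoid E, D (gd g) -> D (gr g).

Definition reduction D : set (path_groupoid E) := [set g | D (gd g)].

Definition trivial_isotropy (H : set (path_groupoid E)) (x : ipath E) :=
  forall g, H g -> gr g = x -> gd g = x -> g = gunit x.

(* G_D is topologically principal: its units with trivial isotropy are dense
   in D. *)
Definition reduction_top_principal D :=
  D `<=` closure [set x | D x /\ trivial_isotropy (reduction D) x].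

Definition essentially_principal :=
  forall D, closed D -> ginvariant D -> reduction_top_principal D.

End EssentiallyPrincipal.

HB.mixin Record CompleteNormedModule_isCStarAlgebra (R : realType) A
    & CompleteNormedModule R[i] A := {
  cmul : A -> A -> A;
  cstar : A -> A;
  cmulA : associative cmul;
  cmulDl : left_distributive cmul +%R;
  cmulDr : right_distributive cmul +%R;
  cscalerAl : forall (c : R[i]) a b, c *: cmul a b = cmul (c *: a) b;
  cscalerAr : forall (c : R[i]) a b, c *: cmul a b = cmul a (c *: b);
  cstarK : involutive cstar;
  cstarD : {morph cstar : a b / a + b};
  cstarZ : forall (c : R[i]) a, cstar (c *: a) = c^* *: cstar a;
  cstarM : forall a b, cstar (cmul a b) = cmul (cstar b) (cstar a);
  cnormM : forall a b, `|cmul a b| <= `|a| * `|b|;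
  cstar_identity : forall a, `|cmul (cstar a) a| = `|a| ^+ 2
}.

(* Not necessarily unital. *)
#[short(type="cstarAlgType")]
HB.structure Definition CStarAlgebra (R : realType) :=
  {A of CompleteNormedModule R[i] A &
        CompleteNormedModule_isCStarAlgebra R A}.

(* Norms over R[i] take values in R[i], in fact among the nonnegative reals. *)
Definition rnorm (R : realType) (V : normedZmodType R[i]) (x : V) : R :=
  complex.Re `|x|.

Section PurelyInfinite.
Variables (R : realType) (A : cstarAlgType R).

Definition cpositive (a : A) := exists b : A, a = cmul (cstar b) b.

Definition cmulmx m n p (x : 'M[A]_(m, n)) (y : 'M[A]_(n, p)) : 'M[A]_(m, p) :=
  \matrix_(i, j) \sum_k cmul (x i k) (y k j).

Definition cstarmx m n (x : 'M[A]_(m, n)) : 'M[A]_(n, m) :=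
  \matrix_(i, j) cstar (x j i).

Definition cvnorm n (v : 'cV[A]_n) : R :=
  Num.sqrt (rnorm (cmulmx (cstarmx v) v 0 0)).

(* M_n(A) acts faithfully on the Hilbert A-module A^n, whose norm is cvnorm, so
   its C*-norm is the operator norm of that action. *)
Definition cmxnorm n (x : 'M[A]_n) : \bar R :=
  ereal_sup [set (cvnorm (cmulmx x v))%:E | v in [set v | cvnorm v <= 1]].

Definition cuntz_le n m (a : 'M[A]_n) (b : 'M[A]_m) :=
  exists r : nat -> 'M[A]_(m, n),
    cmxnorm (cmulmx (cmulmx (cstarmx (r k)) b) (r k) - a) @[k --> \oo]
      --> 0%E.

Definition cdirsum n m (a : 'M[A]_n) (b : 'M[A]_m) : 'M[A]_(n + m) :=
  block_mx a 0 0 b.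

Definition purely_infinite :=
  forall a : A, a != 0 -> cpositive a ->
    let a1 : 'M[A]_1 := const_mx a in cuntz_le (cdirsum a1 a1) a1.

End PurelyInfinite.

Section GroupoidCStar.
Variables (R : realType) (E : digraph).
Local Notation G := (path_groupoid E).

(* C_c(G). The regular module R[i]^o carries the topology of R[i]. *)
Definition Cc : set (G -> R[i]) :=
  [set f | continuous (f : G -> R[i]^o) /\
           compact (closure [set g | f g != 0])].

(* The sum is finite for f in C_c(G), since G is etale. *)
Definition gconv (f h : G -> R[i]) : G -> R[i] :=
  fun g => \sum_(p \in [set p : G * G | gcomp p.1 p.2 g]) f p.1 * h p.2.

Definition ginvol (f : G -> R[i]) : G -> R[i] := fun g => (f (ginv g))^*.

Definition l2norm (xi : G -> R[i]) : \bar R :=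
  sqrte (\esum_(g in [set: G]) (rnorm (xi g) ^+ 2)%:E).

(* The operator norm of xi |-> gconv f xi on l^2(G), that is, on the direct sum
   over x of the regular representations on l^2([set g | gd g = x]); it equals
   the supremum over x of their norms. *)
Definition reduced_norm (f : G -> R[i]) : \bar R :=
  ereal_sup [set l2norm (gconv f xi) | xi in [set xi | (l2norm xi <= 1)%E]].

(* A is the completion of the *-algebra C_c(G) in the reduced norm, through
   iota; the values of iota outside C_c(G) are irrelevant. Since G is amenable
   the reduced and full norms agree on C_c(G). *)
Record is_groupoid_cstar (A : cstarAlgType R) (iota : (G -> R[i]) -> A) :
    Prop := {
  iota_linear : forall (c : R[i]) f h, Cc f -> Cc h ->
    iota (fun g => c * f g + h g) = c *: iota f + iota h;
  iota_mul : forall f h, Cc f -> Cc h ->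
    iota (gconv f h) = cmul (iota f) (iota h);
  iota_star : forall f, Cc f -> iota (ginvol f) = cstar (iota f);
  iota_norm : forall f, Cc f -> (rnorm (iota f))%:E = reduced_norm f;
  iota_dense : dense (iota @` Cc)
}.

End GroupoidCStar.

(* Main.v *)
Require Import Defs.
From HB Require Import structures.
From mathcomp Require Import all_boot all_order all_algebra.
From mathcomp Require Import complex finmap.
From mathcomp Require Import all_classical all_reals all_analysis.
From mathcomp Require Import zify ring lra.

Set Implicit Arguments.
Unset Strict Implicit.
Unset Printing Implicit Defensive.

Import Order.TTheory GRing.Theory Num.Theory.
Import numFieldNormedType.Exports.

Local Open Scope classical_set_scope.
Local Open Scope complex_scope.
Local Open Scope ring_scope.

(** The proof uses neither functional calculus nor an abstract groupoid theorem.

    Negatively: if (K) or (DL) fails, some vertex v is stable, that is, for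
    any finitely many pairs of paths (a, b) from v with equal targets there is
    a finite nonempty set S of infinite paths from v that is preserved by every
    exchange of prefixes a <-> b. (If v has a unique first-return cycle, S is
    the infinite power of a cycle; otherwise follow an infinite path that never
    becomes reachable through a loop.) Counting prefixes in S contradicts a
    paradoxical decomposition of Z(v). In C*(G), averaging over S the values at
    units is a trace on the finitely many step functions at hand, whereas
    p_v + p_v <= p_v approximates two isometries of the corner at p_v with
    orthogonal ranges.

    Positively: under (K) and (DI), exits from paths through V^2 supply
    arbitrarily small disjoint copies of the pieces of Z(mu), so each p_mu is
    properly infinite. Given a = b* b, let U be the union of the Z(mu) for which
    p_mu = w* w with w in the closure of b A. On the complement of U, a closed
    invariant set, a step function near b is small: at an aperiodic point where
    it is not, compressing a by p_mu for a long prefix mu gives nearly a multiple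
    of p_mu, and a Newton iteration puts mu in U. A Schur multiplier reduces a
    step function to boundedly many bisections, so that it is small in norm where
    it is uniformly small; hence b is close to q b, where q is a finite sum of
    p_mu with Z(mu) in U. Such a q is properly infinite and equals w* w with w in
    the closure of b A, and this yields a + a <= a. *)

(** * Paths, prefixes and shifts *)

(** Order of choices: small coefficients bound a norm only when the number of bisections is fixed
    beforehand, whereas a step function close enough to b to have small coefficients off U may need
    arbitrarily many cells. A crude approximant of b therefore fixes the Schur multiplier, and with
    it the number of bisections, before the accuracy of a fine approximant is chosen; contractivity
    carries the estimate from the crude to the fine one. Writing a = b* b avoids square roots and
    spectral cut-downs of a. The one fact about positive elements that is needed, ||x||^2 <= ||x* x
    + y* y||, is read off the l^2 representation; it compares the norm of 2 x 2 matrices with their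
    entries. A stable set depends on the finite list of exchanges, so the two approximate isometries
    must become step functions before S is chosen. *)

Section PathBasics.
Variable E : digraph.
Implicit Types (mu nu : finpath E) (v w : vertex E) (x y z : ipath E).

Lemma ipath_eq x y : iedge x =1 iedge y -> x = y.
Proof.
case: x y => [f Pf] [g Pg] /= /funext fg; subst g.
by congr exist; exact: Prop_irrelevance.
Qed.

Lemma finpath_eq mu nu : fsrc mu = fsrc nu -> fedges mu = fedges nu -> mu = nu.
Proof.
by case: mu nu => [[v p] Pp] [[w q] Pq]; rewrite /fsrc /fedges /= => vw pq;
  apply: val_inj; rewrite /= vw pq.
Qed.

Definition ivert x n : vertex E := src (iedge x n).

Lemma iedgeS x n : tgt (iedge x n) = ivert x n.+1.
Proof. exact: (svalP x). Qed.

Lemma shift_proof x n i : tgt (iedge x (n + i)%N) = src (iedge x (n + i.+1)%N).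
Proof. by rewrite iedgeS addnS. Qed.

Definition ishift n x : ipath E :=
  exist _ (fun i => iedge x (n + i)%N) (@shift_proof x n).

Lemma iedge_shift n x i : iedge (ishift n x) i = iedge x (n + i)%N.
Proof. by []. Qed.

Lemma isrc_shift n x : isrc (ishift n x) = ivert x n.
Proof. by rewrite /isrc iedge_shift addn0. Qed.

Lemma shift0 x : ishift 0 x = x.
Proof. by apply: ipath_eq => i; rewrite iedge_shift. Qed.

Lemma shift_shift m n x : ishift m (ishift n x) = ishift (n + m) x.
Proof. by apply: ipath_eq => i; rewrite !iedge_shift addnA. Qed.

Lemma ivert_shift m n x : ivert (ishift m x) n = ivert x (m + n).
Proof. by []. Qed.

Lemma is_path_mkseq x n m : is_path (ivert x m) (mkseq (fun i => iedge x (m + i)%N) n).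
Proof.
elim: n m => // n IH m; rewrite /mkseq /= -[1%N]addn0 iotaDl -map_comp addn0 eqxx /= iedgeS.
by under eq_map do rewrite /= add1n addnS -addSn; exact: IH.
Qed.

Definition ipre x n : finpath E :=
  exist (fun p : vertex E * seq (edge E) => is_path p.1 p.2)
    (isrc x, mkseq (iedge x) n) (is_path_mkseq x n 0).

Lemma fsrc_ipre x n : fsrc (ipre x n) = isrc x. Proof. by []. Qed.
Lemma fedges_ipre x n : fedges (ipre x n) = mkseq (iedge x) n. Proof. by []. Qed.
Lemma flen_ipre x n : flen (ipre x n) = n.
Proof. by rewrite /flen size_mkseq. Qed.

Lemma ftgt_ipre x n : ftgt (ipre x n) = ivert x n.
Proof.
rewrite /ftgt fsrc_ipre fedges_ipre; case: n => // n.
by rewrite mkseqS map_rcons last_rcons iedgeS.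
Qed.

Lemma cylE mu x : cyl mu x <-> ipre x (flen mu) = mu.
Proof.
split=> [[Ex Em]|<-]; first exact: finpath_eq.
by split; rewrite ?flen_ipre.
Qed.

Lemma cyl_ipre x n : cyl (ipre x n) x.
Proof. by apply/cylE; rewrite flen_ipre. Qed.

Lemma ipreP x y n : ipre x n = ipre y n <->
  isrc x = isrc y /\ (forall i, (i < n)%N -> iedge x i = iedge y i).
Proof.
split=> [e|[e1 e2]].
  split=> [|i ilt]; first by rewrite -(fsrc_ipre x n) e.
  have := congr1 (fun mu => nth (iedge x 0) (fedges mu) i) e.
  by rewrite /= !nth_mkseq.
apply: finpath_eq => //; rewrite !fedges_ipre.
by apply/eq_in_map => i; rewrite mem_iota => /e2.
Qed.

Lemma ipre_le x y m n : (m <= n)%N -> ipre x n = ipre y n -> ipre x m = ipre y m.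
Proof.
move=> mn /ipreP[e1 e2]; apply/ipreP; split => // i im; apply: e2.
exact: leq_trans mn.
Qed.

Lemma ipre_eq x y : (forall n, ipre x n = ipre y n) -> x = y.
Proof. by move=> e; apply: ipath_eq => i; have /ipreP[_ ->] := e i.+1. Qed.

Lemma cyl_ipreP x y n : cyl (ipre x n) y <-> ipre y n = ipre x n.
Proof. by rewrite cylE flen_ipre. Qed.

(* junk value z when ftgt mu <> isrc z *)
Definition icat_fun mu z (i : nat) : edge E :=
  if (i < flen mu)%N then nth (iedge z 0) (fedges mu) i
  else iedge z (i - flen mu)%N.

Definition icat mu z : ipath E :=
  if pselect (forall i, tgt (icat_fun mu z i) = src (icat_fun mu z i.+1)) is left H
  then exist _ _ H else z.

Lemma is_path_cat v p q :
  is_path v (p ++ q) = is_path v p && is_path (last v (map (@tgt E) p)) q.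
Proof. by elim: p v => //= e p IH v; rewrite IH andbA. Qed.

Lemma is_path_nth v p e i : is_path v p -> (i < size p)%N ->
  src (nth e p i) = nth v (v :: map tgt p) i.
Proof.
elim: p v i => // f p IH v [|i] /= /andP[/eqP sf pp]; first by [].
rewrite ltnS => ip; rewrite (IH _ _ pp ip) /=.
case: i ip => //= i ip; apply: set_nth_default; rewrite size_map; exact: ltnW.
Qed.

Lemma finpathP mu : is_path (fsrc mu) (fedges mu).
Proof. exact: (valP mu). Qed.

Lemma ftgt_nth mu : ftgt mu = nth (fsrc mu) (fverts mu) (flen mu).
Proof.
by rewrite /ftgt /fverts (last_nth (fsrc mu)) size_map.
Qed.

Lemma iedge_icat mu z i : ftgt mu = isrc z -> iedge (icat mu z) i = icat_fun mu z i.
Proof.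
move=> tmu; rewrite /icat; case: pselect => // -[] j; rewrite /icat_fun.
have [jl|jl] := ltnP.
  have -> : tgt (nth (iedge z 0) (fedges mu) j) = nth (fsrc mu) (fverts mu) j.+1.
    by rewrite /fverts /= (nth_map (iedge z 0)).
  case: (ltnP j.+1) => jl1; first by rewrite (is_path_nth _ (finpathP mu)).
  have -> : j.+1 = flen mu by apply/eqP; rewrite eqn_leq jl1 jl.
  by rewrite subnn -ftgt_nth.
rewrite ltnNge (leq_trans jl)//= subSn//; exact: iedgeS.
Qed.

Lemma iedge_icat_lt mu z i d : ftgt mu = isrc z -> (i < flen mu)%N ->
  iedge (icat mu z) i = nth d (fedges mu) i.
Proof.
by move=> tz il; rewrite iedge_icat// /icat_fun il; apply: set_nth_default.
Qed.

Lemma shift_icat mu z : ftgt mu = isrc z -> ishift (flen mu) (icat mu z) = z.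
Proof.
move=> tz; apply: ipath_eq => i.
by rewrite iedge_shift iedge_icat// /icat_fun ltnNge leq_addr/= addKn.
Qed.

Lemma isrc_icat mu z : ftgt mu = isrc z -> isrc (icat mu z) = fsrc mu.
Proof.
move=> tz; rewrite /isrc iedge_icat// /icat_fun.
have [l0|l0] := ltnP; first by rewrite (is_path_nth _ (finpathP mu)).
rewrite sub0n; move: tz l0; rewrite ftgt_nth /flen /isrc leqn0 => <- /eqP ->.
by [].
Qed.

Lemma ipre_icat mu z : ftgt mu = isrc z -> ipre (icat mu z) (flen mu) = mu.
Proof.
move=> tz; apply: finpath_eq; first by rewrite fsrc_ipre isrc_icat.
rewrite fedges_ipre; apply: (@eq_from_nth _ (iedge z 0)); rewrite size_mkseq// => i il.
by rewrite nth_mkseq// (iedge_icat_lt (iedge z 0)).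
Qed.

Lemma cyl_icat mu z : ftgt mu = isrc z -> cyl mu (icat mu z).
Proof. by move=> tz; apply/cylE/ipre_icat. Qed.

Lemma cyl_tgt mu x : cyl mu x -> ftgt mu = isrc (ishift (flen mu) x).
Proof. by move/cylE => {1}<-; rewrite ftgt_ipre isrc_shift. Qed.

Lemma icat_unique mu x z : cyl mu x -> ishift (flen mu) x = z -> x = icat mu z.
Proof.
move=> cx xz; have tz : ftgt mu = isrc z by rewrite -xz; exact: cyl_tgt.
apply: ipath_eq => i; have [il|il] := ltnP i (flen mu).
  by have /ipreP[_] : ipre x (flen mu) = ipre (icat mu z) (flen mu);
    [rewrite ipre_icat//; exact/cylE|exact].
rewrite -(subnKC il) -!iedge_shift xz shift_icat//.
Qed.

Lemma icat_shift mu x : cyl mu x -> icat mu (ishift (flen mu) x) = x.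
Proof. by move=> cx; apply/esym/icat_unique. Qed.

(* junk value mu when ftgt mu <> fsrc nu *)
Definition fcat mu nu : finpath E := insubd mu (fsrc mu, fedges mu ++ fedges nu).

Lemma val_fcat mu nu : ftgt mu = fsrc nu ->
  val (fcat mu nu) = (fsrc mu, fedges mu ++ fedges nu).
Proof.
by move=> tn; rewrite /fcat val_insubd /= is_path_cat finpathP -/(ftgt mu) tn finpathP.
Qed.

Lemma fsrc_fcat mu nu : ftgt mu = fsrc nu -> fsrc (fcat mu nu) = fsrc mu.
Proof. by move=> tn; rewrite /fsrc val_fcat. Qed.

Lemma fedges_fcat mu nu : ftgt mu = fsrc nu ->
  fedges (fcat mu nu) = fedges mu ++ fedges nu.
Proof. by move=> tn; rewrite /fedges val_fcat. Qed.

Lemma flen_fcat mu nu : ftgt mu = fsrc nu -> flen (fcat mu nu) = (flen mu + flen nu)%N.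
Proof. by move=> tn; rewrite /flen fedges_fcat// size_cat. Qed.

Lemma ftgt_fcat mu nu : ftgt mu = fsrc nu -> ftgt (fcat mu nu) = ftgt nu.
Proof.
move=> tn; rewrite /ftgt fedges_fcat// fsrc_fcat// map_cat last_cat.
by rewrite -/(ftgt mu) tn.
Qed.

Lemma fverts_fcat mu nu : ftgt mu = fsrc nu ->
  fverts (fcat mu nu) = fverts mu ++ behead (fverts nu).
Proof. by move=> tn; rewrite /fverts fedges_fcat// fsrc_fcat// map_cat. Qed.

Lemma mkseq_addn (T : Type) (f : nat -> T) m n :
  mkseq f (m + n) = mkseq f m ++ mkseq (fun i => f (m + i)%N) n.
Proof. by rewrite /mkseq iotaD map_cat -[X in iota X n]addn0 iotaDl -map_comp. Qed.

Lemma icat_fcat mu nu z : ftgt mu = fsrc nu -> ftgt nu = isrc z ->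
  icat (fcat mu nu) z = icat mu (icat nu z).
Proof.
move=> mn nz; apply/esym.
have tm : ftgt mu = isrc (icat nu z) by rewrite isrc_icat.
apply: icat_unique; last first.
  by rewrite flen_fcat// -shift_shift !shift_icat.
apply/cylE/finpath_eq; first by rewrite fsrc_ipre isrc_icat// fsrc_fcat.
rewrite fedges_ipre fedges_fcat// flen_fcat// mkseq_addn; congr cat.
  by rewrite -fedges_ipre ipre_icat.
rewrite -(ipre_icat nz) flen_ipre fedges_ipre ipre_icat// -[in RHS](shift_icat tm).
exact: eq_map.
Qed.

Lemma cyl_fcat mu nu x : ftgt mu = fsrc nu ->
  cyl (fcat mu nu) x <-> cyl mu x /\ cyl nu (ishift (flen mu) x).
Proof.
move=> mn; split=> [cx|[c1 c2]].
  have tz := cyl_tgt cx; rewrite ftgt_fcat// in tz.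
  rewrite -(icat_shift cx) icat_fcat// shift_icat ?isrc_icat//.
  by split; apply: cyl_icat; rewrite ?isrc_icat.
have tz := cyl_tgt c2.
rewrite -(icat_shift c1) -(icat_shift c2) -icat_fcat//.
by apply: cyl_icat; rewrite ftgt_fcat.
Qed.

Lemma ipreD x m n : ipre x (m + n) = fcat (ipre x m) (ipre (ishift m x) n).
Proof.
have e : ftgt (ipre x m) = fsrc (ipre (ishift m x) n).
  by rewrite ftgt_ipre fsrc_ipre isrc_shift.
have : cyl (fcat (ipre x m) (ipre (ishift m x) n)) x.
  by apply/(cyl_fcat _ e); rewrite flen_ipre; split; apply: cyl_ipre.
by move/cylE; rewrite flen_fcat// !flen_ipre.
Qed.

Lemma cyl_vpath v x : cyl (vpath v) x <-> isrc x = v.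
Proof. by split=> [[]|<-]. Qed.

Lemma isrc_cyl mu x : cyl mu x -> isrc x = fsrc mu.
Proof. by case. Qed.

End PathBasics.

(** * Compactness of the path space *)

Section Fan.
Variable E : digraph.
Implicit Types (mu nu : finpath E) (v w : vertex E) (x y z : ipath E).

Lemma ex_ipath (ns : no_sinks E) v : exists x, isrc x = v.
Proof.
have [nxt nxtP] : {f : vertex E -> edge E & forall u, src (f u) = u}.
  by apply: (@choice _ _ (fun u e => src e = u)) => u; have [e] := ns u; exists e.
pose vs n := iter n (fun u => tgt (nxt u)) v.
have P i : tgt (nxt (vs i)) = src (nxt (vs i.+1)) by rewrite nxtP.
by exists (exist _ (fun i => nxt (vs i)) P); rewrite /isrc/= nxtP.
Qed.

Lemma cyl_neq0 (ns : no_sinks E) mu : exists x, cyl mu x.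
Proof. by have [z zs] := ex_ipath ns (ftgt mu); exists (icat mu z); apply: cyl_icat. Qed.

Lemma finite_paths (rf : row_finite E) v n :
  finite_set [set mu : finpath E | fsrc mu = v /\ flen mu = n].
Proof.
have fin : forall v, finite_set [set p : seq (edge E) | is_path v p /\ size p = n].
  elim: n => [|n IH] u.
    by apply: (sub_finite_set _ (finite_set1 [::])) => p [_ /size0nil].
  apply: (@sub_finite_set _ _ (\bigcup_(e in [set e : edge E | src e = u])
     ((cons e) @` [set p : seq (edge E) | is_path (tgt e) p /\ size p = n]))).
    by move=> [|e p] [] //= /andP[/eqP se pp] [sp]; exists e => //; exists p.
  by apply: bigcup_finite => // e _; exact: finite_image.
apply: (sub_finite_set _ (finite_image (fun p => insubd (vpath v) (v, p)) (fin v))).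
move=> mu [sm lm]; exists (fedges mu).
  by split=> //; rewrite -sm; exact: finpathP.
apply: val_inj; rewrite val_insubd /= -sm finpathP /=.
exact/esym/surjective_pairing.
Qed.

Lemma finite_pathsW (rf : row_finite E) v n :
  finite_set [set mu : finpath E | fsrc mu = v /\ (flen mu < n)%N].
Proof.
apply: (@sub_finite_set _ _ (\bigcup_(i in `I_n)
   [set mu : finpath E | fsrc mu = v /\ flen mu = i])).
  by move=> mu [sm lm]; exists (flen mu).
by apply: bigcup_finite => // i _; exact: finite_paths.
Qed.

(** Edge i is frozen from [u i.+1] on, so the limit reads it off there. *)
Lemma ilim (u : nat -> ipath E) : (forall n, ipre (u n.+1) n = ipre (u n) n) ->
  exists x, forall n, ipre x n = ipre (u n) n.
Proof.
move=> H.
have H' n m : (n <= m)%N -> ipre (u m) n = ipre (u n) n.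
  elim: m => [|m IH]; first by rewrite leqn0 => /eqP ->.
  rewrite leq_eqVlt => /predU1P[->//|]; rewrite ltnS => nm.
  by rewrite -IH//; exact: ipre_le (H m).
have P i : tgt (iedge (u i.+1) i) = src (iedge (u i.+2) i.+1).
  rewrite iedgeS /ivert.
  have /ipreP[_ <-//] := H' i.+2 i.+3 (leqnSn _).
  by have /ipreP[_ e] := H i.+2; rewrite (e i.+1)// -/(ivert (u i.+1) i.+1)
    -[RHS]/(ivert (u i.+2) i.+1) -!iedgeS; have /ipreP[_ ->] := H i.+1.
exists (exist _ (fun i => iedge (u i.+1) i) P) => n; apply/ipreP; split.
  rewrite /isrc/=; have /ipreP[e _] : ipre (u 1%N) 0 = ipre (u n) 0 by rewrite H' // H'.
  exact: e.
move=> i il /=; have /ipreP[_ ->//] : ipre (u n) i.+1 = ipre (u i.+1) i.+1 by rewrite H'.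
Qed.

(** Dependent choice followed by the diagonal limit. [P] need not hold of the limit itself, only of
    some path through each of its prefixes. *)
Lemma ilim_from (P : ipath E -> nat -> Prop) x0 : P x0 0%N ->
  (forall x n, P x n -> exists y, ipre y n = ipre x n /\ P y n.+1) ->
  exists x, forall n, exists y, ipre y n = ipre x n /\ P y n.
Proof.
move=> P0 step.
have [f fP] : {f : ipath E * nat -> ipath E & forall a, P a.1 a.2 ->
    ipre (f a) a.2 = ipre a.1 a.2 /\ P (f a) a.2.+1}.
  apply: (@choice _ _ (fun a y => P a.1 a.2 ->
    ipre y a.2 = ipre a.1 a.2 /\ P y a.2.+1)) => -[x n] /=.
  have [/step [y]|np] := pselect (P x n); first by exists y.
  by exists x.
pose u := fix u n := if n is m.+1 then f (u m, m) else x0.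
have uP n : P (u n) n by elim: n => //= n IH; have [] := fP (u n, n) IH.
have [|x xP] := @ilim u; first by move=> n /=; have [] := fP (u n, n) (uP n).
by exists x => n; exists (u n); split.
Qed.

(** Compactness of Z(v), in the form of König's lemma. A prefix below which no depth is uniform has
    a one-edge extension of the same kind, since otherwise the maximum of finitely many depths would
    be uniform; the limit of such prefixes meets no bar. *)
Theorem fan (rf : row_finite E) v (P : finpath E -> Prop) :
  (forall x m n, (m <= n)%N -> P (ipre x m) -> P (ipre x n)) ->
  (forall x, isrc x = v -> exists n, P (ipre x n)) ->
  exists N, forall x, isrc x = v -> P (ipre x N).
Proof.
move=> Pmon Pbar; apply: contrapT => noN.
pose bad x n := isrc x = v /\
  forall N, exists y, ipre y n = ipre x n /\ ~ P (ipre y N).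
have [[x0 x0v]|nox] := pselect (exists x, isrc x = v); last first.
  by apply: noN; exists 0%N => x xv; case: nox; exists x.
have bad0 : bad x0 0%N.
  split=> // N; apply: contrapT => H; apply: noN; exists N => x xv.
  apply: contrapT => nP; apply: H; exists x; split => //.
  by apply/ipreP; split; rewrite ?xv.
have step x n : bad x n -> exists y, ipre y n = ipre x n /\ bad y n.+1.
  move=> [xv bx]; apply: contrapT => nos.
  have [f fP] : {f : finpath E -> nat & forall mu y,
      ipre y n.+1 = mu -> ipre y n = ipre x n -> P (ipre y (f mu))}.
    apply: (@choice _ _ (fun mu N => forall y,
      ipre y n.+1 = mu -> ipre y n = ipre x n -> P (ipre y N))) => mu.
    apply: contrapT => noNm; apply: nos.
    have H N : exists y, [/\ ipre y n.+1 = mu, ipre y n = ipre x n & ~ P (ipre y N)].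
      apply: contrapT => Hy; apply: noNm; exists N => y y1 y2.
      by apply: contrapT => nP; apply: Hy; exists y.
    have [y [y1 y2 _]] := H 0%N; exists y; split => //; split.
      by rewrite -xv; have /ipreP[] := y2.
    by move=> N; have [z [z1 z2 z3]] := H N; exists z; rewrite y1.
  have /finite_seqP[s sP] := @finite_paths rf v n.+1.
  have [y [y1]] := bx (\max_(mu <- s) f mu)%N; apply.
  have yv : isrc y = v by rewrite -xv; have /ipreP[] := y1.
  apply: (Pmon _ (f (ipre y n.+1))); last exact: fP.
  have ys : ipre y n.+1 \in s.
    have : [set` s] (ipre y n.+1) by rewrite -sP /= fsrc_ipre flen_ipre.
    by [].
  exact: leq_bigmax_seq.
have [x xP] := ilim_from bad0 step.
have xv : isrc x = v.
  by have [y [y1 [yv _]]] := xP 0%N; rewrite -yv; have /ipreP[-> ] := y1.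
have [n Pn] := Pbar x xv; have [y [y1 [_ by_]]] := xP n.
by have [z [z1]] := by_ n; rewrite z1 y1.
Qed.

End Fan.

(** * Cycles and first returns *)

Section Cycles.
Variable E : digraph.
Hypothesis ns : no_sinks E.
Implicit Types (mu nu : finpath E) (v w : vertex E) (x y z : ipath E).

Lemma ivert_ipre x y n i : ipre x n = ipre y n -> (i <= n)%N -> ivert x i = ivert y i.
Proof.
by move=> e il; rewrite -!ftgt_ipre (ipre_le il e).
Qed.

Lemma fverts_ipre x n : fverts (ipre x n) = mkseq (ivert x) n.+1.
Proof.
rewrite /fverts fsrc_ipre fedges_ipre /mkseq /= -[in RHS]/(isrc x); congr cons.
rewrite -[1%N]addn0 iotaDl -!map_comp; apply: eq_map => i /=.
by rewrite iedgeS add1n.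
Qed.

Lemma mem_fverts_ipre x n w :
  w \in fverts (ipre x n) <-> exists2 i, (i <= n)%N & w = ivert x i.
Proof.
rewrite fverts_ipre; split.
  by move=> /mapP[k]; rewrite mem_iota add0n ltnS => kl ->; exists k.
by move=> [k kl ->]; apply/mapP; exists k => //; rewrite mem_iota add0n ltnS.
Qed.

Lemma is_cycle_ipre x n : is_cycle (ipre x n) <-> (0 < n)%N /\ ivert x n = isrc x.
Proof. by rewrite /is_cycle flen_ipre fsrc_ipre ftgt_ipre; split=> -[-> ->]. Qed.

Lemma first_return_ipre v x n : first_return v (ipre x n) <->
  [/\ isrc x = v, (0 < n)%N, ivert x n = v &
      forall j, (0 < j < n)%N -> ivert x j <> v].
Proof.
have nthE i : (i < n)%N -> nth v (map tgt (fedges (ipre x n))) i = ivert x i.+1.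
  move=> il; rewrite (nth_map (iedge x 0)) ?size_mkseq//.
  by rewrite nth_mkseq// iedgeS.
rewrite /first_return flen_ipre fsrc_ipre; split.
  move=> [/is_cycle_ipre[n0 xn] xv H]; split => //; first by rewrite xn.
  move=> [|j]// /andP[_ jn] jv; have := H j (ltnW jn).
  by rewrite nthE ?(ltnW jn)// => -[+ _] => /(_ jv) jn'; rewrite jn' ltnn in jn.
move=> [xv n0 xn H]; split => //; first by apply/is_cycle_ipre; rewrite xn xv.
move=> i il; rewrite nthE//; split=> [iv|-> //].
by apply/eqP; rewrite eqn_leq il leqNgt; apply/negP => in'; apply: (H i.+1).
Qed.

Lemma first_return_exists x v n : isrc x = v -> (0 < n)%N -> ivert x n = v ->
  exists2 k, (k <= n)%N & first_return v (ipre x k).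
Proof.
move=> xv n0 xn.
have ex : exists k, (0 < k)%N && (ivert x k == v) by exists n; rewrite n0 xn eqxx.
case: (ex_minnP ex) => k /andP[k0 /eqP kv] kmin.
exists k; first by apply: kmin; rewrite n0 xn eqxx.
apply/first_return_ipre; split => // j /andP[j0 jk] jv.
by have := kmin j; rewrite j0 jv eqxx leqNgt jk => /(_ isT).
Qed.

Lemma ipath_power mu : is_cycle mu -> exists x, cyl mu x /\ ishift (flen mu) x = x.
Proof.
move=> [l0 st].
have [z zs] := ex_ipath ns (ftgt mu).
pose y := icat mu z; have yc : cyl mu y by apply: cyl_icat.
have ye : ivert y (flen mu) = ivert y 0 by rewrite -ftgt_ipre (cylE _ _).1// -st -(isrc_cyl yc).
have P i : tgt (iedge y (i %% flen mu)) = src (iedge y (i.+1 %% flen mu)).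
  have -> : (i.+1 %% flen mu = (i %% flen mu).+1 %% flen mu)%N.
    by rewrite -[in RHS]addn1 modnDml addn1.
  rewrite iedgeS -/(ivert y _).
  have := ltn_pmod i l0; rewrite leq_eqVlt => /predU1P[->|il].
    by rewrite modnn ye.
  by rewrite (modn_small il).
pose x : ipath E := exist _ (fun i => iedge y (i %% flen mu)) P.
exists x; split; last by apply: ipath_eq => i; rewrite iedge_shift /x/= modnDl.
apply/cylE; rewrite -[RHS](proj1 (cylE _ _) yc); apply/ipreP; split.
  by rewrite /isrc /x /= mod0n.
by move=> i il; rewrite /x /= (modn_small il).
Qed.

Lemma shift_mul l k x : ishift l x = x -> ishift (l * k) x = x.
Proof. by move=> lx; elim: k => [|k IH]; rewrite ?muln0 ?shift0// mulnS -shift_shift lx. Qed.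

(** Rotating a cycle moves its base to any of its vertices; on the infinite power of the cycle,
    rotation is a shift. *)
Lemma on_cycleP w :
  on_cycle E w <-> exists y n, [/\ isrc y = w, (0 < n)%N & ivert y n = w].
Proof.
split=> [[mu [cmu wmu]]|[y [n [yw n0 yn]]]]; last first.
  exists (ipre y n); split; first by apply/is_cycle_ipre; rewrite yn.
  by apply/mem_fverts_ipre; exists 0%N.
have [x [/cylE xmu xl]] := ipath_power cmu; have [l0 _] := cmu.
move: wmu; rewrite -xmu => /mem_fverts_ipre[i il ->].
exists (ishift i x), (flen mu); rewrite isrc_shift; split => //.
by rewrite ivert_shift addnC -ivert_shift xl.
Qed.

Lemma V2_on_cycle w : V2 E w -> on_cycle E w.
Proof. by move=> [mu [_ [_ [cmu sw _] _]]]; exists mu; split=> //; rewrite -sw mem_head. Qed.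

Lemma on_cycle_V2 w : condK E -> on_cycle E w -> V2 E w.
Proof.
move=> K /on_cycleP[y [n [yw n0 yn]]].
have [k _ fr] := first_return_exists yw n0 yn.
apply: contrapT => nV2; have : V1 E w; last by rewrite K.
exists (ipre y k); split => // nu frnu; apply: contrapT => ne.
by apply: nV2; exists nu, (ipre y k).
Qed.

Lemma cond_decompositionS (P Q : vertex E -> Prop) : (forall w, P w -> Q w) ->
  cond_decomposition P -> cond_decomposition Q.
Proof.
move=> PQ H v; have [n [beta [b1 b2 b3]]] := H v; exists n, beta; split => // i.
by have [alpha [a1 a2 [w wa /PQ Qw]]] := b3 i; exists alpha; split => //; exists w.
Qed.

Lemma condK_DI_DL : condK E -> condDI E <-> condDL E.
Proof.
by move=> K; split; apply: cond_decompositionS => w;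
  [exact: V2_on_cycle|exact: on_cycle_V2].
Qed.

(** Every vertex along y can reach v. Unlike being a power of a cycle at v, this visibly survives an
    exchange of prefixes. *)
Definition returns v y :=
  forall n, exists z m, [/\ ipre z n = ipre y n, (n <= m)%N & ivert z m = v].

(** Let n be the first index where y and y' differ and j the last visit to v up to n. Both paths
    continue from j to first returns of length greater than n - j. Uniqueness makes these the same
    cycle, so the edges at n agree after all. *)
Lemma V1_unique v y y' : V1 E v -> isrc y = v -> isrc y' = v ->
  returns v y -> returns v y' -> y = y'.
Proof.
move=> [mu [_ muU]] yv y'v ry ry'; apply: contrapT => nyy'.
have ex : exists n, iedge y n != iedge y' n.
  apply: contrapT => H; apply/nyy'/ipath_eq => i; apply/eqP/negPn/negP => ne.
  by apply: H; exists i.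
case: (ex_minnP ex) => n /eqP yn nmin {ex}.
have yy' : ipre y n = ipre y' n.
  apply/ipreP; split; first by rewrite yv.
  by move=> i il; apply/eqP/negPn/negP => /nmin; rewrite leqNgt il.
have exj : exists j, (j <= n)%N && (ivert y j == v).
  by exists 0%N; rewrite -[ivert y 0]/(isrc y) yv eqxx.
have bj i : (i <= n)%N && (ivert y i == v) -> (i <= n)%N by case/andP.
have [j /andP[jn /eqP jv] jmax] := ex_maxnP exj bj.
have main u : ipre u n = ipre y n -> returns v u ->
    exists (w : ipath E) k, [/\ first_return v (ipre (ishift j w) k), (n - j < k)%N &
      iedge w n = iedge u n].
  move=> un ru; have [w [m [wu nm wm]]] := ru n.+1.
  have wy : ipre w n = ipre y n by rewrite -un; apply: ipre_le wu.
  have jvw : isrc (ishift j w) = v by rewrite isrc_shift (ivert_ipre wy).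
  have [|||k kle frk] := @first_return_exists (ishift j w) v (m - j) => //.
  - by rewrite subn_gt0; apply: leq_ltn_trans nm.
  - by rewrite ivert_shift subnKC// (leq_trans jn)// ltnW.
  exists w, k; split => //; last by have /ipreP[_ ->] := wu.
  rewrite ltnNge; apply/negP => kn.
  have /first_return_ipre[_ k0 + _] := frk; rewrite ivert_shift.
  have jkn : (j + k <= n)%N by rewrite -leq_subRL.
  rewrite (ivert_ipre wy)// => /eqP jkv; have := jmax (j + k)%N.
  by rewrite jkn jkv => /(_ isT); rewrite -[leqRHS]addn0 leq_add2l leqNgt k0.
have [w [k [/muU fw kw ew]]] := main y erefl ry.
have [w' [k' [/muU fw' kw' ew']]] := main y' (esym yy') ry'.
have kk' : k = k' by rewrite -(flen_ipre (ishift j w) k) fw -fw' flen_ipre.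
subst k'; apply: yn; rewrite -ew -ew' -[in LHS](subnKC jn) -[in RHS](subnKC jn).
have /ipreP[_ H] : ipre (ishift j w) k = ipre (ishift j w') k by rewrite fw fw'.
exact: H.
Qed.

Lemma V1_path v : V1 E v -> exists x l,
  [/\ isrc x = v, returns v x, (0 < l)%N & ishift l x = x].
Proof.
move=> [mu [[cmu sv _] _]]; have [x [xc xl]] := ipath_power cmu.
have [l0 _] := cmu; exists x, (flen mu); rewrite (isrc_cyl xc) sv; split=> // n.
exists x, (flen mu * n)%N; split=> //; first by rewrite leq_pmull.
by rewrite -isrc_shift shift_mul// (isrc_cyl xc).
Qed.

Lemma returns_swap v (a b : finpath E) z : ftgt a = isrc z -> ftgt b = isrc z ->
  returns v (icat a z) -> returns v (icat b z).
Proof.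
move=> az bz ra n; have [u [m [u1 u2 u3]]] := ra (flen a + n)%N.
have ua : ipre u (flen a) = a by rewrite (ipre_le _ u1) ?leq_addr// ipre_icat.
have uz : ipre (ishift (flen a) u) n = ipre z n.
  apply/ipreP; split => [|i il].
    by rewrite -(cyl_tgt (x := u))//; apply/cylE.
  by rewrite iedge_shift; have /ipreP[_ ->] := u1; rewrite ?ltn_add2l// -iedge_shift shift_icat.
have bu : ftgt b = isrc (ishift (flen a) u) by have /ipreP[->] := uz.
exists (icat b (ishift (flen a) u)), (flen b + (m - flen a))%N; split.
- apply: (@ipre_le _ _ _ _ (flen b + n)); first exact: leq_addl.
  by rewrite !ipreD !ipre_icat// !shift_icat// uz.
- by rewrite -leq_subLR; lia.
- by rewrite -ivert_shift shift_icat// ivert_shift subnKC//; lia.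
Qed.

End Cycles.

(** * Stable vertices *)

Lemma finite_set_seq (T : choiceType) (A : set T) : finite_set A ->
  exists2 s : seq T, uniq s & forall x, x \in s <-> A x.
Proof.
move=> fA; exists (enum_fset (fset_set A)); first exact: fset_uniq.
by move=> x; rewrite in_fset_set// in_setE.
Qed.

Section StableSets.
Variable E : digraph.
Hypotheses (rf : row_finite E) (ns : no_sinks E).
Implicit Types (mu nu : finpath E) (v w : vertex E) (x y z : ipath E).

(** Normalised counting on C is a probability measure on Z(v) that is invariant under the prefix
    exchanges listed in Pi. *)
Definition stable_set v (Pi : seq (finpath E * finpath E)) (C : seq (ipath E)) :=
  [/\ uniq C, C != [::], (forall y, y \in C -> isrc y = v) &
      forall a b z, (a, b) \in Pi \/ (b, a) \in Pi -> ftgt a = isrc z ->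
        ftgt b = isrc z -> fsrc a = v -> fsrc b = v -> icat a z \in C -> icat b z \in C].

(** Replacing the prefix a by b injects the part of C in Z(a) into the part in Z(b). *)
Lemma stable_count_le v Pi C a b : stable_set v Pi C ->
  (a, b) \in Pi \/ (b, a) \in Pi -> ftgt a = ftgt b -> fsrc a = v -> fsrc b = v ->
  (count (fun y => `[< cyl a y >]) C <= count (fun y => `[< cyl b y >]) C)%N.
Proof.
move=> [uC _ _ sC] ab tab av bv; rewrite -!size_filter.
rewrite -(size_map (fun y => icat b (ishift (flen a) y))).
apply: uniq_leq_size.
  rewrite map_inj_in_uniq ?filter_uniq// => y1 y2.
  rewrite !mem_filter => /andP[/asboolP c1 _] /andP[/asboolP c2 _] e.
  rewrite -(icat_shift c1) -(icat_shift c2); congr icat.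
  have t1 := cyl_tgt c1; have t2 := cyl_tgt c2.
  have := congr1 (ishift (flen b)) e.
  by rewrite !shift_icat// -tab.
move=> _ /mapP[y + ->]; rewrite !mem_filter => /andP[/asboolP c1 yC].
have tb : ftgt b = isrc (ishift (flen a) y) by rewrite -tab; exact: cyl_tgt.
apply/andP; split; first by apply/asboolP; exact: cyl_icat.
by apply: (sC a) => //; [exact: cyl_tgt|rewrite icat_shift].
Qed.

Lemma stable_count v Pi C a b : stable_set v Pi C ->
  (a, b) \in Pi -> ftgt a = ftgt b -> fsrc a = v -> fsrc b = v ->
  count (fun y => `[< cyl a y >]) C = count (fun y => `[< cyl b y >]) C.
Proof.
move=> sC ab tab av bv; apply/eqP; rewrite eqn_leq.
by apply/andP; split; apply: (stable_count_le sC) => //; [left|right].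
Qed.

(** C may depend on Pi: a set closed under all exchanges would contain whole orbits, which may be
    infinite. *)
Definition stable_vertex v := forall Pi, exists C, stable_set v Pi C.

(** The power of the unique first-return cycle is the only path from v along which v stays
    reachable, and exchanges preserve that property; so this single point is fixed by all of
    them. *)
Lemma V1_stable v : V1 E v -> stable_vertex v.
Proof.
move=> v1 Pi; have [x [l [xv rx _ _]]] := V1_path ns v1.
exists [:: x]; split => // [y|a b z _ az bz av bv]; first by rewrite mem_seq1 => /eqP ->.
rewrite !mem_seq1 => /eqP ax; apply/eqP; apply: (V1_unique v1) => //.
- by rewrite isrc_icat.
- by apply: returns_swap az bz _; rewrite ax.
Qed.

Definition through (P : vertex E -> Prop) v u := exists alpha : finpath E,
  [/\ fsrc alpha = v, ftgt alpha = u & exists2 w, w \in fverts alpha & P w].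

Lemma through_trans P v u mu : through P v u -> fsrc mu = u -> through P v (ftgt mu).
Proof.
move=> [a [av au [w wa Pw]]] mu_u; have e : ftgt a = fsrc mu by rewrite au.
exists (fcat a mu); rewrite fsrc_fcat// ftgt_fcat//; split => //.
by exists w => //; rewrite fverts_fcat// mem_cat wa.
Qed.

Lemma through_ipre P y n i : (i <= n)%N -> P (ivert y i) -> through P (isrc y) (ivert y n).
Proof.
move=> il Pi; exists (ipre y n); rewrite ftgt_ipre; split => //.
by exists (ivert y i) => //; apply/mem_fverts_ipre; exists i.
Qed.

(** The fan theorem makes the bar uniform, at some depth N; the pieces are then all paths of length
    N from v. *)
Lemma bar_decomposition P v :
  (forall x, isrc x = v -> exists n, through P v (ivert x n)) ->
  exists (n : nat) (beta : 'I_n -> finpath E),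
    [/\ cyl (vpath v) = \bigcup_i cyl (beta i),
        trivIset setT (fun i => cyl (beta i)) &
        forall i, exists alpha : finpath E,
          [/\ fsrc alpha = v, ftgt alpha = ftgt (beta i) &
              exists2 w, w \in fverts alpha & P w]].
Proof.
move=> bar.
have [||N NP] := @fan E rf v (fun mu => through P v (ftgt mu)).
- move=> x m n mn; rewrite !ftgt_ipre => tm.
  have /(through_trans tm) : fsrc (ipre (ishift m x) (n - m)) = ivert x m.
    by rewrite fsrc_ipre isrc_shift.
  by rewrite ftgt_ipre ivert_shift subnKC.
- by move=> x /bar[n xn]; exists n; rewrite ftgt_ipre.
have [s us sE] := finite_set_seq (@finite_paths E rf v N).
exists (size s), (fun i => nth (vpath v) s i); split.
- apply/seteqP; split => x.
    move/cyl_vpath => xv; have xs : ipre x N \in s by apply/sE; split => //; exact: flen_ipre.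
    have xl : (index (ipre x N) s < size s)%N by rewrite index_mem.
    exists (Ordinal xl) => //=; rewrite nth_index//; exact: cyl_ipre.
  by move=> [k _ /= ck]; apply/cyl_vpath; rewrite (isrc_cyl ck);
    have [] := proj1 (sE _) (mem_nth (vpath v) (ltn_ord k)).
- move=> k l _ _ [x [/= ck cl]]; apply/val_inj/eqP => /=.
  rewrite -(nth_uniq (vpath v) (ltn_ord k) (ltn_ord l) us).
  have [_ lk] := proj1 (sE _) (mem_nth (vpath v) (ltn_ord k)).
  have [_ ll] := proj1 (sE _) (mem_nth (vpath v) (ltn_ord l)).
  by move: ck cl => /cylE <- /cylE <-; rewrite lk ll.
- move=> k; have [kv lk] := proj1 (sE _) (mem_nth (vpath v) (ltn_ord k)).
  have [x cx] := cyl_neq0 ns (nth (vpath v) s k).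
  have := NP x; rewrite (isrc_cyl cx) -lk => /(_ kv).
  by have /cylE -> := cx.
Qed.

Lemma edge_repeat_on_cycle y i j : (i < j)%N -> iedge y i = iedge y j ->
  on_cycle E (ivert y i).
Proof.
move=> ij e; apply/on_cycleP => //; exists (ishift i y), (j - i)%N.
by rewrite isrc_shift ivert_shift subn_gt0 (subnKC (ltnW ij)) /ivert e.
Qed.

(** A repeated edge would close a cycle on the way. *)
Lemma not_through_uniq y n : ~ through (on_cycle E) (isrc y) (ivert y n) ->
  uniq (mkseq (iedge y) n).
Proof.
move=> nt; apply/negPn/negP => /(uniqPn (iedge y 0))[i [j [ij jn]]].
rewrite size_mkseq in jn; rewrite !nth_mkseq ?(ltn_trans ij)// => e.
apply: nt; apply: (@through_ipre _ y n i); first by rewrite ltnW// (ltn_trans ij).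
exact: edge_repeat_on_cycle ij e.
Qed.

(** Let F collect the edges of all paths in Pi. The edges of x are distinct, so some first one, at
    index m, lies outside F. Take for C all g z0 with z0 the tail of x from m and g a path in F from
    v to the start of z0. Such g repeat no edge, so there are finitely many, and an exchange only
    alters g. *)
Lemma bar_failure_stable v x : isrc x = v ->
  (forall n, ~ through (on_cycle E) v (ivert x n)) -> stable_vertex v.
Proof.
move=> xv nt Pi.
pose F := flatten [seq fedges p.1 ++ fedges p.2 | p <- Pi].
have FP a b : (a, b) \in Pi \/ (b, a) \in Pi -> {subset fedges a <= F}.
  move=> ab e ea; apply/flattenP; case: ab => ab.
    by exists (fedges a ++ fedges b); rewrite ?mem_cat ?ea//; exact: (map_f _ ab).
  by exists (fedges b ++ fedges a); rewrite ?mem_cat ?ea ?orbT//; exact: (map_f _ ab).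
have ex : exists m, iedge x m \notin F.
  apply: contrapT => H.
  have uq : uniq (mkseq (iedge x) (size F).+1).
    by apply: not_through_uniq; rewrite xv; exact: nt.
  have sub : {subset mkseq (iedge x) (size F).+1 <= F}.
    by move=> _ /mapP[k _ ->]; apply/negPn/negP => kF; apply: H; exists k.
  by have := uniq_leq_size uq sub; rewrite size_mkseq ltnn.
case: (ex_minnP ex) => m mF mmin {ex}; set z0 := ishift m x.
pose Gam := [set mu | [/\ fsrc mu = v, ftgt mu = ivert x m & {subset fedges mu <= F}]].
have z0s : isrc z0 = ivert x m by rewrite isrc_shift.
have : finite_set Gam.
  apply: sub_finite_set (@finite_pathsW E rf v (size F).+1).
  move=> g [gv gm gF]; split => //; rewrite ltnS; apply: uniq_leq_size => //.
  have gz : ftgt g = isrc z0 by rewrite gm.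
  have := @not_through_uniq (icat g z0) (flen g).
  rewrite -[in uniq _]fedges_ipre ipre_icat//; apply.
  by rewrite isrc_icat// -ftgt_ipre ipre_icat// gv gm.
move=> /finite_set_seq[s _ sE].
exists (undup [seq icat g z0 | g <- s]); split.
- exact: undup_uniq.
- suff : x \in undup [seq icat g z0 | g <- s] by case: undup.
  rewrite mem_undup; apply/mapP; exists (ipre x m).
    apply/sE; split; rewrite ?ftgt_ipre//.
    move=> e /mapP[k]; rewrite mem_iota add0n => /andP[_ km] ->.
    by apply/negPn/negP => /mmin; rewrite leqNgt km.
  by rewrite -{1}(icat_shift (cyl_ipre x m)) flen_ipre.
- move=> y; rewrite mem_undup => /mapP[g /sE[gv gm _] ->].
  by rewrite isrc_icat// gm.
- move=> a b z ab az bz av bv; rewrite !mem_undup => /mapP[g /sE[gv gm gF] ag].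
  have gz : ftgt g = isrc z0 by rewrite gm.
  (* Right after g comes an edge outside F, while all edges of a are in F; so a ends no later than
     g. *)
  have lag : (flen a <= flen g)%N.
    rewrite leqNgt; apply/negP => lga.
    have := congr1 (fun y => iedge y (flen g)) ag.
    have -> : iedge (icat g z0) (flen g) = iedge x m.
      by rewrite -[flen g in LHS]addn0 -iedge_shift shift_icat// iedge_shift addn0.
    rewrite (iedge_icat_lt (iedge z 0))// => e; move/negP: mF; apply; rewrite -e.
    by apply: (FP a b ab); exact: mem_nth.
  pose g' := ipre (ishift (flen a) (icat a z)) (flen g - flen a).
  have gag' : g = fcat a g'.
    have := ipreD (icat g z0) (flen a) (flen g - flen a).
    by rewrite subnKC// (ipre_icat gz) -ag ipre_icat.
  have ag' : ftgt a = fsrc g' by rewrite /g' fsrc_ipre shift_icat.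
  have bg' : ftgt b = fsrc g' by rewrite -ag' az bz.
  have g'z : ftgt g' = isrc z0 by rewrite -gz gag' ftgt_fcat.
  apply/mapP; exists (fcat b g').
    apply/sE; split; rewrite ?fsrc_fcat ?ftgt_fcat ?g'z//.
    move=> e; rewrite fedges_fcat// mem_cat => /orP[eb|eg'].
      by apply: (FP b a) eb; case: ab; [right|left].
    by apply: gF; rewrite gag' fedges_fcat// mem_cat eg' orbT.
  rewrite icat_fcat//; congr icat.
  have := congr1 (ishift (flen a)) ag.
  by rewrite shift_icat// gag' icat_fcat// shift_icat// isrc_icat.
Qed.

Theorem not_K_DL_stable : ~ (condK E /\ condDL E) -> exists v, stable_vertex v.
Proof.
move=> H; have [K|nK] := pselect (condK E); last first.
  have [v v1] : exists v, V1 E v.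
    by apply: contrapT => nv; apply: nK; apply/seteqP; split=> // v v1; apply: nv; exists v.
  by exists v; exact: V1_stable.
have [DL|nDL] := pselect (condDL E); first by case: H.
apply: contrapT => nstab; apply: nDL => v; apply: bar_decomposition => x xv.
apply: contrapT => nx; apply: nstab; exists v; apply: (bar_failure_stable xv) => n tn.
by apply: nx; exists n.
Qed.

(** Counting points of C: the two covers of Z(v) total at least 2 |C|, their disjoint copies at most
    |C|, and stability equates the two totals. *)
Lemma paradoxical_not_stable v : paradoxical (vpath v) -> ~ stable_vertex v.
Proof.
move=> [m [n [al [be [ga [de [[tab tgd] [Ub Ud] [sa sg] tri]]]]]]] st.
have src0 mu : cyl mu `<=` cyl (vpath v) -> fsrc mu = v.
  move=> s; have [x cx] := cyl_neq0 ns mu; rewrite -(isrc_cyl cx).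
  exact/cyl_vpath/s.
have bev i : fsrc (be i) = v by apply: src0; rewrite -Ub => x cx; exists i.
have dev i : fsrc (de i) = v by apply: src0; rewrite -Ud => x cx; exists i.
have alv i := src0 _ (sa i); have gav i := src0 _ (sg i).
have [C sC] := st ([seq (al i, be i) | i : 'I_n] ++ [seq (ga j, de j) | j : 'I_m]).
pose cnt mu := count (fun y => `[< cyl mu y >]) C.
have eab i : cnt (al i) = cnt (be i).
  by apply: (stable_count sC) => //; rewrite mem_cat map_f// mem_enum.
have egd i : cnt (ga i) = cnt (de i).
  by apply: (stable_count sC) => //; rewrite mem_cat orbC map_f// mem_enum.
have [uC C0 Cv _] := sC.
have cntE mu : cnt mu = (\sum_(y <- C) `[< cyl mu y >])%N.
  by rewrite /cnt -sum1_count big_mkcond; apply: eq_bigr => y _; case: `[< _ >].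
have cover p (f : 'I_p -> finpath E) : \bigcup_i cyl (f i) = cyl (vpath v) ->
    (size C <= \sum_i cnt (f i))%N.
  move=> fU; under eq_bigr do rewrite cntE; rewrite exchange_big /=.
  rewrite -sum1_size big_seq [leqRHS]big_seq; apply: leq_sum => y /Cv yv.
  have : cyl (vpath v) y by apply/cyl_vpath.
  by rewrite -fU => -[k _ /asboolT ck]; rewrite (bigD1 k)//= ck.
have le2 : (\sum_i cnt (al i) + \sum_j cnt (ga j) <= size C)%N.
  under eq_bigr do rewrite cntE; under [X in (_ + X)%N]eq_bigr do rewrite cntE.
  rewrite exchange_big /= [X in (_ + X)%N]exchange_big /= -big_split /= -sum1_size.
  apply: leq_sum => y _.
  pose f (k : 'I_n + 'I_m) := match k with inl i => cyl (al i) | inr j => cyl (ga j) end.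
  have -> : (\sum_(i < n) `[< cyl (al i) y >] + \sum_(j < m) `[< cyl (ga j) y >] =
      \sum_(k : 'I_n + 'I_m) `[< f k y >])%N by rewrite big_sumType.
  have [[k fk]|nk] := pselect (exists k, f k y).
    rewrite (bigD1 k)//= big1 ?addn0 ?leq_b1// => l lk.
    apply/eqP; rewrite eqb0; apply/asboolP => fl; move/eqP: lk; apply.
    by apply: (tri _ _ I I); exists y.
  by rewrite big1// => k _; apply/eqP; rewrite eqb0; apply/asboolP => fk; apply: nk; exists k.
have := cover _ _ Ub; have := cover _ _ Ud.
under eq_bigr do rewrite -egd; under [X in _ -> (_ <= X)%N -> _]eq_bigr do rewrite -eab.
have : (0 < size C)%N by case: (C) C0.
by move: le2; lia.
Qed.

End StableSets.

(** * The topology of the path space *)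

Section Topology.
Variable E : digraph.
Implicit Types (mu nu : finpath E) (v w : vertex E) (x y z : ipath E).

Lemma open_cyl mu : open (cyl mu).
Proof.
have H : finI_from (range (@cyl E)) id (cyl mu).
  by exists [fset (cyl mu)]%fset; [move=> i /fset1P ->; rewrite in_setE; exists mu|
    apply/seteqP; split => x; [move=> /(_ (cyl mu)); apply; rewrite /= inE|
     move=> cx i /=; rewrite inE => /eqP ->]].
by exists [set cyl mu]; [move=> _ ->|rewrite bigcup_set1].
Qed.

Lemma nbhs_cyl x (U : set (ipath E)) : nbhs x U -> exists n, cyl (ipre x n) `<=` U.
Proof.
rewrite nbhsE => -[B [oB Bx] BU].
suff [n nB] : exists n, cyl (ipre x n) `<=` B by exists n; apply: subset_trans BU.
case: oB => D' sD' BE; move: Bx; rewrite -BE => -[A DA /= Ax].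
have [F FD FA] : finI_from (range (@cyl E)) id A := sD' _ DA.
have key (S : set (ipath E)) : S \in F -> exists n, cyl (ipre x n) `<=` S.
  move=> SF; have := FD S SF; rewrite in_setE => -[mu _ muS].
  have cx : cyl mu x by rewrite muS; move: Ax; rewrite -FA; apply.
  by exists (flen mu); rewrite -muS; have /cylE -> := cx.
suff [n nF] : exists n, forall S, S \in F -> cyl (ipre x n) `<=` S.
  by exists n => y yn; exists A => //; rewrite -FA => S SF; apply: (nF S SF).
have [f fP] : {f : set (ipath E) -> nat & forall S, S \in F -> cyl (ipre x (f S)) `<=` S}.
  apply: (@choice _ _ (fun S n => S \in F -> cyl (ipre x n) `<=` S)) => S.
  by have [/key[n]|] := boolP (S \in F); [exists n|exists 0%N].
exists (\max_(S <- F) f S)%N => S SF; apply: subset_trans (fP S SF) => y /cyl_ipreP e.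
apply/cyl_ipreP; apply: ipre_le e; exact: leq_bigmax_seq.
Qed.

Lemma open_cylP (U : set (ipath E)) :
  (forall x, U x -> exists n, cyl (ipre x n) `<=` U) -> open U.
Proof.
move=> H; rewrite openE => x /H[n nU]; rewrite /interior.
apply: filterS nU _; apply: open_nbhs_nbhs; split; [exact: open_cyl|exact: cyl_ipre].
Qed.

Lemma closed_cylP (D : set (ipath E)) x : closed D ->
  (forall n, exists y, D y /\ ipre y n = ipre x n) -> D x.
Proof.
move=> cD H; apply: cD => U /nbhs_cyl[n nU]; have [y [Dy yn]] := H n.
by exists y; split => //; apply: nU; apply/cyl_ipreP.
Qed.

End Topology.

(** * Arrows as equalities of shifts *)

Section TailEquivalence.
Variable E : digraph.
Implicit Types (mu nu : finpath E) (x y z : ipath E).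

(** Replaces integer indices and absolute values by an equality of two shifts, the form in which
    arrows are handled below. *)
Lemma tail_eqP x k y : tail_eq x k y <->
  exists p q : nat, k = q%:Z - p%:Z /\ ishift p x = ishift q y.
Proof.
split=> [[N [Nk H]]|[p [q [-> H]]]].
  exists N, (absz (N%:Z + k)); split; first by rewrite gez0_abs//; lia.
  apply: ipath_eq => i; rewrite !iedge_shift H ?leq_addr//; congr iedge; lia.
exists p; split; first by lia.
move=> i pi; have -> : absz (i%:Z + (q%:Z - p%:Z)) = (q + (i - p))%N by lia.
by rewrite -iedge_shift -H iedge_shift subnKC.
Qed.

Lemma arrow_eq (g h : path_groupoid E) :
  gr g = gr h -> gk g = gk h -> gd g = gd h -> g = h.
Proof.
case: g h => [x k y P] [x' k' y' P'] /= e1 e2 e3; subst; congr Arrow.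
exact: Prop_irrelevance.
Qed.

Lemma arrowP (g : path_groupoid E) :
  exists p q : nat, gk g = q%:Z - p%:Z /\ ishift p (gr g) = ishift q (gd g).
Proof. exact/tail_eqP/gP. Qed.

Lemma ex_arrow x y p q : ishift p x = ishift q y ->
  exists g : path_groupoid E, [/\ gr g = x, gd g = y & gk g = q%:Z - p%:Z].
Proof.
move=> H; have P : tail_eq x (q%:Z - p%:Z) y by apply/tail_eqP; exists p, q.
by exists (Arrow P).
Qed.

Lemma ginvariant_shift D p q x y : ginvariant D -> ishift p x = ishift q y -> D y -> D x.
Proof. by move=> iD /ex_arrow[g [gx gy _]] Dy; rewrite -gx; apply: iD; rewrite gy. Qed.

Lemma trivial_isotropyP (H : set (path_groupoid E)) x :
  (forall p q, ishift p x = ishift q x -> p = q) -> trivial_isotropy H x.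
Proof.
move=> Hx g _ gx gy; have [p [q [k e]]] := arrowP g.
apply: arrow_eq => //=; rewrite k; move: e; rewrite gx gy => /Hx ->; lia.
Qed.

End TailEquivalence.

(** * Condition (DI) and paradoxical cylinders *)

Section Branching.
Variable E : digraph.
Hypothesis ns : no_sinks E.
Implicit Types (mu nu : finpath E) (v w : vertex E) (x y z : ipath E).

(** There are paths ending at u that follow y for as long as desired and then leave it; their
    cylinders shrink to y without containing it. *)
Definition exits y u := forall d, exists al : finpath E,
  [/\ fsrc al = isrc y, ftgt al = u, cyl al `<=` cyl (ipre y d) & ~ cyl al y].

Lemma first_return_inj v x k k' : first_return v (ipre x k) ->
  first_return v (ipre x k') -> k = k'.
Proof.
move=> /first_return_ipre[_ k0 xk H] /first_return_ipre[_ k0' xk' H'].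
by case: (ltngtP k k') => // kk'; [case: (H' k)|case: (H k')]; rewrite ?k0 ?k0'.
Qed.

(** Turn d times around the first return r1, then leave along r2. *)
Lemma V2_exits w : V2 E w -> exists2 r, isrc r = w & exits r w.
Proof.
move=> [r1 [r2 [ne f1 f2]]].
have [c1 s1 _] := f1; have [l10 t1] := c1; have [c2 s2 _] := f2; have [l20 t2] := c2.
have [r [rc rl]] := ipath_power ns c1.
have rw_ : isrc r = w by rewrite (isrc_cyl rc).
exists r => // d.
pose a := ipre r (flen r1 * d).
have aw : ftgt a = w by rewrite ftgt_ipre -isrc_shift shift_mul.
have as2 : ftgt a = fsrc r2 by rewrite aw.
exists (fcat a r2); split.
- by rewrite fsrc_fcat.
- by rewrite ftgt_fcat// -t2.
- move=> x /(cyl_fcat _ as2)[/cyl_ipreP e _]; apply/cyl_ipreP; apply: ipre_le e.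
  exact: leq_pmull.
move=> /(cyl_fcat _ as2)[_]; rewrite flen_ipre shift_mul// => /cylE e.
move: f2; rewrite -e; move: f1; rewrite -((proj1 (cylE _ _)) rc) => f1 f2.
apply: ne; rewrite -e -((proj1 (cylE _ _)) rc).
by rewrite (first_return_inj f1 f2).
Qed.

Lemma exits_fcat r w kap lam : exits r w -> isrc r = w -> ftgt kap = w -> fsrc lam = w ->
  exits (icat kap r) (ftgt lam).
Proof.
move=> er rw_ kw lw d; have [al [a1 a2 a3 a4]] := er d.
have kr : ftgt kap = isrc r by rewrite kw.
have al_ : ftgt al = fsrc lam by rewrite a2.
have ka : ftgt kap = fsrc (fcat al lam) by rewrite fsrc_fcat// a1.
exists (fcat kap (fcat al lam)); split.
- by rewrite fsrc_fcat// isrc_icat.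
- by rewrite !ftgt_fcat.
- move=> x /(cyl_fcat _ ka)[xk /(cyl_fcat _ al_)[/a3/cyl_ipreP xa _]].
  apply/cyl_ipreP; rewrite -(icat_shift xk); apply: (@ipre_le _ _ _ _ (flen kap + d)).
    exact: leq_addl.
  have xk' := cyl_tgt xk.
  by rewrite !ipreD !ipre_icat// !shift_icat// xa.
- by move=> /(cyl_fcat _ ka)[_ ]; rewrite shift_icat// => /(cyl_fcat _ al_)[].
Qed.

(** The path y follows mu, goes on to the vertex w in V^2 and then turns around one cycle at w
    forever; each exit at w is continued to u. *)
Lemma through_V2_exits v u mu : through (V2 E) v u -> ftgt mu = v ->
  exists y, cyl mu y /\ exits y u.
Proof.
move=> [a [av au [w wa v2w]]] muv.
have [x ax] := cyl_neq0 ns a.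
move: wa; rewrite -(proj1 (cylE _ _) ax) => /mem_fverts_ipre[k kl wk].
have [r rw_ er] := V2_exits v2w.
pose kap := ipre x k; pose lam := ipre (ishift k x) (flen a - k).
have kw : ftgt kap = w by rewrite ftgt_ipre.
have lw : fsrc lam = w by rewrite fsrc_ipre isrc_shift.
have lu : ftgt lam = u.
  by rewrite ftgt_ipre ivert_shift subnKC// -ftgt_ipre (proj1 (cylE _ _) ax).
have mk : ftgt mu = fsrc kap by rewrite fsrc_ipre (isrc_cyl ax) muv.
have mkw : ftgt (fcat mu kap) = w by rewrite ftgt_fcat.
exists (icat (fcat mu kap) r); split.
  have : cyl (fcat mu kap) (icat (fcat mu kap) r) by apply: cyl_icat; rewrite mkw.
  by move/(cyl_fcat _ mk) => [].
by rewrite -lu; apply: exits_fcat er _ _ _.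
Qed.

(** Induction on l, where the same point may occur several times. Avoiding all of Y is part of the
    claim because it leaves room near y for the next cylinder. *)
Lemma choose_disjoint (Y : seq (ipath E)) mu (l : seq (ipath E * vertex E)) :
  (forall p, p \in l -> [/\ p.1 \in Y, cyl mu p.1 & exits p.1 p.2]) ->
  exists al : seq (finpath E), [/\ map (@ftgt E) al = map snd l,
    (forall a, a \in al -> cyl a `<=` cyl mu /\ forall y, y \in Y -> ~ cyl a y) &
    forall i j x, (i < size al)%N -> (j < size al)%N ->
      cyl (nth mu al i) x -> cyl (nth mu al j) x -> i = j].
Proof.
elim: l => [|[y u] l IH] H; first by exists [::].
have [|al [a1 a2 a3]] := IH; first by move=> p pl; apply: H; rewrite inE pl orbT.
have [/= yY ymu ey] := H (y, u) (mem_head _ _).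
have [f fP] : {f : ipath E -> nat & forall y', y' <> y -> ipre y' (f y') <> ipre y (f y')}.
  apply: (@choice _ _ (fun y' n => y' <> y -> ipre y' n <> ipre y n)) => y'.
  have [e|ne] := pselect (exists n, ipre y' n <> ipre y n).
    by have [n ne] := e; exists n.
  by exists 0%N => nyy; case: nyy; apply: ipre_eq => n; apply: contrapT => e; apply: ne; exists n.
(* A cylinder of this depth around y lies in Z(mu), misses the earlier choices, which do not contain
   y, and misses the other points of Y. *)
pose d := maxn (flen mu) (maxn (\max_(a <- al) flen a) (\max_(y' <- Y) f y'))%N.
have [a [as_ at_ ac ay]] := ey d.
have adisj b x : b \in al -> cyl a x -> cyl b x -> False.
  move=> bal /ac /cyl_ipreP xy /cylE xb; have [_ /(_ y yY)] := a2 _ bal; apply.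
  apply/cylE; rewrite -[RHS]xb; apply/esym; apply: ipre_le xy.
  have le : (flen b <= \max_(a <- al) flen a)%N by exact: leq_bigmax_seq.
  by rewrite !leq_max le orbT.
exists (a :: al); split.
- by rewrite /= a1 at_.
- move=> b; rewrite inE => /predU1P[->|/a2//]; split.
    move=> x /ac /cyl_ipreP xy; apply/cylE; move/cylE: ymu => <-.
    by rewrite flen_ipre; apply: ipre_le xy; rewrite leq_max leqnn.
  move=> y' y'Y ay'; have [e|ne] := pselect (y' = y); first by apply: ay; rewrite -e.
  apply: (fP _ ne); have /cyl_ipreP e := ac _ ay'; apply: ipre_le e.
  have le : (f y' <= \max_(y' <- Y) f y')%N by exact: leq_bigmax_seq.
  by rewrite !leq_max le !orbT.
- move=> [|i] [|j] x //=; rewrite ?ltnS => ia ja ci cj.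
  + by case: (adisj (nth mu al j) x) => //; exact: mem_nth.
  + by case: (adisj (nth mu al i) x) => //; exact: mem_nth.
  + by congr S; apply: a3 ci cj.
Qed.

(** Sharper than [paradoxical]: both families of copies sit over one disjoint partition, so the sums
    of the corresponding partial isometries are isometries of the corner at p_mu. *)
Definition paradoxical_partition mu n (al be ga : 'I_n -> finpath E) :=
  [/\ forall k, ftgt (al k) = ftgt (be k) /\ ftgt (ga k) = ftgt (be k),
      \bigcup_k cyl (be k) = cyl mu /\ trivIset setT (fun k => cyl (be k)),
      forall k, cyl (al k) `<=` cyl mu /\ cyl (ga k) `<=` cyl mu &
      trivIset setT (fun k : 'I_n + 'I_n =>
        match k with inl k => cyl (al k) | inr k => cyl (ga k) end)].

(** Each piece of Z(mu) has a point of Z(mu) near which small cylinders with the same target as the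
    piece exist. Two are taken for each piece, by listing the points twice, and all are made
    disjoint at once. *)
Lemma DI_paradoxical_partition mu : condDI E ->
  exists n (al be ga : 'I_n -> finpath E), paradoxical_partition mu al be ga.
Proof.
move=> DI; have [n [be [Ub tri thr]]] := DI (ftgt mu).
have bes i : ftgt mu = fsrc (be i).
  have [x cx] := cyl_neq0 ns (be i); rewrite -(isrc_cyl cx); apply/esym/cyl_vpath.
  by rewrite Ub; exists i.
pose be' i := fcat mu (be i).
have Ub' : \bigcup_i cyl (be' i) = cyl mu.
  apply/seteqP; split => [x [k _ /(cyl_fcat _ (bes k))[]//]|x xmu].
  have : cyl (vpath (ftgt mu)) (ishift (flen mu) x) by apply/cyl_vpath/esym/cyl_tgt.
  by rewrite Ub => -[k _ ck]; exists k => //; apply/(cyl_fcat _ (bes k)).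
have [y yP] : {y : 'I_n -> ipath E & forall i, cyl mu (y i) /\ exits (y i) (ftgt (be i))}.
  apply: (@choice _ _ (fun i y => cyl mu y /\ exits y (ftgt (be i)))) => i.
  by apply: through_V2_exits (thr i) _.
pose l0 := [seq (y i, ftgt (be i)) | i <- enum 'I_n].
have [|al [a1 a2 a3]] := @choose_disjoint [seq y i | i <- enum 'I_n] mu (l0 ++ l0).
  move=> p; rewrite mem_cat orbb => /mapP[k _ ->] /=; have [y1 y2] := yP k.
  by split => //; apply: map_f; rewrite mem_enum.
have sz : size al = (n + n)%N.
  by rewrite -(size_map (@ftgt E)) a1 /l0 size_map size_cat size_map size_enum_ord.
have aE k : (k < n + n)%N -> ftgt (nth mu al k) = nth (ftgt mu) (map snd (l0 ++ l0)) k.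
  by move=> kn; rewrite -a1 (nth_map mu) ?sz.
have l0E (i : 'I_n) : nth (ftgt mu) (map snd l0) i = ftgt (be i).
  rewrite (_ : map snd l0 = [seq ftgt (be k) | k <- enum 'I_n]).
    by rewrite (nth_map i) ?nth_ord_enum ?size_enum_ord.
  by rewrite /l0 -map_comp.
have sl0 : size (map snd l0) = n by rewrite /l0 size_map size_map size_enum_ord.
have lt1 (k : 'I_n) : (k < n + n)%N by rewrite ltn_addr.
have lt2 (k : 'I_n) : (n + k < n + n)%N by rewrite ltn_add2l.
exists n, (fun k => nth mu al (nat_of_ord k)), be', (fun k => nth mu al (n + nat_of_ord k)%N).
have sub k : (k < n + n)%N -> cyl (nth mu al k) `<=` cyl mu.
  by move=> kn; have [] := a2 (nth mu al k) _ => //; apply: mem_nth; rewrite sz.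
split.
- move=> k; rewrite ftgt_fcat// !aE ?map_cat ?nth_cat ?sl0 ?ltn_ord ?l0E//; split => //.
  by rewrite ltnNge leq_addr /= addKn l0E.
- split => // k k' _ _ [x [/(cyl_fcat _ (bes k))[_ c1] /(cyl_fcat _ (bes k'))[_ c2]]].
  by apply: tri => //; exists (ishift (flen mu) x).
- by move=> k; split; apply: sub.
- move=> [i|i] [j|j] _ _ [x [/= c1 c2]].
  + by congr inl; apply/val_inj; apply: a3 c1 c2; rewrite sz.
  + by have := a3 _ _ _ _ _ c1 c2; rewrite sz => /(_ (lt1 i) (lt2 j)); have := ltn_ord i; lia.
  + by have := a3 _ _ _ _ _ c1 c2; rewrite sz => /(_ (lt2 i) (lt1 j)); have := ltn_ord j; lia.
  + congr inr; apply/val_inj; have := a3 _ _ _ _ _ c1 c2; rewrite sz => /(_ (lt2 i) (lt2 j)).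
    by move/addnI.
Qed.

Theorem DI_paradoxical mu : condDI E -> paradoxical mu.
Proof.
move=> /(DI_paradoxical_partition mu)[n [al [be [ga [tg [Ub _] sub tri]]]]].
exists n, n, al, be, ga, be; split => //.
- by split => k; have [] := tg k.
- by split => k; have [] := sub k.
Qed.

(* A periodicity of [u x] from position p <= |u| with period q - p determines the
   tail from u, so two different tails cannot both be periodic. *)
Lemma break_period w r s (p q : nat) : (p < q)%N -> isrc r = w -> isrc s = w -> r <> s ->
  forall u : finpath E, ftgt u = w -> (q <= flen u)%N ->
  exists t, (t = r \/ t = s) /\ ishift p (icat u t) <> ishift q (icat u t).
Proof.
move=> pq rw_ sw_ rs u uw qu.
apply: contrapT => H.
have Hr : ishift p (icat u r) = ishift q (icat u r).
  by apply: contrapT => e; apply: H; exists r; split => //; left.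
have Hs : ishift p (icat u s) = ishift q (icat u s).
  by apply: contrapT => e; apply: H; exists s; split => //; right.
apply: rs; suff e : icat u r = icat u s.
  by rewrite -(@shift_icat _ u r) ?uw// e shift_icat// uw.
apply: ipath_eq => i; elim/ltn_ind: i => i IH.
have [iu|ui] := ltnP i (flen u).
  by rewrite !(iedge_icat_lt (iedge r 0)) ?uw.
have per x : ishift p x = ishift q x -> iedge x i = iedge x (p + (i - q)).
  by move=> e; rewrite -iedge_shift e iedge_shift subnKC// (leq_trans qu).
by rewrite (per _ Hr) (per _ Hs) IH//; lia.
Qed.

(** If x0 is not itself aperiodic, its tail is periodic and passes again and again through a vertex
    w on a cycle, where (K) gives two first-return cycles. Turns around them inserted before the
    tail of x0 stay in D by invariance, and their limits by closedness; the turns are chosen to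
    destroy every period. *)
Theorem K_essentially_principal : condK E -> essentially_principal E.
Proof.
move=> K D cD iD x0 Dx0 U /nbhs_cyl[m mU].
suff [x [Dx xm tx]] : exists x, [/\ D x, ipre x m = ipre x0 m &
    forall p q, (p < q)%N -> ishift p x <> ishift q x].
  exists x; split; last by apply: mU; apply/cyl_ipreP.
  split => //; apply: trivial_isotropyP => p q e.
  by case: (ltngtP p q) => // /tx; rewrite e.
have [ap|] := pselect (forall p q, (p < q)%N -> ishift p x0 <> ishift q x0).
  by exists x0.
move=> /existsNP[p0 /existsNP[q0 /not_implyP[pq0 /contrapT e0]]].
pose k0 := maxn m p0; pose w := ivert x0 k0.
have per : ishift k0 x0 = ishift (k0 + (q0 - p0)) x0.
  have k0E : (p0 + (k0 - p0))%N = k0 by rewrite subnKC// leq_maxr.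
  rewrite -{1}k0E -shift_shift e0 shift_shift; congr ishift; lia.
have wc : on_cycle E w.
  apply/on_cycleP => //; exists (ishift k0 x0), (q0 - p0)%N; split.
  - by rewrite isrc_shift.
  - by rewrite subn_gt0.
  - by rewrite ivert_shift -isrc_shift -per isrc_shift.
have [r1 [r2 [ne f1 f2]]] := on_cycle_V2 ns K wc.
have [c1 s1 _] := f1; have [c2 s2 _] := f2.
have [r [rc rl]] := ipath_power ns c1; have [s [sc sl]] := ipath_power ns c2.
have [[l10 t1] [l20 t2]] := (c1, c2).
have rw_ : isrc r = w by rewrite (isrc_cyl rc).
have sw_ : isrc s = w by rewrite (isrc_cyl sc).
have rs : r <> s.
  move=> rs; apply: ne; move: f1 f2; rewrite -(proj1 (cylE _ _) rc) -(proj1 (cylE _ _) sc).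
  by rewrite -rs => f1 f2; rewrite (first_return_inj f1 f2).
(* A Baire-type construction: good prefixes are extended so as to dodge one pair
   of candidate periods at a time. *)
pose good x n := D (icat (ipre x n) (ishift k0 x0)) /\ ivert x n = w.
pose dodge (pq : nat * nat) x n := forall y, ipre y n = ipre x n ->
  (pq.1 < pq.2)%N -> ishift pq.1 y <> ishift pq.2 y.
have ext x n pq : good x n -> exists y n', [/\ (n < n')%N, ipre y n = ipre x n,
    good y n' & dodge pq y n'].
  move=> [Dx xn]; case: pq => p q.
  pose u := fcat (ipre x n) (ipre r (flen r1 * q.+1)).
  have rq : ivert r (flen r1 * q.+1) = w by rewrite -isrc_shift shift_mul.
  have xr : ftgt (ipre x n) = fsrc (ipre r (flen r1 * q.+1)).
    by rewrite ftgt_ipre xn fsrc_ipre.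
  have uw : ftgt u = w by rewrite ftgt_fcat// ftgt_ipre.
  have lu : (n + q < flen u)%N.
    rewrite flen_fcat// !flen_ipre; rewrite -addnS leq_add2l; exact: leq_pmull.
  have [t [tt tP]] : exists t, (t = r \/ t = s) /\
      ((p < q)%N -> ishift p (icat u t) <> ishift q (icat u t)).
    have [pq|] := boolP (p < q)%N; last by exists r; split => //; left.
    have [|t [h1 h2]] := break_period pq rw_ sw_ rs uw; first by lia.
    by exists t.
  have [l [l0 lt]] : exists l, (0 < l)%N /\ ishift l t = t.
    by case: tt => ->; [exists (flen r1)|exists (flen r2)].
  have tw : isrc t = w by case: tt => ->.
  have ut : ftgt u = isrc t by rewrite uw.
  have [N NP] : exists N, (p < q)%N -> forall y, ipre y N = ipre (icat u t) N ->
      ishift p y <> ishift q y.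
    have [pq|] := boolP (p < q)%N; last by exists 0%N.
    have [j jP] : exists j, iedge (icat u t) (p + j) <> iedge (icat u t) (q + j).
      apply: contrapT => H; apply: (tP pq); apply: ipath_eq => j.
      by apply: contrapT => nj; apply: H; exists j.
    exists (q + j).+1 => _ y /ipreP[_ ye] e; apply: jP.
    by rewrite -!ye -?iedge_shift ?e//; lia.
  (* Whole turns around t, so that the prefix ends at w again and is at least N long, which is
     enough to show that the period fails. *)
  pose n' := (flen u + l * N)%N.
  have n'w : ivert (icat u t) n' = w.
    by rewrite -ivert_shift shift_icat// -isrc_shift shift_mul.
  exists (icat u t), n'; split.
  - by rewrite /n'; lia.
  - rewrite icat_fcat// -?[ivert r _]ftgt_ipre ?rq ?tw//; last by rewrite ftgt_ipre rq.
    set z := icat (ipre r _) t; have xz : ftgt (ipre x n) = isrc z.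
      by rewrite isrc_icat// ftgt_ipre rq.
    by have := ipre_icat xz; rewrite flen_ipre.
  - split => //; apply: (@ginvariant_shift E D n' n) iD _ Dx.
    have h1 : ftgt (ipre (icat u t) n') = isrc (ishift k0 x0).
      by rewrite ftgt_ipre isrc_shift n'w.
    have h2 : ftgt (ipre x n) = isrc (ishift k0 x0) by rewrite ftgt_ipre isrc_shift xn.
    by have := shift_icat h1; have := shift_icat h2; rewrite !flen_ipre => -> ->.
  - move=> y ye pq /=; apply: NP => //; apply: ipre_le ye.
    by rewrite /n' (leq_trans (leq_pmull N l0))// leq_addl.
have good0 : good x0 k0.
  split => //; have := icat_shift (cyl_ipre x0 k0); rewrite flen_ipre => -> //.
pose S := {a : ipath E * nat | good a.1 a.2}.
have [f fP] : {f : S * (nat * nat) -> S & forall a, let b := f a in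
   [/\ ((sval a.1).2 < (sval b).2)%N, ipre (sval b).1 (sval a.1).2 = ipre (sval a.1).1 (sval a.1).2
     & dodge a.2 (sval b).1 (sval b).2]}.
  apply: (@choice _ _ (fun (a : S * (nat * nat)) (b : S) =>
   [/\ ((sval a.1).2 < (sval b).2)%N, ipre (sval b).1 (sval a.1).2 = ipre (sval a.1).1 (sval a.1).2
     & dodge a.2 (sval b).1 (sval b).2])) => -[[[x n] gx] pq] /=.
  have [y [n' [nn' yn gy dy]]] := ext x n pq gx.
  by exists (exist _ (y, n') gy).
pose a0 : S := exist _ (x0, k0) good0.
(* Stage k treats the pair with code k; the default [(0, 0)] demands nothing. *)
pose en k : nat * nat := odflt (0%N, 0%N) (choice.unpickle k).
pose a := fix rec n : S := if n is k.+1 then f (rec k, en k) else a0.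
pose len n := (sval (a n)).2; pose pt n := (sval (a n)).1.
have aP n : [/\ (len n < len n.+1)%N, ipre (pt n.+1) (len n) = ipre (pt n) (len n)
     & dodge (en n) (pt n.+1) (len n.+1)].
  exact: (fP (a n, en n)).
have lenn n : (n <= len n)%N.
  by elim: n => // n IH; have [H _ _] := aP n; apply: leq_ltn_trans H.
have [|x xP] := @ilim E pt.
  by move=> n; have [_ H _] := aP n; apply: ipre_le H.
have ptle i j : (i <= j)%N -> ipre (pt j) (len i) = ipre (pt i) (len i).
  elim: j => [|j IH]; first by rewrite leqn0 => /eqP ->.
  rewrite leq_eqVlt => /predU1P[->//|]; rewrite ltnS => ij; rewrite -IH//.
  have [_ H _] := aP j; apply: ipre_le H.
  elim: (j) ij {IH} => [|j' IH]; first by rewrite leqn0 => /eqP ->.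
  rewrite leq_eqVlt => /predU1P[->//|]; rewrite ltnS => /IH H.
  by have [/ltnW H' _ _] := aP j'; apply: leq_trans H'.
have xpt n : ipre x (len n) = ipre (pt n) (len n).
  rewrite xP; have [ij|ij] := leqP n (len n); last by have := lenn n; rewrite leqNgt ij.
  exact: ptle.
exists x; split.
- apply: (closed_cylP cD) => n; have [gD gw] := svalP (a n).
  exists (icat (ipre (pt n) (len n)) (ishift k0 x0)); split => //.
  have h : ftgt (ipre (pt n) (len n)) = isrc (ishift k0 x0).
    by rewrite ftgt_ipre isrc_shift; exact: gw.
  have := ipre_icat h; rewrite flen_ipre => h'.
  by apply: ipre_le (lenn n) _; rewrite h' xpt.
- by apply: ipre_le (xpt 0%N); exact: leq_maxl.
- move=> p q pq; have [_ _] := aP (choice.pickle (p, q)); rewrite /en choice.pickleK /= => H.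
  by apply: (H x) => //; rewrite xpt.
Qed.

End Branching.

(** * Norms with complex values *)

Section RNorm.
Variable R : realType.

Section NormedModule.
Variable V : normedModType R[i].
Implicit Types x y : V.

Lemma rnormE x : `|x| = (rnorm x)%:C.
Proof. by rewrite /rnorm RRe_real// ger0_real. Qed.

Lemma rnorm_ge0 x : 0 <= rnorm x.
Proof. by rewrite -ler0c -rnormE normr_ge0. Qed.

Lemma rnorm0 : rnorm (0 : V) = 0.
Proof. by rewrite /rnorm normr0. Qed.

Lemma rnorm_eq0 x : (rnorm x == 0) = (x == 0).
Proof. by rewrite -[RHS]normr_eq0 rnormE eq_complex /= eqxx andbT. Qed.

Lemma rnormN x : rnorm (- x) = rnorm x.
Proof. by apply: complexI; rewrite -!rnormE normrN. Qed.

Lemma rnormD x y : rnorm (x + y) <= rnorm x + rnorm y.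
Proof. by rewrite -lecR rmorphD /= -!rnormE ler_normD. Qed.

Lemma rnormB x y : rnorm (x - y) <= rnorm x + rnorm y.
Proof. by rewrite -(rnormN y) rnormD. Qed.

Lemma rdistC x y : rnorm (x - y) = rnorm (y - x).
Proof. by rewrite -rnormN opprB. Qed.

Lemma rdist_triangle z x y : rnorm (x - y) <= rnorm (x - z) + rnorm (z - y).
Proof. by rewrite -[x - y](subrKA z) rnormD. Qed.

Lemma rnorm_sum (I : Type) (r : seq I) (P : pred I) (F : I -> V) :
  rnorm (\sum_(i <- r | P i) F i) <= \sum_(i <- r | P i) rnorm (F i).
Proof.
elim/big_rec2 : _ => [|i a x _ IH]; first by rewrite rnorm0.
by apply: (le_trans (rnormD _ _)); rewrite lerD2l.
Qed.

Lemma rnormZ (c : R[i]) x : rnorm (c *: x) = rnorm c * rnorm x.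
Proof.
by apply: complexI; rewrite rmorphM /= -!rnormE normrZ; congr (_ * _); rewrite /rnorm RRe_real// ger0_real.
Qed.

Lemma rnorm_le0_eq x y : (forall e : R, 0 < e -> rnorm (x - y) <= e) -> x = y.
Proof.
move=> H; apply/eqP; rewrite -subr_eq0 -rnorm_eq0 eq_le rnorm_ge0 andbT.
by apply/ler_addgt0Pl => e e0; rewrite addr0 H.
Qed.

Lemma dense_rnorm (S : set V) x (e : R) : dense S -> 0 < e ->
  exists2 y, S y & rnorm (x - y) < e.
Proof.
move=> dS e0; have [||y [yb Sy]] := dS (ball x e%:C).
- by exists x; apply: ballxx; rewrite ltcR.
- exact: ball_open.
exists y => //; move: yb; rewrite -ball_normE /ball_ /= rnormE.
by rewrite ltcR.
Qed.

End NormedModule.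

Lemma rnormM (c d : R[i]) : rnorm (c * d) = rnorm c * rnorm d.
Proof.
have E (z : R[i]) : `|z| = (rnorm z)%:C by rewrite /rnorm RRe_real// ger0_real.
by apply: complexI; rewrite rmorphM /= -!E normrM.
Qed.

Lemma rnormC_ge0 (c : R[i]) : 0 <= rnorm c.
Proof. by rewrite -ler0c /rnorm RRe_real ?normr_ge0// ger0_real. Qed.

Lemma rnormC_real (x : R) : rnorm x%:C = `|x|.
Proof. by rewrite /rnorm normc_def /= expr0n addr0 sqrtr_sqr. Qed.

Lemma rnormC_conj (c : R[i]) : rnorm c^* = rnorm c.
Proof. by rewrite /rnorm normcJ. Qed.

Lemma mul_conj_rnorm (c : R[i]) : c^* * c = (rnorm c ^+ 2)%:C.
Proof.
by rewrite mulrC -sqr_normc rmorphXn /= /rnorm RRe_real// ger0_real.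
Qed.

Lemma rnormC_Re (c : R[i]) : complex.Re c <= rnorm c.
Proof.
by apply: le_trans (ler_norm _) _; rewrite -lecR [X in _ <= X]RRe_real ?ger0_real// normc_ge_Re.
Qed.

Section Complete.
Variable V : completeNormedModType R[i].

Lemma rnorm_cauchy (u : nat -> V) (d : R) : 0 <= d -> d < 1 ->
  (forall n, rnorm (u n.+1 - u n) <= d ^+ n) ->
  exists l, forall e : R, 0 < e -> exists N, forall n, (N <= n)%N -> rnorm (u n - l) < e.
Proof.
move=> d0 d1 H.
have d1' : 0 < 1 - d by rewrite subr_gt0.
have tel n k : rnorm (u (n + k)%N - u n) <= d ^+ n / (1 - d).
  have step : rnorm (u (n + k)%N - u n) * (1 - d) <= d ^+ n * (1 - d ^+ k).
    elim: k => [|k IH]; first by rewrite addn0 subrr rnorm0 expr0 subrr mul0r mulr0.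
    have := rdist_triangle (u (n + k)%N) (u (n + k.+1)%N) (u n).
    rewrite -(ler_pM2r d1') => /le_trans; apply; rewrite mulrDl.
    apply: (@le_trans _ _ (d ^+ (n + k) * (1 - d) + d ^+ n * (1 - d ^+ k))).
      by apply: lerD => //; rewrite ler_pM2r// addnS H.
    by rewrite exprD exprS; lra.
  rewrite ler_pdivlMr//; apply: le_trans step _.
  by rewrite ler_piMr ?exprn_ge0// gerBl exprn_ge0.
have small (e : R) : 0 < e -> exists N, forall n, (N <= n)%N -> d ^+ n / (1 - d) < e.
  move=> e0; have e0' : 0 < e * (1 - d) by rewrite mulr_gt0.
  have : (fun n => d ^+ n) @ \oo --> (0 : R) by apply: cvg_expr; rewrite ger0_norm.
  move=> /cvgrPdist_lt /(_ _ e0')[N _ NP]; exists N => n Nn.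
  rewrite ltr_pdivrMr//; have := NP n Nn.
  by rewrite /= sub0r normrN ger0_norm// exprn_ge0.
have cu : cauchy (u @ \oo).
  apply: cauchy_exP => e e0.
  have eE : e = (complex.Re e)%:C by rewrite RRe_real// gtr0_real.
  have e0' : 0 < complex.Re e by rewrite -ltcR -eE.
  have [N NP] := small _ e0'; exists (u N); exists N => // n /= Nn.
  rewrite -ball_normE /ball_ /= rnormE eE ltcR rdistC -(subnKC Nn).
  by apply: le_lt_trans (tel _ _) _; exact: NP.
have ul := proj1 (cvg_ballP _ _) (proj1 (cauchy_cvgP _) cu).
exists (lim (u @ \oo)) => e e0.
have [|N _ NP] := ul _ _ e%:C; first by rewrite ltcR.
exists N => n Nn; have := NP n Nn.
by rewrite /= -ball_normE /ball_ /= rnormE ltcR rdistC.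
Qed.

End Complete.
End RNorm.

(** * Partial isometries in C*-algebras *)

Section CStar.
Variables (R : realType) (A : cstarAlgType R).
Implicit Types a b c x y z w p q s t v : A.
Local Notation "a ** b" := (cmul a b) (at level 40, left associativity).
Local Notation "a ^#" := (cstar a) (at level 2, format "a ^#").

Lemma cmul0l a : 0 ** a = 0.
Proof. by have := cmulDl 0 0 a; rewrite addr0 => /eqP; rewrite -subr_eq subrr => /eqP. Qed.

Lemma cmul0r a : a ** 0 = 0.
Proof. by have := cmulDr a 0 0; rewrite addr0 => /eqP; rewrite -subr_eq subrr => /eqP. Qed.

Lemma cmulNl a b : (- a) ** b = - (a ** b).
Proof. by apply/eqP; rewrite -addr_eq0 -cmulDl addNr cmul0l. Qed.

Lemma cmulNr a b : a ** (- b) = - (a ** b).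
Proof. by apply/eqP; rewrite -addr_eq0 -cmulDr addNr cmul0r. Qed.

Lemma cmulBl a b c : (a - b) ** c = a ** c - b ** c.
Proof. by rewrite cmulDl cmulNl. Qed.

Lemma cmulBr a b c : a ** (b - c) = a ** b - a ** c.
Proof. by rewrite cmulDr cmulNr. Qed.

Lemma cmul_suml (I : Type) (r : seq I) (P : pred I) (F : I -> A) a :
  (\sum_(i <- r | P i) F i) ** a = \sum_(i <- r | P i) F i ** a.
Proof. by apply: (big_morph (fun x => x ** a)) => [x y|]; rewrite ?cmulDl ?cmul0l. Qed.

Lemma cmul_sumr (I : Type) (r : seq I) (P : pred I) (F : I -> A) a :
  a ** (\sum_(i <- r | P i) F i) = \sum_(i <- r | P i) a ** F i.
Proof. by apply: (big_morph (cmul a)) => [x y|]; rewrite ?cmulDr ?cmul0r. Qed.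

Lemma cstar0 : (0 : A)^# = 0.
Proof. by have := cstarD (0 : A) 0; rewrite addr0 => /eqP; rewrite -subr_eq subrr => /eqP. Qed.

Lemma cstarN a : (- a)^# = - a^#.
Proof. by apply/eqP; rewrite -addr_eq0 -cstarD addNr cstar0. Qed.

Lemma cstarB a b : (a - b)^# = a^# - b^#.
Proof. by rewrite cstarD cstarN. Qed.

Lemma cstar_sum (I : Type) (r : seq I) (P : pred I) (F : I -> A) :
  (\sum_(i <- r | P i) F i)^# = \sum_(i <- r | P i) (F i)^#.
Proof. by apply: (big_morph (@cstar R A)) => [x y|]; rewrite ?cstarD ?cstar0. Qed.

Lemma rnorm_cmul a b : rnorm (a ** b) <= rnorm a * rnorm b.
Proof. by rewrite -lecR rmorphM /= -!rnormE cnormM. Qed.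

Lemma rnorm_cstar_cmul a : rnorm (a^# ** a) = rnorm a ^+ 2.
Proof. by apply: complexI; rewrite rmorphXn /= -!rnormE cstar_identity. Qed.

Lemma rnorm_cstar_le a : rnorm a <= rnorm a^#.
Proof.
have [->|a0] := eqVneq (rnorm a) 0; first exact: rnorm_ge0.
have ap : 0 < rnorm a by rewrite lt_def a0 rnorm_ge0.
by rewrite -(ler_pM2r ap) -expr2 -rnorm_cstar_cmul rnorm_cmul.
Qed.

Lemma rnorm_cstar a : rnorm a^# = rnorm a.
Proof. by apply/eqP; rewrite eq_le rnorm_cstar_le -{2}(cstarK a) rnorm_cstar_le. Qed.

Lemma rnorm_sq a e : 0 <= e -> rnorm (a^# ** a) <= e ^+ 2 -> rnorm a <= e.
Proof. by move=> e0; rewrite rnorm_cstar_cmul ler_pXn2r// nnegrE rnorm_ge0. Qed.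

Definition projection p := p^# = p /\ p ** p = p.

Lemma rnorm_projection p : projection p -> rnorm p <= 1.
Proof.
move=> [ps pp]; have := rnorm_cstar_cmul p; rewrite ps pp => e.
have [->//|p0] := eqVneq (rnorm p) 0.
have : rnorm p * 1 = rnorm p * rnorm p by rewrite mulr1 -expr2.
by move/(mulfI p0) => <-.
Qed.

Lemma rnorm_projection_mul p z : projection p -> rnorm (p ** z) <= rnorm z.
Proof.
move=> /rnorm_projection p1; apply: le_trans (rnorm_cmul _ _) _.
by rewrite -[leRHS]mul1r; apply: ler_wpM2r => //; exact: rnorm_ge0.
Qed.

Lemma rnorm_projection_sandwich p z : projection p -> rnorm (p ** z ** p) <= rnorm z.
Proof.
move=> pp; apply: le_trans (rnorm_cmul _ _) _; rewrite -[leRHS]mulr1.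
by apply: ler_pM; rewrite ?rnorm_ge0 ?rnorm_projection// rnorm_projection_mul.
Qed.

(** For x = v q - v the products cancel to x* x = 0, and the C*-identity gives x = 0. *)
Lemma partial_isometry_r v q : v^# ** v = q -> projection q -> v ** q = v.
Proof.
move=> vq [qs qq]; apply/eqP; rewrite -subr_eq0 -rnorm_eq0 -sqrf_eq0 -rnorm_cstar_cmul.
have h1 : v^# ** (v ** q) = q by rewrite cmulA vq.
rewrite cstarB cstarM qs cmulBl cmulBr cmulBr h1 -!cmulA h1 vq qq !subrr.
by rewrite rnorm0.
Qed.

(** w lies in the closure of b A. Then w* w is a limit of elements z* a z with a = b* b, which is
    how it comes to be Cuntz below a. *)
Definition in_right_ideal b w := forall e : R, 0 < e -> exists z, rnorm (w - b ** z) < e.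

Lemma in_right_ideal_mul b z : in_right_ideal b (b ** z).
Proof. by move=> e e0; exists z; rewrite subrr rnorm0. Qed.

Lemma in_right_idealM b w c : in_right_ideal b w -> in_right_ideal b (w ** c).
Proof.
move=> bw e e0; have c0 : 0 < rnorm c + 1 by rewrite ltr_wpDl// rnorm_ge0.
have [z zw] := bw (e / (rnorm c + 1)) (divr_gt0 e0 c0).
exists (z ** c); rewrite cmulA -cmulBl; apply: le_lt_trans (rnorm_cmul _ _) _.
move: zw; rewrite ltr_pdivlMr// => /le_lt_trans; apply.
by rewrite ler_wpM2l ?rnorm_ge0// lerDl.
Qed.

Lemma in_right_idealD b w w' : in_right_ideal b w -> in_right_ideal b w' ->
  in_right_ideal b (w + w').
Proof.
move=> bw bw' e e0; have e20 : 0 < e / 2 by rewrite divr_gt0.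
have [z zw] := bw _ e20; have [z' zw'] := bw' _ e20; exists (z + z').
rewrite cmulDr opprD addrACA; apply: le_lt_trans (rnormD _ _) _.
by rewrite [e]splitr ltrD.
Qed.

Lemma in_right_idealN b w : in_right_ideal b w -> in_right_ideal b (- w).
Proof.
by move=> bw e /bw[z zw]; exists (- z); rewrite cmulNr -opprD rnormN.
Qed.

Lemma rnorm_limit_star_mul (v : nat -> A) w q :
  (forall e : R, 0 < e -> exists N, forall n, (N <= n)%N -> rnorm (v n - w) < e) ->
  (forall e : R, 0 < e -> exists N, forall n, (N <= n)%N -> rnorm (q - (v n)^# ** v n) < e) ->
  w^# ** w = q.
Proof.
move=> vw vq; apply: rnorm_le0_eq => e e0.
pose K := rnorm w + 1.
have K0 : 0 < K by rewrite ltr_wpDl// rnorm_ge0.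
have d0 : 0 < Num.min 1 (e / (6 * K)) by rewrite lt_min ltr01 divr_gt0// mulr_gt0.
have KE : e / (6 * K) * K = e / 6 by field; exact: lt0r_neq0.
have e30 : 0 < e / 3 by rewrite divr_gt0.
have [N NP] := vw _ d0; have [N' NP'] := vq _ e30.
pose n := maxn N N'.
have := NP n (leq_maxl _ _); rewrite lt_min => /andP[h1 h2].
have h3 := NP' n (leq_maxr _ _).
have vK : rnorm (v n) <= K.
  rewrite -[v n](subrK w); apply: le_trans (rnormD _ _) _.
  by rewrite addrC lerD2l ltW.
have -> : w^# ** w - q = (w - v n)^# ** w + (v n)^# ** (w - v n) - (q - (v n)^# ** v n).
  by rewrite cstarB cmulBl cmulBr opprB !subrKA.
apply: le_trans (rnormB _ _) _.
apply: le_trans (lerD (rnormD _ _) (lexx _)) _.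
have : rnorm ((w - v n)^# ** w) <= e / 3 / 2.
  apply: le_trans (rnorm_cmul _ _) _; rewrite rnorm_cstar rdistC.
  apply: (@le_trans _ _ (e / (6 * K) * K)).
    by apply: ler_pM; rewrite ?rnorm_ge0 ?ltW// /K ltrDl.
  by rewrite KE; lra.
have : rnorm ((v n)^# ** (w - v n)) <= e / 3 / 2.
  apply: le_trans (rnorm_cmul _ _) _; rewrite rnorm_cstar rdistC.
  apply: (@le_trans _ _ (K * (e / (6 * K)))).
    by apply: ler_pM; rewrite ?rnorm_ge0 ?(ltW h2).
  by rewrite mulrC KE; lra.
by move: h3; lra.
Qed.

(* [v + v h / 2] with [h = p - v* v] replaces the defect h by 3/4 h^2 + 1/4 h^3, a
   quadratically convergent iteration towards a partial isometry. *)
Lemma newton_step p v z b (h := p - v^# ** v) : projection p -> v ** p = v -> v = b ** z ->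
  rnorm h <= 1 ->
  exists v', [/\ v' ** p = v', exists z', v' = b ** z',
    rnorm (p - v'^# ** v') <= rnorm h ^+ 2 & rnorm (v' - v) <= rnorm h].
Proof.
move=> [ps pp] vp vbz h1.
have pv : p ** v^# = v^# by rewrite -{1}ps -cstarM vp.
have hs : h^# = h by rewrite /h cstarB cstarM cstarK ps.
have hp : h ** p = h by rewrite /h cmulBl pp -cmulA vp.
have ph : p ** h = h by rewrite -{1}ps -{1}hs -cstarM hp hs.
have vv : v^# ** v = p - h by rewrite /h opprB addrC subrK.
clearbody h.
pose c : R[i] := (2^-1 : R)%:C.
have cJ : (c^*)%R = c by exact: conjc_real.
have cc : c + c = 1.
  by rewrite /c -rmorphD /= (_ : 2^-1 + 2^-1 = 1 :> R) ?rmorph1//; lra.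
have rc : rnorm c = 2^-1 by rewrite rnormC_real ger0_norm// invr_ge0.
exists (v + c *: (v ** h)).
have hh : h ** (p - h) = h - h ** h by rewrite cmulBr hp.
have Hd : p - (v + c *: (v ** h))^# ** (v + c *: (v ** h)) =
    h ** h - (c * c) *: (h ** h - h ** h ** h).
  rewrite cstarD cstarZ cJ cstarM hs cmulDl !cmulDr -!cscalerAl -!cscalerAr.
  rewrite -(cmulA h) (cmulA v^#) vv hh.
  have -> : h ** v^# ** (v ** h) = (h - h ** h) ** h.
    by rewrite cmulA -(cmulA h) vv hh.
  have -> : (p - h) ** h = h - h ** h by rewrite cmulBl ph.
  rewrite scalerA cmulBl.
  set X := h ** h; set Y := X ** h.
  have -> : forall a b d e : A, a - (b + d + (d + e)) = a - b - (d + d) - e.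
    by move=> a1 a2 a3 a4; rewrite !opprD !addrA.
  by rewrite -scalerDl cc scale1r !subKr.
split.
- by rewrite cmulDl vp -cscalerAl -cmulA hp.
- exists (z + c *: (z ** h)); by rewrite cmulDr -cscalerAr cmulA -vbz.
- have -> : p - (v + c *: (v ** h))^# ** (v + c *: (v ** h)) =
      (1 - c * c) *: (h ** h) + (c * c) *: (h ** h ** h).
    by rewrite Hd scalerBr opprB addrA addrAC scalerBl scale1r.
  apply: le_trans (rnormD _ _) _; rewrite !rnormZ.
  have -> : 1 - c * c = (3 / 4 : R)%:C.
    by rewrite /c -rmorphM -(rmorph1 (real_complex R)) -rmorphB /=; congr (_%:C); lra.
  rewrite rnormM rc rnormC_real ger0_norm; last by lra.
  have H1 : rnorm (h ** h) <= rnorm h ^+ 2 by rewrite expr2 rnorm_cmul.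
  have H2 : rnorm (h ** h ** h) <= rnorm h ^+ 2.
    apply: le_trans (rnorm_cmul _ _) _; rewrite -[leRHS]mulr1.
    by apply: ler_pM; rewrite ?rnorm_ge0.
  have := rnorm_ge0 h; lra.
- rewrite addrC addrA addNr add0r rnormZ rc.
  have v2 : rnorm v <= 2.
    apply: rnorm_sq => //; rewrite vv; apply: le_trans (rnormB _ _) _.
    by have := rnorm_projection (conj ps pp); move: h1; lra.
  apply: le_trans (ler_wpM2l _ (rnorm_cmul _ _)) _ => //.
  by rewrite mulrA ler_piMl ?rnorm_ge0//; move: v2; lra.
Qed.

(** The defect shrinks at least by the factor d < 1 and each step moves v by at most the defect, so
    the iterates converge geometrically. [P] keeps them in b A and supported on p. *)
Lemma newton_partial_isometry p b z : projection p ->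
  rnorm (p - (b ** z ** p)^# ** (b ** z ** p)) < 1 ->
  exists w, in_right_ideal b w /\ w^# ** w = p.
Proof.
move=> pp; set v0 := b ** z ** p; set d := rnorm _ => d1.
have d0 : 0 <= d := rnorm_ge0 _.
pose P v := [/\ v ** p = v, exists z', v = b ** z' & rnorm (p - v^# ** v) <= d].
have P0 : P v0.
  split => //; first by rewrite /v0 -cmulA (proj2 pp).
  by exists (z ** p); rewrite cmulA.
have step v : exists v', P v -> [/\ P v', rnorm (v' - v) <= rnorm (p - v^# ** v) &
    rnorm (p - v'^# ** v') <= d * rnorm (p - v^# ** v)].
  have [[vp [z' vz] vd]|nP] := pselect (P v); last by exists v.
  have [|v' [w1 w2 w3 w4]] := newton_step pp vp vz; first exact: le_trans vd (ltW d1).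
  have w5 : rnorm (p - v'^# ** v') <= d * rnorm (p - v^# ** v).
    by apply: le_trans w3 _; rewrite expr2 ler_wpM2r// rnorm_ge0.
  exists v' => _; split => //; split => //.
  by apply: le_trans w5 _; rewrite -[leRHS]mulr1 ler_wpM2l// (le_trans vd)// ltW.
have [f fP] := choice step.
pose u n := iter n f v0.
have uP n : P (u n) by elim: n => //= n /fP[].
have ud n : rnorm (p - (u n)^# ** u n) <= d ^+ n.
  elim: n => [|n IH]; first by rewrite expr0; exact: ltW.
  have [_ _ H] := fP (u n) (uP n); apply: le_trans H _.
  by rewrite exprS ler_wpM2l.
have [n|w wP] := @rnorm_cauchy R A u d d0 d1.
  by have [_ H _] := fP (u n) (uP n); exact: le_trans H (ud n).
exists w; split.
  move=> e e0; have [N NP] := wP e e0; have [_ [z' zE] _] := uP N.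
  by exists z'; rewrite -zE rdistC; exact: NP.
apply: rnorm_limit_star_mul wP _ => e e0.
have : (fun n => d ^+ n) @ \oo --> (0 : R) by apply: cvg_expr; rewrite ger0_norm.
move=> /cvgrPdist_lt /(_ _ e0)[N _ NP]; exists N => n Nn.
apply: le_lt_trans (ud n) _; have := NP n Nn.
by rewrite /= sub0r normrN ger0_norm// exprn_ge0.
Qed.

Definition le_source b q := exists w, in_right_ideal b w /\ w^# ** w = q.

Lemma le_source_conj b q s q' : le_source b q -> s^# ** q ** s = q' -> le_source b q'.
Proof.
move=> [w [bw wq]] sq; exists (w ** s); split; first exact: in_right_idealM.
by rewrite cstarM cmulA -(cmulA _ _ w) wq.
Qed.

Definition properly_infinite_witness q s t :=
  [/\ q ** s = s, q ** t = t, s^# ** s = q, t^# ** t = q & s^# ** t = 0].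

(* With [m = v1* v2], the three summands below have pairwise orthogonal ranges. *)
Lemma le_source_add b q1 q2 s t : projection q1 -> properly_infinite_witness q1 s t ->
  le_source b q1 -> le_source b q2 -> le_source b (q1 + q2).
Proof.
move=> pq1 [qs qt ss tt st] [v1 [b1 v1q]] [v2 [b2 v2q]].
have v1p := partial_isometry_r v1q pq1.
have ts : t^# ** s = 0 by rewrite -(cstarK s) -cstarM st cstar0.
pose m := v1^# ** v2.
have q1m : q1 ** m = m by rewrite /m cmulA -(proj1 pq1) -cstarM v1p.
pose n := v2 - v1 ** m.
have v1n : v1^# ** n = 0 by rewrite /n cmulBr cmulA v1q q1m subrr.
have nv1 : n^# ** v1 = 0 by rewrite -(cstarK v1) -cstarM v1n cstar0.
exists (v1 ** s + n + v1 ** t ** m); split.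
  apply: in_right_idealD; first apply: in_right_idealD; try exact: in_right_idealM.
    by apply: in_right_idealD => //; apply: in_right_idealN; exact: in_right_idealM.
  by rewrite -cmulA; exact: in_right_idealM.
have h1 : (v1 ** s)^# ** (v1 ** s) = q1.
  by rewrite cstarM cmulA -(cmulA s^#) v1q -cmulA qs ss.
have h2 : (v1 ** s)^# ** n = 0 by rewrite cstarM -cmulA v1n cmul0r.
have h3 : (v1 ** s)^# ** (v1 ** t ** m) = 0.
  by rewrite cstarM -!cmulA (cmulA v1^#) v1q (cmulA q1) qt (cmulA s^#) st cmul0l.
have h4 : n^# ** (v1 ** t ** m) = 0 by rewrite -!cmulA cmulA nv1 cmul0l.
have h2' : n^# ** (v1 ** s) = 0 by rewrite cmulA nv1 cmul0l.
have h3' : (v1 ** t ** m)^# ** (v1 ** s) = 0.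
  by rewrite -[v1 ** s]cstarK -cstarM h3 cstar0.
have h4' : (v1 ** t ** m)^# ** n = 0 by rewrite -[n]cstarK -cstarM h4 cstar0.
have h5 : (v1 ** t ** m)^# ** (v1 ** t ** m) = m^# ** m.
  by rewrite !cstarM -!cmulA (cmulA v1^#) v1q (cmulA q1) qt (cmulA t^#) tt q1m.
have h6 : n^# ** n = q2 - m^# ** m.
  rewrite {2}/n cmulBr cmulA nv1 cmul0l subr0 /n cstarB cmulBl v2q cstarM.
  by rewrite -cmulA.
clearbody n; rewrite !cstarD !cmulDl !cmulDr h1 h2 h3 h4 h2' h3' h4' h5 h6 !addr0 !add0r.
by rewrite -addrA subrK.
Qed.

(** Choose z1 with b z1 close to w s and put r1 = z1 b. Then r1* a r1 is close to b* s* w* w s b =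
    b* q b, which is close to b* b = a. With t in place of s one gets r2, and s* t = 0 makes the
    mixed products small. *)
Lemma properly_infinite_cuntz a b q s t : a = b^# ** b -> le_source b q ->
  projection q -> properly_infinite_witness q s t ->
  forall e : R, 0 < e -> rnorm (b - q ** b) < e / (2 * (rnorm b + 1)) ->
  exists r1 r2, [/\ rnorm (r1^# ** a ** r1 - a) < e, rnorm (r2^# ** a ** r2 - a) < e,
     rnorm (r1^# ** a ** r2) < e & rnorm (r2^# ** a ** r1) < e].
Proof.
move=> ab [w [bw wq]] pq [qs qt ss tt st] e e0 bqb.
pose K := rnorm b + 1.
have K1 : 1 <= K by rewrite lerDr rnorm_ge0.
have K0 : 0 < K by apply: lt_le_trans K1.
have bK : rnorm b <= K by rewrite lerDl.
pose d := e / (2 * K); have d0 : 0 < d by rewrite divr_gt0// mulr_gt0.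
(* Half of e pays for replacing w s and w t by elements of b A, the other half for b* q b instead of
   a. *)
pose eps := Num.min 1 (e / (8 * K ^+ 2)).
have eps0 : 0 < eps by rewrite lt_min ltr01 divr_gt0// mulr_gt0// exprn_gt0.
have eps1 : eps <= 1 by rewrite ge_min lexx.
have epsE : 4 * eps * K ^+ 2 <= e / 2.
  have : eps <= e / (8 * K ^+ 2) by rewrite ge_min lexx orbT.
  by rewrite ler_pdivlMr ?mulr_gt0 ?exprn_gt0//; lra.
have unit_norm x : x^# ** x = q -> rnorm x <= 1.
  move=> xq; apply: rnorm_sq => //; rewrite xq expr1n; exact: rnorm_projection.
have wx x : q ** x = x -> (w ** x)^# ** (w ** x) = x^# ** x.
  by move=> qx; rewrite cstarM cmulA -(cmulA x^#) wq -cmulA qx.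
have wxy x y : q ** y = y -> (w ** x)^# ** (w ** y) = x^# ** y.
  by move=> qy; rewrite cstarM cmulA -(cmulA x^#) wq -cmulA qy.
have [z1 z1P] := in_right_idealM s bw eps0.
have [z2 z2P] := in_right_idealM t bw eps0.
(* replacing u_i by b z_i changes u_i* u_j by at most 4 eps *)
have close u u' z z' : rnorm u <= 1 -> rnorm u' <= 1 ->
    rnorm (u - b ** z) < eps -> rnorm (u' - b ** z') < eps ->
    rnorm ((z ** b)^# ** a ** (z' ** b) - b^# ** (u^# ** u') ** b) < e / 2.
  move=> u1 u1' zu zu'.
  have -> : (z ** b)^# ** a ** (z' ** b) - b^# ** (u^# ** u') ** b =
     b^# ** ((b ** z)^# ** (b ** z') - u^# ** u') ** b.
    by rewrite cmulBr cmulBl ab !cstarM !cmulA.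
  have -> : (b ** z)^# ** (b ** z') - u^# ** u' =
      - ((u - b ** z)^# ** u' + (b ** z)^# ** (u' - b ** z')).
    by rewrite cstarB cmulBl cmulBr subrKA opprB.
  apply: le_lt_trans (rnorm_cmul _ _) _.
  apply: le_lt_trans (ler_wpM2r (rnorm_ge0 _) (rnorm_cmul _ _)) _.
  rewrite rnorm_cstar rnormN.
  have bz2 : rnorm (b ** z) <= 2.
    rewrite -[b ** z](subrK u); apply: le_trans (rnormD _ _) _.
    by rewrite rdistC; move: u1 zu eps1; lra.
  have h1 : rnorm ((u - b ** z)^# ** u') <= eps * 1.
    apply: le_trans (rnorm_cmul _ _) _; rewrite rnorm_cstar.
    by apply: ler_pM; rewrite ?rnorm_ge0// ltW.
  have h2 : rnorm ((b ** z)^# ** (u' - b ** z')) <= 2 * eps.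
    apply: le_trans (rnorm_cmul _ _) _; rewrite rnorm_cstar.
    by apply: ler_pM; rewrite ?rnorm_ge0// ltW.
  set N := rnorm (_ + _).
  have h3 : N <= 3 * eps by apply: le_trans (rnormD _ _) _; lra.
  apply: (@le_lt_trans _ _ (K * (3 * eps) * K)).
    by apply: ler_pM; rewrite ?mulr_ge0 ?rnorm_ge0//; apply: ler_pM; rewrite ?rnorm_ge0.
  apply: lt_le_trans epsE; have -> : K * (3 * eps) * K = 3 * (eps * K ^+ 2) by ring.
  have : 0 < eps * K ^+ 2 by rewrite mulr_gt0// exprn_gt0.
  by rewrite -[4 * eps * _]mulrA; lra.
have bq : rnorm (b^# ** q ** b - a) < e / 2.
  have -> : b^# ** q ** b - a = - (b^# ** (b - q ** b)) by rewrite ab cmulBr opprB cmulA.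
  rewrite rnormN; apply: le_lt_trans (rnorm_cmul _ _) _; rewrite rnorm_cstar.
  apply: (@le_lt_trans _ _ (K * rnorm (b - q ** b))).
    by rewrite ler_wpM2r ?rnorm_ge0.
  have : K * rnorm (b - q ** b) < K * d by rewrite ltr_pM2l.
  have -> : K * d = e / 2 by rewrite /d; field; exact: lt0r_neq0.
  by [].
have ws1 : rnorm (w ** s) <= 1 by apply: unit_norm; rewrite wx.
have wt1 : rnorm (w ** t) <= 1 by apply: unit_norm; rewrite wx.
have ts : t^# ** s = 0 by rewrite -(cstarK s) -cstarM st cstar0.
exists (z1 ** b), (z2 ** b); split.
- rewrite [e]splitr; apply: le_lt_trans (rdist_triangle (b^# ** q ** b) _ _) _.
  by apply: ltrD => //; have := close _ _ _ _ ws1 ws1 z1P z1P; rewrite wx// ss.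
- rewrite [e]splitr; apply: le_lt_trans (rdist_triangle (b^# ** q ** b) _ _) _.
  by apply: ltrD => //; have := close _ _ _ _ wt1 wt1 z2P z2P; rewrite wx// tt.
- have := close _ _ _ _ ws1 wt1 z1P z2P; rewrite wxy// st cmul0r cmul0l subr0.
  by move/lt_trans; apply; move: e0; lra.
- have := close _ _ _ _ wt1 ws1 z2P z1P; rewrite wxy// ts cmul0r cmul0l subr0.
  by move/lt_trans; apply; move: e0; lra.
Qed.

(** The sum S is a projection up to four errors of norm at most 4 e, so ||S||^2 <= ||S|| + 1/4,
    which excludes ||S|| > 3/2. Any bound below 2 with room for small errors would serve the trace
    argument. *)
Lemma orthogonal_isometries_bound p f1 f2 (e : R) : 0 <= e -> e <= 64^-1 -> projection p ->
  f1 ** p = f1 -> f2 ** p = f2 ->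
  rnorm (f1^# ** f1 - p) <= e -> rnorm (f2^# ** f2 - p) <= e ->
  rnorm (f1^# ** f2) <= e -> rnorm (f2^# ** f1) <= e ->
  rnorm (f1 ** f1^# + f2 ** f2^#) <= 3 / 2.
Proof.
move=> e0 e64 pp f1p f2p h11 h22 h12 h21.
set S := _ + _.
have Ss : S^# = S by rewrite /S cstarD !cstarM !cstarK.
have bd (f : A) : rnorm (f^# ** f - p) <= e -> rnorm f <= 2.
  move=> fe; apply: rnorm_sq => //; rewrite -[f^# ** f](subrK p).
  by apply: le_trans (rnormD _ _) _; have := rnorm_projection pp; lra.
have b1 := bd _ h11; have b2 := bd _ h22.
have tri (f d g : A) : rnorm f <= 2 -> rnorm g <= 2 -> rnorm d <= e ->
    rnorm (f ** d ** g^#) <= 4 * e.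
  move=> hf hg de; apply: le_trans (rnorm_cmul _ _) _; rewrite rnorm_cstar.
  have -> : 4 * e = 2 * e * 2 by lra.
  apply: ler_pM; rewrite ?rnorm_ge0//; apply: le_trans (rnorm_cmul _ _) _.
  by apply: ler_pM; rewrite ?rnorm_ge0.
have SS : S ** S = S + (f1 ** (f1^# ** f1 - p) ** f1^# + f1 ** (f1^# ** f2) ** f2^#
    + (f2 ** (f2^# ** f1) ** f1^# + f2 ** (f2^# ** f2 - p) ** f2^#)).
  have reorder (X Y Z W a b : A) :
      X + Y + (Z + W) = a + b + (X - a + Y + (Z + (W - b))).
    by rewrite [RHS]addrACA [X - a + Y]addrAC (addrCA a) subrr addr0 (addrA Z) (addrCA b) subrr addr0.
  rewrite !cmulBr f1p f2p !cmulBl /S cmulDl !cmulDr !cmulA; exact: reorder.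
have := rnorm_cstar_cmul S; rewrite Ss SS => e2.
have : rnorm S ^+ 2 <= rnorm S + 16 * e.
  rewrite -e2; apply: le_trans (rnormD _ _) _; rewrite lerD2l.
  apply: le_trans (rnormD _ _) _.
  have k1 := rnormD (f1 ** (f1^# ** f1 - p) ** f1^#) (f1 ** (f1^# ** f2) ** f2^#).
  have k2 := rnormD (f2 ** (f2^# ** f1) ** f1^#) (f2 ** (f2^# ** f2 - p) ** f2^#).
  have := tri _ _ _ b1 b1 h11; have := tri _ _ _ b1 b2 h12.
  have := tri _ _ _ b2 b1 h21; have := tri _ _ _ b2 b2 h22.
  by move: k1 k2; lra.
have := rnorm_ge0 S; set x := rnorm S; move=> x0 hx.
rewrite leNgt; apply/negP => xx.
have : (x - 3 / 2) * x > 0 by rewrite mulr_gt0//; lra.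
by move: hx; rewrite expr2; lra.
Qed.

End CStar.

(** * Convolution by functions supported in a cell *)

Section Swap.
Variable E : digraph.
Implicit Types (a b : finpath E) (x y z : ipath E) (g h : path_groupoid E).

(** Deciding [tail_eq], with default g0, makes [swap] and [gshift] total maps on arrows. *)
Definition marrow x k y g0 : path_groupoid E :=
  if pselect (tail_eq x k y) is left P then Arrow P else g0.

Lemma marrowP x k y g0 : tail_eq x k y ->
  [/\ gr (marrow x k y g0) = x, gk (marrow x k y g0) = k & gd (marrow x k y g0) = y].
Proof. by rewrite /marrow; case: pselect. Qed.

(* junk value g unless gr g lies in cyl a and ftgt a = ftgt b *)
Definition swap a b g := marrow (icat b (ishift (flen a) (gr g)))
  (gk g + (flen a)%:Z - (flen b)%:Z) (gd g) g.

Lemma swapP a b g : cyl a (gr g) -> ftgt a = ftgt b ->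
  [/\ gr (swap a b g) = icat b (ishift (flen a) (gr g)),
      gk (swap a b g) = gk g + (flen a)%:Z - (flen b)%:Z & gd (swap a b g) = gd g].
Proof.
move=> ca ab; apply: marrowP; apply/tail_eqP.
have [p [q [kE e]]] := arrowP g.
exists (flen b + p)%N, (flen a + q)%N; split; first by rewrite kE; lia.
have t : ftgt b = isrc (ishift (flen a) (gr g)) by rewrite -ab; exact: cyl_tgt.
rewrite -[LHS]shift_shift shift_icat// shift_shift [(flen a + p)%N]addnC.
by rewrite -shift_shift e shift_shift addnC.
Qed.

Lemma cyl_swap a b g : cyl a (gr g) -> ftgt a = ftgt b -> cyl b (gr (swap a b g)).
Proof.
by move=> ca ab; have [-> _ _] := swapP ca ab; apply: cyl_icat; rewrite -ab; exact: cyl_tgt.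
Qed.

Lemma swapK a b g : cyl a (gr g) -> ftgt a = ftgt b -> swap b a (swap a b g) = g.
Proof.
move=> ca ab; have [r1 k1 d1] := swapP ca ab.
have [r2 k2 d2] := swapP (cyl_swap ca ab) (esym ab).
have t : ftgt b = isrc (ishift (flen a) (gr g)) by rewrite -ab; exact: cyl_tgt.
apply: arrow_eq; rewrite ?r2 ?k2 ?d2 ?r1 ?k1 ?d1//; last by lia.
by rewrite shift_icat// icat_shift.
Qed.

Lemma gcylP a b g : gcyl a b g <-> [/\ cyl a (gr g), cyl b (gd g),
  gk g = (flen b)%:Z - (flen a)%:Z & ishift (flen a) (gr g) = ishift (flen b) (gd g)].
Proof.
split=> -[h1 h2 h3 h4]; split => //.
  by apply: ipath_eq => i; exact: h4.
by move=> i; rewrite -!iedge_shift h4.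
Qed.

(** The unique arrow of Z(a, b) with range x, for x in Z(a): the unit at the other end with its
    prefix b exchanged for a. *)
Definition slice a b x := swap b a (gunit (icat b (ishift (flen a) x))).

Lemma sliceP a b x : cyl a x -> ftgt a = ftgt b ->
  [/\ gr (slice a b x) = x, gd (slice a b x) = icat b (ishift (flen a) x) &
      gcyl a b (slice a b x)].
Proof.
move=> ca ab; have t : ftgt b = isrc (ishift (flen a) x) by rewrite -ab; exact: cyl_tgt.
have cb : cyl b (gr (gunit (icat b (ishift (flen a) x)))) by apply: cyl_icat.
have [r1 k1 d1] := swapP cb (esym ab).
have r1' : gr (slice a b x) = x by rewrite r1 /= shift_icat// icat_shift.
have d1' : gd (slice a b x) = icat b (ishift (flen a) x) by rewrite d1.
split => //; apply/gcylP; rewrite r1' d1' shift_icat//; split => //.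
Qed.

Lemma slice_unique a b g : gcyl a b g -> ftgt a = ftgt b -> g = slice a b (gr g).
Proof.
move=> /gcylP[ca cb kE e] ab; have [r1 d1 /gcylP[_ _ k1 _]] := sliceP ca ab.
apply: arrow_eq; rewrite ?r1 ?d1 ?kE ?k1//.
by rewrite e icat_shift.
Qed.

Lemma gcomp_slice a b g : cyl a (gr g) -> ftgt a = ftgt b ->
  gcomp (slice a b (gr g)) (swap a b g) g.
Proof.
move=> ca ab; have [r1 d1 /gcylP[_ _ k1 _]] := sliceP ca ab.
have [r2 k2 d2] := swapP ca ab.
by split; rewrite ?d1 ?r2 ?r1 ?d2// k1 k2; lia.
Qed.

(** Z(a, b) is a bisection, so g has at most one factorisation with first factor in it. Convolution
    by a function on a cell therefore has at most one term. *)
Lemma gcomp_slice_unique a b g u h : gcomp u h g -> gcyl a b u -> ftgt a = ftgt b ->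
  [/\ cyl a (gr g), u = slice a b (gr g) & h = swap a b g].
Proof.
move=> [dr rg kg dg] cu ab; have /gcylP[ca cb ku e] := cu.
have cg : cyl a (gr g) by rewrite rg.
split => //; first by rewrite rg; exact: slice_unique.
have [r2 k2 d2] := swapP cg ab.
apply: arrow_eq; rewrite ?r2 ?k2 ?d2 ?dg//; last by rewrite kg ku; lia.
by rewrite -dr rg e icat_shift.
Qed.

End Swap.

Lemma esumZl_le (R : realType) (T : choiceType) (P : set T) (c : R) (f : T -> \bar R) :
  0 <= c -> (forall i, 0 <= f i)%E ->
  (\esum_(i in P) (c%:E * f i) <= c%:E * \esum_(i in P) f i)%E.
Proof.
move=> c0 f0; apply: ge_ereal_sup => _ [X [fX XP] <-].
rewrite -ge0_mule_fsumr//; apply: lee_wpmul2l; first by rewrite lee_fin.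
by apply: ereal_sup_ubound; exists X.
Qed.

(** * The reduced norm of a function on a cell *)

Section Convolution.
Variables (R : realType) (E : digraph).
Local Notation G := (path_groupoid E).
Local Notation C := R[i].
Implicit Types (a b : finpath E) (u f xi : G -> C) (g h : G).

Lemma gconv_cell a b u xi g : (forall h, u h != 0 -> gcyl a b h) -> ftgt a = ftgt b ->
  gconv u xi g = if `[< cyl a (gr g) >] then u (slice a b (gr g)) * xi (swap a b g) else 0.
Proof.
move=> su ab; rewrite /gconv; case: asboolP => [ca|nca].
  rewrite -(@fsbig_widen _ _ _ _ [set (slice a b (gr g), swap a b g)]) ?fsbig_set1//.
    by move=> _ ->; exact: gcomp_slice.
  move=> [v h] /= [vh nvh]; have [->|/su cv] := eqVneq (u v) 0; first by rewrite mul0r.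
  by case: nvh; have [_ -> ->] := gcomp_slice_unique vh cv ab.
rewrite fsbig1// => -[v h] /= vh; have [->|/su cv] := eqVneq (u v) 0; first by rewrite mul0r.
by case: nca; have [] := gcomp_slice_unique vh cv ab.
Qed.

(** A sum over an infinite support defaults to 0, so additivity of [gconv] in its first argument
    depends on this finiteness. *)
Definition conv_finite u xi g :=
  finite_set ([set p : G * G | gcomp p.1 p.2 g] `&` [set p | u p.1 * xi p.2 != 0]).

Lemma fsbigD_supp (T : choiceType) (P : set T) (F H : T -> C) :
  finite_set (P `&` [set p | F p != 0]) -> finite_set (P `&` [set p | H p != 0]) ->
  \sum_(p \in P) (F p + H p) = \sum_(p \in P) F p + \sum_(p \in P) H p.
Proof.
move=> fF fH; set Q := (P `&` [set p | F p != 0]) `|` (P `&` [set p | H p != 0]).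
have fQ : finite_set Q by rewrite finite_setU.
have QP : Q `<=` P by move=> p [][].
have w (K : T -> C) : (forall p, P p -> K p != 0 -> Q p) -> \sum_(p \in P) K p = \sum_(p \in Q) K p.
  move=> KQ; symmetry; apply: (@fsbig_widen T C 0 +%R Q P K) => // p [Pp nQ] /=.
  by apply/eqP/negPn/negP => /(KQ p Pp).
rewrite !w ?fsbig_split//.
- by move=> p Pp Hp; right.
- by move=> p Pp Fp; left.
- move=> p Pp; have [F0|F0] := eqVneq (F p) 0; first by rewrite F0 add0r; right.
  by left.
Qed.

Lemma conv_finite_cell a b u xi g : (forall h, u h != 0 -> gcyl a b h) -> ftgt a = ftgt b ->
  conv_finite u xi g.
Proof.
move=> su ab; apply: (sub_finite_set _ (finite_set1 (slice a b (gr g), swap a b g))).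
move=> [v h] /= [vh]; rewrite mulf_eq0 negb_or => /andP[/su cv _].
by have [_ -> ->] := gcomp_slice_unique vh cv ab.
Qed.

Lemma conv_finiteD u v xi g : conv_finite u xi g -> conv_finite v xi g ->
  conv_finite (fun h => u h + v h) xi g.
Proof.
move=> fu fv; apply: (@sub_finite_set _ _ (_ `|` _)); last first.
  by rewrite finite_setU; split; [exact: fu|exact: fv].
move=> [p q] /= [pq]; rewrite mulrDl => H.
have [u0|u0] := eqVneq (u p * xi q) 0; last by left.
by right; split => //; rewrite u0 add0r in H.
Qed.

Lemma gconvDl u v xi g : conv_finite u xi g -> conv_finite v xi g ->
  gconv (fun h => u h + v h) xi g = gconv u xi g + gconv v xi g.
Proof.
move=> fu fv; rewrite /gconv -fsbigD_supp//.
by apply: eq_fsbigr => p _; rewrite mulrDl.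
Qed.

Definition nrm2 xi : \bar R := \esum_(g in [set: G]) (rnorm (xi g) ^+ 2)%:E.

Lemma nrm2_ge0 xi : (0 <= nrm2 xi)%E.
Proof. by apply: esum_ge0 => g _; rewrite lee_fin sqr_ge0. Qed.

Lemma l2norm_le xi (c : R) : 0 <= c -> (l2norm xi <= c%:E)%E <-> (nrm2 xi <= (c ^+ 2)%:E)%E.
Proof.
move=> c0; rewrite /l2norm -/(nrm2 xi); case: (nrm2 xi) (nrm2_ge0 xi) => [r| |] //=.
rewrite !lee_fin => r0; split => H.
  by rewrite -(sqr_sqrtr r0) ler_pXn2r// nnegrE sqrtr_ge0.
by rewrite -(ger0_norm c0) -sqrtr_sqr ler_sqrt// sqr_ge0.
Qed.

Lemma l2norm_le1 xi : (l2norm xi <= 1)%E <-> (nrm2 xi <= 1)%E.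
Proof. by have := @l2norm_le xi 1 ler01; rewrite expr1n. Qed.

Lemma reduced_norm_le u (c : R) : 0 <= c ->
  (forall xi, (nrm2 xi <= 1)%E -> (nrm2 (gconv u xi) <= (c ^+ 2)%:E)%E) ->
  (reduced_norm u <= c%:E)%E.
Proof.
move=> c0 H; apply: ge_ereal_sup => _ [xi /l2norm_le1 x1 <-].
exact/(l2norm_le _ c0)/H.
Qed.

Lemma nrm2_gconv_le u (c : R) xi : (reduced_norm u <= c%:E)%E -> 0 <= c ->
  (nrm2 xi <= 1)%E -> (nrm2 (gconv u xi) <= (c ^+ 2)%:E)%E.
Proof.
move=> uc c0 x1; apply/(l2norm_le _ c0)/(le_trans _ uc).
by apply: ereal_sup_ubound; exists xi => //; exact/l2norm_le1.
Qed.

Lemma nrm2_reindex (P : set G) (s : G -> G) xi : set_inj P s ->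
  (\esum_(g in P) (rnorm (xi (s g)) ^+ 2)%:E <= nrm2 xi)%E.
Proof.
move=> inj; rewrite -(esum_image P s (fun h => (rnorm (xi h) ^+ 2)%:E) inj).
rewrite esum_mkcond /nrm2; apply: le_esum => g _.
by case: ifP => // _; rewrite lee_fin sqr_ge0.
Qed.

(** Convolution by u is a weighted partial permutation of the basis of l^2(G), as [swap a b] is
    injective on the arrows with range in Z(a); its norm is at most the supremum of the weights. *)
Lemma reduced_norm_cell a b u (c : R) : 0 <= c -> ftgt a = ftgt b ->
  (forall h, u h != 0 -> gcyl a b h) -> (forall h, rnorm (u h) <= c) ->
  (reduced_norm u <= c%:E)%E.
Proof.
move=> c0 ab su uc; apply: reduced_norm_le => // xi x1.
have inj : set_inj [set g | cyl a (gr g)] (swap a b).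
  move=> g h; rewrite !in_setE /= => cg ch e.
  by rewrite -(swapK cg ab) e swapK.
apply: (@le_trans _ _ ((c ^+ 2)%:E * \esum_(g in [set g | cyl a (gr g)]) (rnorm (xi (swap a b g)) ^+ 2)%:E)%E).
  apply: (le_trans _ (esumZl_le _ (sqr_ge0 c) _)); last by move=> g; rewrite lee_fin sqr_ge0.
  rewrite [leRHS]esum_mkcond; apply: le_esum => g _.
  rewrite (gconv_cell _ _ su ab); case: asboolP => [ca|nca].
    rewrite mem_set// -EFinM lee_fin rnormM exprMn; apply: ler_wpM2r; first exact: sqr_ge0.
    by rewrite ler_pXn2r// nnegrE rnormC_ge0.
  by rewrite memNset// /rnorm normr0 expr0n.
rewrite -[leRHS]mule1; apply: lee_wpmul2l; first by rewrite lee_fin sqr_ge0.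
exact: le_trans (nrm2_reindex _ inj) x1.
Qed.

(** The unit vector at the unit [gunit (gd g)] is mapped to a function with value u g at g. *)
Lemma reduced_norm_ge u g : (forall xi h, conv_finite u xi h) ->
  ((rnorm (u g))%:E <= reduced_norm u)%E.
Proof.
move=> fin; pose xi h : C := if h == gunit (gd g) then 1 else 0.
have x1 : (nrm2 xi <= 1)%E.
  have -> : nrm2 xi = \esum_(h in [set gunit (gd g)]) (rnorm (xi h) ^+ 2)%:E.
    rewrite [RHS]esum_mkcond; apply: eq_esum => h _.
    case: ifPn => // /negP; rewrite in_setE /= /xi; case: eqP => // _ _.
    by rewrite /rnorm normr0 expr0n.
  rewrite esum_set1 ?lee_fin ?sqr_ge0// /xi eqxx /rnorm normr1.
  by rewrite expr1n.
have xg : gconv u xi g = u g.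
  rewrite /gconv -(@fsbig_widen _ _ _ _ [set (g, gunit (gd g))]) ?fsbig_set1 /xi /= ?eqxx ?mulr1//.
    by move=> _ -> /=; split; rewrite //= addr0.
  move=> [p q] /= [[dr rg kg dg] npq]; case: eqP => [qE|]; last by rewrite mulr0.
  case: npq; congr pair => //; apply: arrow_eq; first by rewrite rg.
    by rewrite kg qE addr0.
  by rewrite dr qE.
apply: le_trans (ereal_sup_ubound _); last by exists xi => //=; exact/l2norm_le1.
rewrite /l2norm -/(nrm2 _).
have : ((rnorm (u g) ^+ 2)%:E <= nrm2 (gconv u xi))%E.
  rewrite -{1}xg /nrm2 -(@esum_set1 _ _ g (fun h => (rnorm (gconv u xi h) ^+ 2)%:E)).
    rewrite esum_mkcond; apply: le_esum => h _; case: ifP => // _; by rewrite lee_fin sqr_ge0.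
  by rewrite lee_fin sqr_ge0.
case: (nrm2 _) => [r| |] //=; rewrite ?leey// !lee_fin => ur.
rewrite -[leLHS](ger0_norm (rnormC_ge0 _)) -sqrtr_sqr ler_sqrt//.
by apply: le_trans ur; exact: sqr_ge0.
Qed.

End Convolution.

(** * The topology of the path groupoid *)

Lemma compact_coverP (T : topologicalType) (A : set T) : compact A <->
  forall (I : choiceType) (D : set I) (f : I -> set T),
    (forall i, D i -> open (f i)) -> A `<=` cover D f -> finite_subset_cover D f A.
Proof.
have [[x0 _]|nx] := pselect (exists x : T, True); last first.
  have -> : A = set0 by apply/seteqP; split => // x; case: nx; exists x.
  split=> [_ I D f _ _|_]; last exact: compact0.
  by exists fset0.
pose T' : ptopologicalType := HB.pack (Topological.sort T) (isPointed.Build (Topological.sort T) x0).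
have H : @compact T' A = cover_compact (A : set T') by rewrite compact_cover.
by split => [|?]; rewrite -[compact A]/(@compact T' A) H.
Qed.

Section GroupoidTopology.
Variable E : digraph.
Local Notation G := (path_groupoid E).
Implicit Types (a b : finpath E) (x y z : ipath E) (g h : G).

(** Depths from which the two paths of g run in step; the cells cut at depths p + n and q + n form a
    neighbourhood basis of g. *)
Definition lag g (p q : nat) := gk g = q%:Z - p%:Z /\ ishift p (gr g) = ishift q (gd g).

Lemma lag_tgt g p q n : lag g p q ->
  ftgt (ipre (gr g) (p + n)) = ftgt (ipre (gd g) (q + n)).
Proof. by move=> [_ e]; rewrite !ftgt_ipre -!ivert_shift e. Qed.

Lemma gcyl_self g p q n : lag g p q -> gcyl (ipre (gr g) (p + n)) (ipre (gd g) (q + n)) g.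
Proof.
move=> [k e]; apply/gcylP; rewrite !flen_ipre; split; try exact: cyl_ipre.
  by rewrite k; lia.
by rewrite -!shift_shift e.
Qed.

Lemma gcyl_lag a b g : gcyl a b g -> lag g (flen a) (flen b).
Proof. by move=> /gcylP[_ _ k e]; split. Qed.

(* Membership in gcyl a b is decided on any basic neighbourhood of g which is at
   least as deep. *)
Lemma gcyl_local a b g p q n h : lag g p q -> (flen a <= p + n)%N -> (flen b <= q + n)%N ->
  gcyl (ipre (gr g) (p + n)) (ipre (gd g) (q + n)) h -> gcyl a b h <-> gcyl a b g.
Proof.
move=> [kg eg] pn qn /gcylP[/cyl_ipreP ch /cyl_ipreP dh kh].
rewrite !flen_ipre => eh; rewrite !flen_ipre in kh.
have main u w : ipre (gr u) (p + n) = ipre (gr w) (p + n) ->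
    ipre (gd u) (q + n) = ipre (gd w) (q + n) -> gk u = gk w -> gk u = q%:Z - p%:Z ->
    ishift (p + n) (gr w) = ishift (q + n) (gd w) -> gcyl a b u -> gcyl a b w.
  move=> e1 e2 ek ek' e3 /gcylP[c1 c2 k1 e4]; apply/gcylP; split.
  - by apply/cylE; rewrite -(ipre_le pn e1); exact/cylE.
  - by apply/cylE; rewrite -(ipre_le qn e2); exact/cylE.
  - by rewrite -ek.
  - apply: ipath_eq => i; rewrite !iedge_shift.
    have [il|il] := ltnP (flen a + i) (p + n).
      have il' : (flen b + i < q + n)%N by lia.
      have /ipreP[_ <-//] := e1; have /ipreP[_ <-//] := e2.
      by rewrite -!iedge_shift e4.
    have -> : (flen a + i = (p + n) + (flen a + i - (p + n)))%N by lia.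
    have -> : (flen b + i = (q + n) + (flen a + i - (p + n)))%N by lia.
    by rewrite -!iedge_shift e3.
have eg' : ishift (p + n) (gr g) = ishift (q + n) (gd g) by rewrite -!shift_shift eg.
by split; apply: main => //; rewrite ?kh ?kg//; lia.
Qed.

Lemma open_gcyl a b : ftgt a = ftgt b -> open (gcyl a b).
Proof.
move=> ab; have H : finI_from [set U | exists a b : finpath E, ftgt a = ftgt b /\ U = gcyl a b]
    id (gcyl a b).
  by exists [fset (gcyl a b)]%fset; [move=> i /fset1P ->; rewrite in_setE; exists a, b|
    apply/seteqP; split => x; [move=> /(_ (gcyl a b)); apply; rewrite /= inE|
     move=> cx i /=; rewrite inE => /eqP ->]].
by exists [set gcyl a b]; [move=> _ ->|rewrite bigcup_set1].
Qed.

Lemma nbhs_gcyl g p q (U : set G) : lag g p q -> nbhs g U ->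
  exists n, gcyl (ipre (gr g) (p + n)) (ipre (gd g) (q + n)) `<=` U.
Proof.
move=> lg; rewrite nbhsE => -[B [oB Bg] BU].
suff [n nB] : exists n, gcyl (ipre (gr g) (p + n)) (ipre (gd g) (q + n)) `<=` B.
  by exists n; apply: subset_trans BU.
case: oB => D' sD' BE; move: Bg; rewrite -BE => -[A DA /= Ag].
have [F FD FA] : finI_from
  [set U | exists a b : finpath E, ftgt a = ftgt b /\ U = gcyl a b] id A := sD' _ DA.
have key (S : set G) : S \in F -> exists n, forall m, (n <= m)%N ->
    gcyl (ipre (gr g) (p + m)) (ipre (gd g) (q + m)) `<=` S.
  move=> SF; have := FD S SF; rewrite in_setE => -[a [b [ab SE]]].
  have cg : gcyl a b g by rewrite -SE; move: Ag; rewrite -FA; apply.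
  exists (flen a + flen b)%N => m nm h ch.
  by rewrite SE; apply/(gcyl_local lg _ _ ch) => //; lia.
have [f fP] : {f : set G -> nat & forall S, S \in F -> forall m, (f S <= m)%N ->
    gcyl (ipre (gr g) (p + m)) (ipre (gd g) (q + m)) `<=` S}.
  apply: (@choice _ _ (fun S n => S \in F -> forall m, (n <= m)%N ->
    gcyl (ipre (gr g) (p + m)) (ipre (gd g) (q + m)) `<=` S)) => S.
  by have [/key[n]|] := boolP (S \in F); [exists n|exists 0%N].
exists (\max_(S <- F) f S)%N => h ch; exists A => //; rewrite -FA => S SF.
by apply: (fP S SF _ _ h ch); exact: leq_bigmax_seq.
Qed.

Lemma closed_gcyl a b : closed (gcyl a b).
Proof.
move=> g; have [p [q lg]] := arrowP g.
have := gcyl_self (flen a + flen b)%N lg; set A := gcyl _ _ => Ag.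
move=> /(_ A)[|h [abh Ah]].
  by apply: open_nbhs_nbhs; split => //; apply: open_gcyl; exact: lag_tgt lg.
by apply/(gcyl_local lg _ _ Ah) => //; lia.
Qed.

Hypothesis rf : row_finite E.

(** The map sending z to [slice a b (icat a z)] parametrises Z(a, b) by the paths from t(a), and the
    fan theorem applies to these. *)
Lemma compact_gcyl a b : ftgt a = ftgt b -> compact (gcyl a b).
Proof.
move=> ab; apply/compact_coverP => I D f fo cov.
pose P nu := exists i, D i /\ forall z, isrc z = ftgt a -> cyl nu z ->
  f i (slice a b (icat a z)).
have scell z : isrc z = ftgt a -> [/\ gcyl a b (slice a b (icat a z)),
    gr (slice a b (icat a z)) = icat a z & gd (slice a b (icat a z)) = icat b z].
  move=> za; have ca : cyl a (icat a z) by apply: cyl_icat.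
  by have [r d c] := sliceP ca ab; split => //; rewrite d shift_icat.
have [||N NP] := @fan E rf (ftgt a) P.
- move=> x m n mn [i [Di H]]; exists i; split => // z za /cyl_ipreP e; apply: H => //.
  by apply/cyl_ipreP; apply: ipre_le e.
- move=> x xa; have [cx rx dx] := scell x xa.
  have [i Di fi] := cov _ cx.
  have [n nf] := nbhs_gcyl (gcyl_lag cx) (open_nbhs_nbhs (conj (fo i Di) fi)).
  exists n, i; split => // z za /cyl_ipreP zx; apply: nf.
  have [/gcylP[_ _ k _] rz dz] := scell z za.
  have e1 : ipre (icat a z) (flen a + n) = ipre (icat a x) (flen a + n).
    by rewrite !ipreD !ipre_icat// !shift_icat// zx.
  have e2 : ipre (icat b z) (flen b + n) = ipre (icat b x) (flen b + n).
    by rewrite !ipreD !ipre_icat -?ab// !shift_icat -?ab// zx.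
  apply/gcylP; rewrite !flen_ipre rx dx rz dz k; split.
  + exact/cyl_ipreP.
  + exact/cyl_ipreP.
  + lia.
  + by rewrite -!shift_shift !shift_icat// -ab.
have [s us sE] := finite_set_seq (@finite_paths E rf (ftgt a) N).
have [ix ixP] : {ix : finpath E -> option I & forall nu, P nu ->
    exists2 i, ix nu = Some i & D i /\ forall z, isrc z = ftgt a -> cyl nu z ->
      f i (slice a b (icat a z))}.
  apply: (@choice _ _ (fun nu o => P nu -> exists2 i, o = Some i &
    D i /\ forall z, isrc z = ftgt a -> cyl nu z -> f i (slice a b (icat a z)))) => nu.
  by have [[i H]|nP] := pselect (P nu); [exists (Some i) => _; exists i|exists None].
pose Pb nu := `[< P nu >].
exists [fset i | i in pmap ix [seq nu <- s | Pb nu]]%fset.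
  move=> i; rewrite !inE => /=; rewrite mem_pmap => /mapP[nu].
  rewrite mem_filter => /andP[/asboolP Pnu _] e.
  by have [j jE [Dj _]] := ixP _ Pnu; move: e; rewrite jE => -[->]; rewrite ?in_setE.
move=> g cg; have /gcylP[ca cb _ _] := cg.
pose z := ishift (flen a) (gr g); have za : isrc z = ftgt a by rewrite (cyl_tgt ca).
have gE : g = slice a b (icat a z) by rewrite icat_shift//; exact: slice_unique.
have Pz := NP z za; have [i iE [Di Hi]] := ixP _ Pz.
exists i; last by rewrite gE; apply: Hi => //; exact: cyl_ipre.
rewrite /= !inE /= mem_pmap; apply/mapP; exists (ipre z N) => //.
rewrite mem_filter; apply/andP; split; first exact/asboolP.
by apply/sE; split => //; exact: flen_ipre.
Qed.

End GroupoidTopology.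

(** * Step functions *)

Lemma gcyl_fcat (E : digraph) (a b nu : finpath E) g :
  ftgt a = ftgt b -> ftgt a = fsrc nu ->
  gcyl (fcat a nu) (fcat b nu) g <-> gcyl a b g /\ cyl nu (ishift (flen a) (gr g)).
Proof.
move=> ab an; have bn : ftgt b = fsrc nu by rewrite -ab.
split=> [/gcylP[/(cyl_fcat _ an)[c1 c2] /(cyl_fcat _ bn)[c3 c4]]|[/gcylP[c1 c3 k e] c2]].
  rewrite !flen_fcat// => k e; split => //; apply/gcylP; split => //; first by rewrite k; lia.
  rewrite -(icat_shift c2) -(icat_shift c4); congr icat.
  by rewrite !shift_shift.
apply/gcylP; rewrite !flen_fcat//; split.
- by apply/(cyl_fcat _ an).
- by apply/(cyl_fcat _ bn); rewrite -e.
- by rewrite k; lia.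
- by rewrite -!shift_shift e.
Qed.

Section CompactlySupported.
Variables (R : realType) (E : digraph).
Hypothesis rf : row_finite E.
Local Notation G := (path_groupoid E).
Local Notation C := R[i].
Implicit Types (a b : finpath E) (u f xi h : G -> C) (g : G).

Definition cellind a b : G -> C := fun g => if `[< gcyl a b g >] then 1 else 0.

Definition supported_in (l : seq (finpath E * finpath E)) f :=
  (forall c, c \in l -> ftgt c.1 = ftgt c.2) /\
  forall g, f g != 0 -> exists2 c, c \in l & gcyl c.1 c.2 g.

(** Cells are open and cover G, so a compact support meets finitely many; conversely a finite union
    of cells is compact and closed. *)
Lemma CcP f : Cc f <-> continuous (f : G -> C^o) /\ exists l, supported_in l f.
Proof.
split=> [[cf /compact_coverP K]|[cf [l [lv lf]]]]; split => //.
  have [||F FD Fc] := K _ [set c : finpath E * finpath E | ftgt c.1 = ftgt c.2]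
    (fun c => gcyl c.1 c.2).
  - by move=> c; exact: open_gcyl.
  - move=> g _; have [p [q lg]] := arrowP g.
    exists (ipre (gr g) (p + 0), ipre (gd g) (q + 0)); first exact: lag_tgt lg.
    exact: gcyl_self.
  exists (enum_fset F); split.
    by move=> c cF; have := FD c cF; rewrite in_setE.
  by move=> g fg; have [c cF cg] := Fc g (@subset_closure G [set h | f h != 0] g fg); exists c.
have [cK clK] : compact (\big[setU/set0]_(c <- l | ftgt c.1 == ftgt c.2) gcyl c.1 c.2) /\
    closed (\big[setU/set0]_(c <- l | ftgt c.1 == ftgt c.2) gcyl c.1 c.2).
  split; first by apply: bigsetU_compact => c /eqP; exact: compact_gcyl.
  apply: (big_ind (@closed G)) => [|X Y|c _]; [exact: closed0|exact: closedU|exact: closed_gcyl].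
apply: subclosed_compact cK _; first exact: closed_closure.
rewrite [X in _ `<=` X](closure_id _).1//; apply: closure_subset => g /= fg.
have [c cl cg] := lf g fg; rewrite -bigcup_seq_cond; exists c => //=.
by rewrite cl lv// eqxx.
Qed.

Lemma cellindP a b g : cellind a b g != 0 -> gcyl a b g.
Proof. by rewrite /cellind; case: asboolP => //; rewrite eqxx. Qed.

Lemma cellind1 a b g : gcyl a b g -> cellind a b g = 1.
Proof. by move=> c; rewrite /cellind asboolT. Qed.

Lemma cellind0 a b g : ~ gcyl a b g -> cellind a b g = 0.
Proof. by move=> c; rewrite /cellind asboolF. Qed.

Lemma cellind_local a b g : nbhs g [set k | cellind a b k = cellind a b g].
Proof.
have [p [q lg]] := arrowP g.
have := gcyl_self (flen a + flen b)%N lg; set K := gcyl _ _ => Kg.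
have nK : nbhs g K by apply: open_nbhs_nbhs; split => //; apply: open_gcyl; exact: lag_tgt lg.
apply: filterS nK => k Kk /=; rewrite /cellind.
rewrite (_ : `[< gcyl a b k >] = `[< gcyl a b g >]) //.
by apply/asbool_equiv_eq/(gcyl_local lg _ _ Kk); lia.
Qed.

Lemma continuous_cellind a b : continuous (cellind a b : G -> C^o).
Proof.
move=> g U /nbhs_singleton Ug; apply: filterS (cellind_local a b g) => k /= kg.
by rewrite kg.
Qed.

Lemma Cc_cellind a b : ftgt a = ftgt b -> Cc (cellind a b).
Proof.
move=> ab; apply/CcP; split; first exact: continuous_cellind.
exists [:: (a, b)]; split; first by move=> c; rewrite mem_seq1 => /eqP ->.
by move=> g /cellindP cg; exists (a, b); rewrite ?mem_head.
Qed.

Lemma Cc_lin (c : C) f h : Cc f -> Cc h -> Cc (fun g => c * f g + h g).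
Proof.
move=> /CcP[cf [l [lv lf]]] /CcP[ch [m [mv mh]]]; apply/CcP; split.
  move=> g; have cfg := @cvgZl_tmp C C^o G (nbhs g) (nbhs_filter g) c f (f g) (cf g).
  exact: (@cvgD C C^o G (nbhs g) (nbhs_filter g) _ h _ _ cfg (ch g)).
exists (l ++ m); split.
  by move=> d; rewrite mem_cat => /orP[/lv|/mv].
move=> g; have [f0|/lf[d dl dg] _] := eqVneq (f g) 0.
  rewrite f0 mulr0 add0r => /mh[d dm dg]; exists d => //; by rewrite mem_cat dm orbT.
by exists d => //; rewrite mem_cat dl.
Qed.

Lemma Cc0 : Cc (fun _ : G => 0 : C).
Proof.
apply/CcP; split; first exact: cst_continuous.
by exists [::]; split => // g; rewrite eqxx.
Qed.

Lemma Cc_mul_cellind a b f : Cc f -> Cc (fun g => f g * cellind a b g).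
Proof.
move=> /CcP[cf [l [lv lf]]]; apply/CcP; split.
  move=> g U; rewrite /= mulrC => nU.
  have H1 := @cvgZl_tmp C C^o G (nbhs g) (nbhs_filter g) (cellind a b g) f (f g) (cf g) U nU.
  apply: (@filterS2 _ _ (nbhs_filter g) _ _ _ _ H1 (cellind_local a b g)) => k /= kU kg.
  by rewrite mulrC kg.
exists l; split => // g; rewrite mulf_eq0 negb_or => /andP[fg _]; exact: lf.
Qed.

Lemma Cc_sum (I : Type) (r : seq I) (P : pred I) (F : I -> G -> C) :
  (forall i, P i -> Cc (F i)) -> Cc (fun g => \sum_(i <- r | P i) F i g).
Proof.
move=> H; elim: r => [|i r IH].
  by have -> : (fun g => \sum_(i <- [::] | P i) F i g) = (fun=> 0);
    [apply/funext => g; rewrite big_nil|exact: Cc0].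
case Pi : (P i); last first.
  by have -> : (fun g => \sum_(j <- i :: r | P j) F j g) = (fun g => \sum_(j <- r | P j) F j g);
    [apply/funext => g; rewrite big_cons Pi|].
have -> : (fun g => \sum_(j <- i :: r | P j) F j g) =
   (fun g => 1 * F i g + \sum_(j <- r | P j) F j g).
  by apply/funext => g; rewrite big_cons Pi mul1r.
by apply: Cc_lin => //; exact: H.
Qed.

Definition comb (l : seq (C * (finpath E * finpath E))) : G -> C :=
  fun g => \sum_(t <- l) t.1 * cellind t.2.1 t.2.2 g.

Definition valid (l : seq (C * (finpath E * finpath E))) :=
  forall t, t \in l -> ftgt t.2.1 = ftgt t.2.2.

Definition step_fun f := exists2 l, valid l & f = comb l.

Lemma step_fun_Cc f : step_fun f -> Cc f.
Proof.
move=> [l lv ->]; rewrite /comb.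
have -> : (fun g => \sum_(t <- l) t.1 * cellind t.2.1 t.2.2 g) =
    (fun g => \sum_(t <- l | t \in l) (t.1 * cellind t.2.1 t.2.2 g)).
  by apply/funext => g; rewrite big_seq.
apply: Cc_sum => t /lv tv.
have -> : (fun g => t.1 * cellind t.2.1 t.2.2 g) =
    (fun g => t.1 * cellind t.2.1 t.2.2 g + (fun=> 0) g).
  by apply/funext => g; rewrite addr0.
by apply: Cc_lin; [exact: Cc_cellind|exact: Cc0].
Qed.

Lemma step_fun0 : step_fun (fun=> 0).
Proof. by exists [::] => //; apply/funext => g; rewrite /comb big_nil. Qed.

Lemma step_fun_cell a b : ftgt a = ftgt b -> step_fun (cellind a b).
Proof.
move=> ab; exists [:: (1, (a, b))]; first by move=> t; rewrite mem_seq1 => /eqP ->.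
by apply/funext => g; rewrite /comb big_seq1 mul1r.
Qed.

Lemma step_fun_lin (c : C) f h : step_fun f -> step_fun h -> step_fun (fun g => c * f g + h g).
Proof.
move=> [l lv ->] [m mv ->]; exists ([seq (c * t.1, t.2) | t <- l] ++ m).
  by move=> t; rewrite mem_cat => /orP[/mapP[s /lv sv ->]|/mv].
apply/funext => g; rewrite /comb big_cat big_map mulr_sumr; congr (_ + _).
by apply: eq_bigr => t _; rewrite mulrA.
Qed.

Lemma step_funZ (c : C) f : step_fun f -> step_fun (fun g => c * f g).
Proof.
move=> sf; have := step_fun_lin c sf step_fun0.
by congr step_fun; apply/funext => g; rewrite addr0.
Qed.

Lemma step_fun_sum (I : eqType) (r : seq I) (F : I -> G -> C) :
  (forall i, i \in r -> step_fun (F i)) -> step_fun (fun g => \sum_(i <- r) F i g).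
Proof.
elim: r => [|i r IH] H.
  by have -> : (fun g => \sum_(i <- [::]) F i g) = (fun=> 0);
    [apply/funext => g; rewrite big_nil|exact: step_fun0].
have -> : (fun g => \sum_(j <- i :: r) F j g) = (fun g => 1 * F i g + \sum_(j <- r) F j g).
  by apply/funext => g; rewrite big_cons mul1r.
apply: step_fun_lin; first by apply: H; exact: mem_head.
by apply: IH => j jr; apply: H; rewrite inE jr orbT.
Qed.

Section Completion.
Variables (A : cstarAlgType R) (iota : (G -> C) -> A).
Hypothesis gA : is_groupoid_cstar iota.

Lemma iota0 : iota (fun=> 0) = 0.
Proof.
have := iota_linear gA 1 Cc0 Cc0.
have -> : (fun g : G => 1 * 0 + 0) = (fun=> 0 : C) by apply/funext => g; rewrite mulr0 addr0.
by rewrite scale1r => /eqP; rewrite -subr_eq subrr => /eqP.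
Qed.

Lemma iotaD f h : Cc f -> Cc h -> iota (fun g => f g + h g) = iota f + iota h.
Proof.
move=> cf ch; have := iota_linear gA 1 cf ch; rewrite scale1r => <-; congr iota.
by apply/funext => g; rewrite mul1r.
Qed.

Lemma iotaZ c f : Cc f -> iota (fun g => c * f g) = c *: iota f.
Proof.
move=> cf; have := iota_linear gA c cf Cc0; rewrite iota0 addr0 => <-; congr iota.
by apply/funext => g; rewrite addr0.
Qed.

Lemma CcB f h : Cc f -> Cc h -> Cc (fun g => f g - h g).
Proof.
move=> cf ch; have := Cc_lin (-1) ch cf; congr Cc.
by apply/funext => g; rewrite mulN1r addrC.
Qed.

Lemma iotaB f h : Cc f -> Cc h -> iota (fun g => f g - h g) = iota f - iota h.
Proof.
move=> cf ch; have := iota_linear gA (-1) ch cf; rewrite scaleN1r addrC => <-; congr iota.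
by apply/funext => g; rewrite mulN1r addrC.
Qed.

Lemma iota_sum (I : eqType) (r : seq I) (F : I -> G -> C) :
  (forall i, i \in r -> Cc (F i)) ->
  iota (fun g => \sum_(i <- r) F i g) = \sum_(i <- r) iota (F i).
Proof.
elim: r => [|i r IH] H.
  by rewrite big_nil -iota0; congr iota; apply/funext => g; rewrite big_nil.
rewrite big_cons -IH; last by move=> j jr; apply: H; rewrite inE jr orbT.
rewrite -iotaD; first by congr iota; apply/funext => g; rewrite big_cons.
- by apply: H; exact: mem_head.
- have -> : (fun g => \sum_(j <- r) F j g) = (fun g => \sum_(j <- r | j \in r) F j g).
    by apply/funext => g; rewrite big_seq.
  by apply: Cc_sum => j jr; apply: H; rewrite inE jr orbT.
Qed.

Lemma rnorm_iota f (c : R) : Cc f -> (reduced_norm f <= c%:E)%E -> rnorm (iota f) <= c.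
Proof. by move=> cf; rewrite -(iota_norm gA cf) lee_fin. Qed.

Lemma rnorm_iota_cell a b f (c : R) : 0 <= c -> ftgt a = ftgt b -> Cc f ->
  (forall g, f g != 0 -> gcyl a b g) -> (forall g, rnorm (f g) <= c) ->
  rnorm (iota f) <= c.
Proof. by move=> c0 ab cf sf fc; apply: rnorm_iota => //; exact: reduced_norm_cell sf fc. Qed.

(** The fan theorem gives uniform continuity: at some depth N, f varies by at most e on every
    subcell. The difference lives on a single cell, where the supremum bounds the norm. *)
Lemma step_fun_approx_cell a b f (e : R) : ftgt a = ftgt b -> Cc f ->
  (forall g, f g != 0 -> gcyl a b g) -> 0 < e ->
  exists2 s, step_fun s & rnorm (iota f - iota s) <= e.
Proof.
move=> ab cf sf e0.
have scell z : isrc z = ftgt a -> [/\ gcyl a b (slice a b (icat a z)),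
    gr (slice a b (icat a z)) = icat a z & gd (slice a b (icat a z)) = icat b z].
  move=> za; have ca : cyl a (icat a z) by apply: cyl_icat.
  by have [r d c] := sliceP ca ab; split => //; rewrite d shift_icat.
pose P nu := forall z z', isrc z = ftgt a -> isrc z' = ftgt a -> cyl nu z -> cyl nu z' ->
  rnorm (f (slice a b (icat a z)) - f (slice a b (icat a z'))) <= e.
have [||N NP] := @fan E rf (ftgt a) P.
- move=> x m n mn H z z' za za' /cyl_ipreP zx /cyl_ipreP zx'.
  by apply: H => //; apply/cyl_ipreP; [apply: ipre_le zx|apply: ipre_le zx'].
- move=> x xa; have [cx rx dx] := scell x xa.
  have e20 : 0 < e / 2 by rewrite divr_gt0.
  have [cont _] := cf.
  have /cvg_ballP /(_ (e / 2)%:C) := cont (slice a b (icat a x)).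
  rewrite ltcR => /(_ e20) /(nbhs_gcyl (gcyl_lag cx)) [n nf].
  exists n => z z' za za' /cyl_ipreP zx /cyl_ipreP zx'.
  have main w : isrc w = ftgt a -> ipre w n = ipre x n ->
      rnorm (f (slice a b (icat a x)) - f (slice a b (icat a w))) < e / 2.
    move=> wa wx; have := nf (slice a b (icat a w)).
    have [/gcylP[_ _ k _] rw_ dw] := scell w wa.
    have e1 : ipre (icat a w) (flen a + n) = ipre (icat a x) (flen a + n).
      by rewrite !ipreD !ipre_icat// !shift_icat// wx.
    have e2 : ipre (icat b w) (flen b + n) = ipre (icat b x) (flen b + n).
      by rewrite !ipreD !ipre_icat -?ab// !shift_icat -?ab// wx.
    have cw : gcyl (ipre (gr (slice a b (icat a x))) (flen a + n))
       (ipre (gd (slice a b (icat a x))) (flen b + n)) (slice a b (icat a w)).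
      apply/gcylP; rewrite !flen_ipre rx dx rw_ dw k; split.
      + exact/cyl_ipreP.
      + exact/cyl_ipreP.
      + lia.
      + by rewrite -!shift_shift !shift_icat// -ab.
    move=> /(_ cw) /=; rewrite -ball_normE /ball_ /=.
    by rewrite (rnormE (V := C^o)) ltcR.
  apply: le_trans (rdist_triangle (V := C^o) (f (slice a b (icat a x))) _ _) _.
  rewrite (rdistC (V := C^o)) [e]splitr; apply: lerD; exact/ltW/main.
have [s us sE] := finite_set_seq (@finite_paths E rf (ftgt a) N).
have [v vP] : {v : finpath E -> C & forall nu, nu \in s -> forall z, isrc z = ftgt a ->
    cyl nu z -> rnorm (f (slice a b (icat a z)) - v nu) <= e}.
  apply: (@choice _ _ (fun nu c => nu \in s -> forall z, isrc z = ftgt a ->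
    cyl nu z -> rnorm (f (slice a b (icat a z)) - c) <= e)) => nu.
  have [[z0 [z0a z0n]]|nz] := pselect (exists z, isrc z = ftgt a /\ cyl nu z); last first.
    by exists 0 => _ z za zn; case: nz; exists z.
  exists (f (slice a b (icat a z0))) => /sE[nua nuN] z za zn.
  have := NP z za; have -> : ipre z N = nu by rewrite -nuN; exact/cylE.
  by apply.
pose F nu g := v nu * cellind (fcat a nu) (fcat b nu) g.
have nua nu : nu \in s -> ftgt a = fsrc nu by move=> /sE[].
have sF : step_fun (fun g => \sum_(nu <- s) F nu g).
  apply: step_fun_sum => nu /nua an; apply: step_funZ; apply: step_fun_cell.
  by rewrite !ftgt_fcat// -ab.
exists (fun g => \sum_(nu <- s) F nu g) => //.
have cF := step_fun_Cc sF.
rewrite -iotaB//; apply: (rnorm_iota_cell (ltW e0) ab) => [|g|g].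
- exact: CcB.
- apply: contraNP => ng; have -> : f g = 0.
    by apply/eqP/negPn/negP => /sf.
  rewrite big1_seq ?subrr// => nu /= /nua an; rewrite /F cellind0 ?mulr0//.
  by move=> /(gcyl_fcat _ ab an)[].
- have [cg|ncg] := pselect (gcyl a b g); last first.
    have -> : f g = 0 by apply/eqP/negPn/negP => /sf.
    rewrite big1_seq ?subrr ?/rnorm ?normr0 ?(ltW e0)// => nu /= /nua an; rewrite /F cellind0 ?mulr0//.
    by move=> /(gcyl_fcat _ ab an)[].
  have /gcylP[ca cb _ _] := cg.
  pose z := ishift (flen a) (gr g); have za : isrc z = ftgt a by rewrite (cyl_tgt ca).
  have gE : g = slice a b (icat a z) by rewrite icat_shift//; exact: slice_unique.
  have zs : ipre z N \in s by apply/sE; split => //; exact: flen_ipre.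
  rewrite (bigD1_seq (ipre z N))//= big1_seq ?addr0.
    rewrite /F cellind1 ?mulr1.
      by rewrite {1}gE; apply: vP => //; exact: cyl_ipre.
    by apply/(gcyl_fcat _ ab (nua _ zs)); split => //; exact: cyl_ipre.
  move=> nu /andP[nuz nus]; rewrite /F cellind0 ?mulr0// => /(gcyl_fcat _ ab (nua _ nus))[_ /cylE zn].
  by move/eqP: nuz; apply; rewrite -zn; have [_ ->] := proj1 (sE _) nus.
Qed.

(** Cells are peeled off one at a time: what remains of f after restriction to the first cell
    vanishes there and is supported in the others. *)
Theorem step_fun_approx f (e : R) : Cc f -> 0 < e ->
  exists2 s, step_fun s & rnorm (iota f - iota s) <= e.
Proof.
move=> cf; have /CcP[_ [l]] := cf.
elim: l f cf e => [|[a b] l IH] f cf e [lv lf] e0.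
  exists (fun=> 0); first exact: step_fun0.
  have -> : f = fun=> 0.
    by apply/funext => g; apply/eqP/negPn/negP => /lf[c].
  by rewrite subrr rnorm0 ltW.
have ab : ftgt a = ftgt b by apply: (lv (a, b)); exact: mem_head.
have e20 : 0 < e / 2 by rewrite divr_gt0.
have cf1 : Cc (fun g => f g * cellind a b g) by exact: Cc_mul_cellind.
have cf2 : Cc (fun g => f g - f g * cellind a b g) by exact: CcB.
have [|s1 ss1 h1] := step_fun_approx_cell ab cf1 _ e20.
  by move=> g; rewrite mulf_eq0 negb_or => /andP[_ /cellindP].
have [|s2 ss2 h2] := IH _ cf2 _ _ e20.
  split=> [c cl|g]; first by apply: lv; rewrite inE cl orbT.
  rewrite -{1}[f g]mulr1 -mulrBr mulf_eq0 negb_or => /andP[/lf[c cl cg]].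
  have [cab|ncab] := pselect (gcyl a b g); first by rewrite cellind1// subrr eqxx.
  move=> _; exists c => //; move: cl; rewrite inE => /predU1P[cE|//].
  by move: cg; rewrite cE.
exists (fun g => s1 g + s2 g).
  have := step_fun_lin 1 ss1 ss2; congr step_fun.
  by apply/funext => g; rewrite mul1r.
have -> : f = (fun g => f g * cellind a b g + (f g - f g * cellind a b g)).
  by apply/funext => g; rewrite addrC subrK.
rewrite (iotaD cf1 cf2) (iotaD (step_fun_Cc ss1) (step_fun_Cc ss2)).
rewrite opprD addrACA [e]splitr; apply: le_trans (rnormD _ _) _.
exact: lerD.
Qed.

Lemma step_fun_dense (x : A) (e : R) : 0 < e ->
  exists2 s, step_fun s & rnorm (x - iota s) < e.
Proof.
move=> e0; have e20 : 0 < e / 2 by rewrite divr_gt0.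
have [_ [f cf <-] xf] := dense_rnorm x (iota_dense gA) e20.
have [s ss fs] := step_fun_approx cf e20; exists s => //.
apply: le_lt_trans (rdist_triangle (iota f) _ _) _.
by rewrite [e]splitr; apply: ltr_leD.
Qed.

End Completion.
End CompactlySupported.

(** * Products of cells *)

Section CellProducts.
Variable E : digraph.
Local Notation G := (path_groupoid E).
Implicit Types (a b c d kap mu : finpath E) (x y z : ipath E) (g h : G).

Lemma cyl_prefix b c x : cyl b x -> cyl c x -> (flen b <= flen c)%N ->
  exists2 kap, ftgt b = fsrc kap & c = fcat b kap.
Proof.
move=> cb cc bc; exists (ipre (ishift (flen b) x) (flen c - flen b)).
  by rewrite (cyl_tgt cb).
by rewrite -{1}(proj1 (cylE _ _) cc) -{1}(subnKC bc) ipreD (proj1 (cylE _ _) cb).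
Qed.

Lemma swap_id mu g : cyl mu (gr g) -> swap mu mu g = g.
Proof.
move=> c; have [r k d] := swapP c erefl; apply: arrow_eq => //.
  by rewrite r icat_shift.
by rewrite k addrK.
Qed.

Lemma gcyl_unit mu x : cyl mu x -> gcyl mu mu (gunit x).
Proof. by move=> c; apply/gcylP; split => //=; rewrite subrr. Qed.

Lemma gcyl_diag mu g : gcyl mu mu g -> g = gunit (gd g) /\ cyl mu (gd g).
Proof.
move=> /gcylP[c1 c2 k e]; split => //; apply: arrow_eq => //=.
  by rewrite -(icat_shift c1) e icat_shift.
by rewrite k subrr.
Qed.

Lemma gcyl_ginv a b g : gcyl a b (ginv g) <-> gcyl b a g.
Proof.
by split=> /gcylP[/= c1 c2 k e]; apply/gcylP; split => //=; [rewrite -[gk g]opprK k opprB|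
  rewrite k opprB].
Qed.

(** The case c = b kap of the product Z(a, b) Z(c, d), which is then Z(a kap, d). *)
Lemma gcyl_swap_ext a b d kap g : ftgt a = ftgt b -> ftgt b = fsrc kap ->
  (cyl a (gr g) /\ gcyl (fcat b kap) d (swap a b g)) <-> gcyl (fcat a kap) d g.
Proof.
move=> ab bk; have ak : ftgt a = fsrc kap by rewrite ab.
split=> [[ca]|cg].
  have [r k dd] := swapP ca ab; have t := cyl_tgt ca; rewrite ab in t.
  move=> /gcylP[]; rewrite r k dd flen_fcat// => /(cyl_fcat _ bk)[_].
  rewrite shift_icat// => ck cd kE.
  rewrite -shift_shift shift_icat// shift_shift => e.
  apply/gcylP; rewrite flen_fcat//; split => //; last by lia.
  by apply/(cyl_fcat _ ak).
have /gcylP[/(cyl_fcat _ ak)[ca ck] cd kE e] := cg; split => //.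
have [r k dd] := swapP ca ab; have t := cyl_tgt ca; rewrite ab in t.
rewrite flen_fcat// in kE e.
apply/gcylP; rewrite r k dd flen_fcat//; split => //.
- by apply/(cyl_fcat _ bk); rewrite shift_icat//; split => //; exact: cyl_icat.
- by rewrite kE; lia.
- by rewrite -shift_shift shift_icat// shift_shift.
Qed.

(** The case b = c kap, where the product is Z(a, d kap). *)
Lemma gcyl_swap_restr a c d kap g : ftgt a = ftgt kap -> ftgt c = fsrc kap -> ftgt c = ftgt d ->
  (cyl a (gr g) /\ gcyl c d (swap a (fcat c kap) g)) <-> gcyl a (fcat d kap) g.
Proof.
move=> ak ck cd; have dk : ftgt d = fsrc kap by rewrite -cd.
have ab : ftgt a = ftgt (fcat c kap) by rewrite ftgt_fcat.
split=> [[ca]|cg].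
  have [r k dd] := swapP ca ab; have t := cyl_tgt ca; rewrite ak in t.
  move=> /gcylP[]; rewrite r k dd flen_fcat// icat_fcat// => _ cd' kE.
  rewrite shift_icat ?isrc_icat// => e.
  apply/gcylP; rewrite flen_fcat//; split => //; last by rewrite -shift_shift -e shift_icat.
  - by apply/(cyl_fcat _ dk); split => //; rewrite -e; exact: cyl_icat.
  - by lia.
have /gcylP[ca /(cyl_fcat _ dk)[cd' ck'] kE e] := cg; split => //.
have [r k dd] := swapP ca ab; have t := cyl_tgt ca; rewrite ak in t.
rewrite flen_fcat// in kE e.
apply/gcylP; rewrite r k dd flen_fcat// icat_fcat//; split => //.
- by apply: cyl_icat; rewrite isrc_icat.
- by rewrite kE; lia.
- by rewrite shift_icat ?isrc_icat// e -shift_shift icat_shift.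
Qed.

End CellProducts.

(** * Step functions as an algebra with involution *)

Section StepAlgebra.
Variables (R : realType) (E : digraph).
Hypothesis rf : row_finite E.
Local Notation G := (path_groupoid E).
Local Notation C := R[i].
Implicit Types (a b c d kap mu : finpath E) (u f xi h : G -> C) (g : G).
Local Notation cellind := (@cellind R E).

Lemma gconv_cellind a b xi g : ftgt a = ftgt b ->
  gconv (cellind a b) xi g = if `[< cyl a (gr g) >] then xi (swap a b g) else 0.
Proof.
move=> ab; rewrite (gconv_cell _ _ (@cellindP R E a b) ab); case: asboolP => // ca.
by have [_ _ cg] := sliceP ca ab; rewrite cellind1// mul1r.
Qed.

Lemma gconv_diag_l mu xi g :
  gconv (cellind mu mu) xi g = if `[< cyl mu (gr g) >] then xi g else 0.
Proof. by rewrite gconv_cellind//; case: asboolP => // c; rewrite swap_id. Qed.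

Lemma gconv_diag_r mu xi g :
  gconv xi (cellind mu mu) g = if `[< cyl mu (gd g) >] then xi g else 0.
Proof.
rewrite /gconv -(@fsbig_widen _ _ _ _ [set (g, gunit (gd g))]) ?fsbig_set1 /=.
- case: asboolP => cd; first by rewrite cellind1 ?mulr1//; exact: gcyl_unit.
  by rewrite cellind0 ?mulr0// => /gcylP[].
- by move=> _ -> /=; split; rewrite //= addr0.
move=> [p q] /= [[dr rg kg dg] npq].
have [->|/cellindP/gcyl_diag[qE _]] := eqVneq (cellind mu mu q) 0; first by rewrite mulr0.
case: npq; rewrite qE -dg; congr pair => //; apply: arrow_eq; first by rewrite rg.
  by rewrite kg qE addr0.
by rewrite dr qE.
Qed.

Lemma gconv_cells a b c d : ftgt a = ftgt b -> ftgt c = ftgt d ->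
  [\/ exists2 kap, c = fcat b kap /\ ftgt b = fsrc kap &
        gconv (cellind a b) (cellind c d) = cellind (fcat a kap) d,
      exists2 kap, b = fcat c kap /\ ftgt c = fsrc kap &
        gconv (cellind a b) (cellind c d) = cellind a (fcat d kap) |
      (forall x, cyl b x -> cyl c x -> False) /\
        gconv (cellind a b) (cellind c d) = fun=> 0].
Proof.
move=> ab cd.
have [[x [cb cc]]|nx] := pselect (exists x, cyl b x /\ cyl c x); last first.
  apply: Or33; split=> [x cb cc|]; first by apply: nx; exists x.
  apply/funext => g; rewrite gconv_cellind//; case: asboolP => // ca.
  rewrite cellind0// => /gcylP[cc _ _ _]; apply: nx.
  by exists (gr (swap a b g)); split => //; exact: cyl_swap.
have [bc|cb'] := leqP (flen b) (flen c).
  have [kap bk cE] := cyl_prefix cb cc bc; apply: Or31; exists kap => //.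
  apply/funext => g; rewrite gconv_cellind//; subst c.
  have := gcyl_swap_ext d g ab bk; rewrite /cellind.
  case: asboolP => [ca|nca]; case: asboolP => [c1|nc1] H.
  - by rewrite asboolT//; apply/H.
  - by rewrite asboolF// => /H[].
  - by have [] := proj2 H c1.
  - by [].
have [kap ck bE] := cyl_prefix cc cb (ltnW cb'); apply: Or32; exists kap => //.
apply/funext => g; rewrite gconv_cellind//; subst b.
have ak : ftgt a = ftgt kap by rewrite ab ftgt_fcat.
have := gcyl_swap_restr g ak ck cd; rewrite /cellind.
case: asboolP => [ca|nca]; case: asboolP => [c1|nc1] H.
- by rewrite asboolT//; apply/H.
- by rewrite asboolF// => /H[].
- by have [] := proj2 H c1.
- by [].
Qed.

Lemma conv_finite0 xi g : conv_finite (fun=> 0) xi g.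
Proof.
rewrite /conv_finite (_ : _ `&` _ = set0)//; apply/seteqP; split => // p [_ /=].
by rewrite mul0r eqxx.
Qed.

Lemma conv_finite_step f xi g : step_fun f -> conv_finite f xi g.
Proof.
move=> [l lv ->]; elim: l lv => [|t l IH] lv.
  rewrite (_ : comb [::] = fun=> 0); first exact: conv_finite0.
  by apply/funext => h; rewrite /comb big_nil.
rewrite (_ : comb (t :: l) = fun k => t.1 * cellind t.2.1 t.2.2 k + comb l k); last first.
  by apply/funext => h; rewrite /comb big_cons.
apply: conv_finiteD; last by apply: IH => s sl; apply: lv; rewrite inE sl orbT.
apply: (@conv_finite_cell _ _ t.2.1 t.2.2); last by apply: lv; exact: mem_head.
by move=> h; rewrite mulf_eq0 negb_or => /andP[_ /cellindP].
Qed.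

(** Valid for arbitrary xi, since every cell contributes at most one term; it turns convolution by a
    step function into a finite sum. *)
Lemma gconv_comb l xi g : valid l -> gconv (comb l) xi g =
  \sum_(t <- l) t.1 * (if `[< cyl t.2.1 (gr g) >] then xi (swap t.2.1 t.2.2 g) else 0).
Proof.
elim: l => [|t l IH] lv.
  rewrite big_nil /gconv fsbig1// => p _; by rewrite /comb big_nil mul0r.
have lv' : valid l by move=> s sl; apply: lv; rewrite inE sl orbT.
have tv : ftgt t.2.1 = ftgt t.2.2 by apply: lv; exact: mem_head.
have tc k : t.1 * cellind t.2.1 t.2.2 k != 0 -> gcyl t.2.1 t.2.2 k.
  by rewrite mulf_eq0 negb_or => /andP[_ /cellindP].
rewrite (_ : comb (t :: l) = fun k => t.1 * cellind t.2.1 t.2.2 k + comb l k); last first.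
  by apply/funext => h; rewrite /comb big_cons.
rewrite gconvDl.
- rewrite big_cons IH//; congr (_ + _).
  rewrite (gconv_cell _ _ tc tv); case: asboolP => [ca|_]; last by rewrite mulr0.
  by have [_ _ cg] := sliceP ca tv; rewrite cellind1// mulr1.
- exact: conv_finite_cell tc tv.
- by apply: conv_finite_step; exists l.
Qed.

Lemma step_fun_gconv f h : step_fun f -> step_fun h -> step_fun (gconv f h).
Proof.
move=> [l lv ->] [m mv ->].
have -> : gconv (comb l) (comb m) = fun g => \sum_(t <- l) \sum_(s <- m)
    t.1 * s.1 * gconv (cellind t.2.1 t.2.2) (cellind s.2.1 s.2.2) g.
  apply/funext => g; rewrite gconv_comb//; apply: eq_big_seq => t tl.
  under eq_bigr do rewrite (gconv_cellind _ _ (lv t tl)).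
  case: asboolP => ca; last by rewrite mulr0 big1// => s _; rewrite mulr0.
  by rewrite /comb mulr_sumr; apply: eq_bigr => s _; rewrite mulrA.
apply: step_fun_sum => t tl; apply: step_fun_sum => s sm; apply: step_funZ.
have [ts ss] := (lv t tl, mv s sm).
have [[kap [e1 e2] ->]|[kap [e1 e2] ->]|[_ ->]] := gconv_cells ts ss.
- by apply: step_fun_cell; rewrite ftgt_fcat -?ss ?e1 ?ftgt_fcat// ts.
- by apply: step_fun_cell; rewrite ftgt_fcat -?ss// ts e1 ftgt_fcat.
- exact: step_fun0.
Qed.

Lemma ginvol_cellind a b : ginvol (cellind a b) = cellind b a.
Proof.
apply/funext => g; rewrite /ginvol /cellind.
have -> : `[< gcyl a b (ginv g) >] = `[< gcyl b a g >] by apply/asbool_equiv_eq/gcyl_ginv.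
by case: asboolP => _; rewrite ?conjC1 ?conjC0.
Qed.

Lemma step_fun_ginvol f : step_fun f -> step_fun (ginvol f).
Proof.
move=> [l lv ->]; exists [seq (t.1^*, (t.2.2, t.2.1)) | t <- l].
  by move=> _ /mapP[t /lv tv ->].
apply/funext => g; rewrite /ginvol /comb big_map rmorph_sum; apply: eq_bigr => t _ /=.
by rewrite rmorphM /= -[in RHS]ginvol_cellind.
Qed.

Section Completion.
Variables (A : cstarAlgType R) (iota : (G -> C) -> A).
Hypothesis gA : is_groupoid_cstar iota.
Local Notation "x ** y" := (cmul x y) (at level 40, left associativity).
Local Notation "x ^#" := (cstar x) (at level 2, format "x ^#").

Definition ecell a b : A := iota (cellind a b).

Lemma ecell_star a b : ftgt a = ftgt b -> (ecell a b)^# = ecell b a.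
Proof. by move=> ab; rewrite -(iota_star gA) ?ginvol_cellind//; exact: Cc_cellind. Qed.

Lemma ecell_mul_id a b d : ftgt a = ftgt b -> ftgt b = ftgt d -> ecell a b ** ecell b d = ecell a d.
Proof.
move=> ab bd; rewrite -(iota_mul gA); try exact: Cc_cellind; congr iota; apply/funext => g.
rewrite gconv_cellind// /cellind.
case: asboolP => [ca|nca]; last by rewrite asboolF// => /gcylP[].
have [r k dd] := swapP ca ab; have t := cyl_tgt ca; rewrite ab in t.
congr (if _ then _ else _); apply/asbool_equiv_eq; split=> /gcylP[c1 c2 k1 e1]; apply/gcylP.
  rewrite r k dd in c1 c2 k1 e1; split => //; last by rewrite -e1 shift_icat.
  by move: k1; lia.
rewrite r k dd; split => //; last by rewrite shift_icat.
- exact: cyl_icat.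
- by rewrite k1; lia.
Qed.

Lemma ecell_mul0 a b c d : ftgt a = ftgt b -> ftgt c = ftgt d ->
  (forall x, cyl b x -> cyl c x -> False) -> ecell a b ** ecell c d = 0.
Proof.
move=> ab cd bc; rewrite -(iota_mul gA); try exact: Cc_cellind.
rewrite -(iota0 rf gA); congr iota; apply/funext => g.
rewrite gconv_cellind//; case: asboolP => // ca.
rewrite cellind0// => /gcylP[cc _ _ _]; apply: (bc (gr (swap a b g))) => //; exact: cyl_swap.
Qed.

Definition pcyl mu : A := ecell mu mu.

Lemma pcyl_projection mu : projection (pcyl mu).
Proof. by split; [exact: ecell_star|exact: ecell_mul_id]. Qed.

Lemma pcyl_mul mu nu : cyl nu `<=` cyl mu -> pcyl mu ** pcyl nu = pcyl nu.
Proof.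
move=> nm; rewrite -(iota_mul gA); try exact: Cc_cellind; congr iota; apply/funext => g.
rewrite gconv_diag_l; case: asboolP => // nc; rewrite cellind0// => /gcylP[/nm].
by [].
Qed.

Lemma pcyl_ecell mu a b : ftgt a = ftgt b -> cyl a `<=` cyl mu -> pcyl mu ** ecell a b = ecell a b.
Proof.
move=> ab am; rewrite -[in LHS](ecell_mul_id (erefl _) ab) cmulA pcyl_mul//.
exact: ecell_mul_id.
Qed.

Lemma iota_ge f g : step_fun f -> rnorm (f g) <= rnorm (iota f).
Proof.
move=> sf; rewrite -lee_fin (iota_norm gA (step_fun_Cc rf sf)).
by apply: reduced_norm_ge => xi h; exact: conv_finite_step.
Qed.

Lemma iota_gconv f h : step_fun f -> step_fun h -> iota (gconv f h) = iota f ** iota h.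
Proof. by move=> sf sh; apply: (iota_mul gA); exact: step_fun_Cc. Qed.

Lemma iota_ginvol f : step_fun f -> iota (ginvol f) = (iota f)^#.
Proof. by move=> sf; apply: (iota_star gA); exact: step_fun_Cc. Qed.

Lemma rnorm_ecell a b : ftgt a = ftgt b -> rnorm (ecell a b) <= 1.
Proof.
move=> ab; apply: (rnorm_iota_cell gA ler01 ab).
- exact: Cc_cellind.
- by move=> g /cellindP.
- by move=> g; rewrite /cellind; case: asboolP => _; rewrite /rnorm ?normr1 ?normr0.
Qed.

Lemma iota_comb l : valid l -> iota (comb l) = \sum_(t <- l) t.1 *: ecell t.2.1 t.2.2.
Proof.
move=> lv; rewrite /comb (iota_sum rf gA).
  by apply: eq_big_seq => t /lv tv; rewrite (iotaZ rf gA)//; exact: Cc_cellind.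
move=> t /lv tv; apply: step_fun_Cc => //; apply: step_funZ; exact: step_fun_cell.
Qed.

End Completion.
End StepAlgebra.

(** * Positivity in the reduced norm *)

Section Positivity.
Variables (R : realType) (E : digraph).
Hypothesis rf : row_finite E.
Local Notation G := (path_groupoid E).
Local Notation C := R[i].
Implicit Types (a b c d kap mu : finpath E) (u f xi eta h : G -> C) (g : G).
Local Notation cellind := (@cellind R E).

Lemma swap_swap_ext a b d kap g : ftgt a = ftgt b -> ftgt b = fsrc kap -> ftgt kap = ftgt d ->
  cyl (fcat a kap) (gr g) -> swap (fcat b kap) d (swap a b g) = swap (fcat a kap) d g.
Proof.
move=> ab bk kd; have ak : ftgt a = fsrc kap by rewrite ab.
move=> cak; have /(cyl_fcat _ ak)[ca ck] := cak.
have t := cyl_tgt ca; rewrite ab in t.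
have [r1 k1 d1] := swapP ca ab.
have cbk : cyl (fcat b kap) (gr (swap a b g)).
  by rewrite r1; apply/(cyl_fcat _ bk); rewrite shift_icat//; split => //; exact: cyl_icat.
have e1 : ftgt (fcat b kap) = ftgt d by rewrite ftgt_fcat.
have e2 : ftgt (fcat a kap) = ftgt d by rewrite ftgt_fcat.
have [r2 k2 d2] := swapP cbk e1; have [r3 k3 d3] := swapP cak e2.
apply: arrow_eq; rewrite ?r2 ?k2 ?d2 ?r3 ?k3 ?d3 ?k1 ?d1 ?flen_fcat//; last by lia.
by congr icat; rewrite -!shift_shift r1 shift_icat.
Qed.

Lemma swap_swap_restr a c d kap g : ftgt a = ftgt kap -> ftgt c = fsrc kap -> ftgt c = ftgt d ->
  cyl a (gr g) -> swap c d (swap a (fcat c kap) g) = swap a (fcat d kap) g.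
Proof.
move=> ak ck cd ca; have dk : ftgt d = fsrc kap by rewrite -cd.
have t := cyl_tgt ca; rewrite ak in t.
have e1 : ftgt a = ftgt (fcat c kap) by rewrite ftgt_fcat.
have e2 : ftgt a = ftgt (fcat d kap) by rewrite ftgt_fcat.
have [r1 k1 d1] := swapP ca e1.
rewrite icat_fcat// in r1.
have cc : cyl c (gr (swap a (fcat c kap) g)) by rewrite r1; apply: cyl_icat; rewrite isrc_icat.
have [r2 k2 d2] := swapP cc cd.
have [r3 k3 d3] := swapP ca e2.
apply: arrow_eq; rewrite ?r2 ?k2 ?d2 ?r3 ?k3 ?d3 ?k1 ?d1 ?flen_fcat//; last by lia.
by rewrite r1 shift_icat ?isrc_icat// icat_fcat.
Qed.

Lemma gconv_assoc_cells a b c d xi : ftgt a = ftgt b -> ftgt c = ftgt d ->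
  gconv (gconv (cellind a b) (cellind c d)) xi = gconv (cellind a b) (gconv (cellind c d) xi).
Proof.
move=> ab cd; apply/funext => g; rewrite [RHS]gconv_cellind// [in RHS]gconv_cellind//.
have [[kap [cE bk] ->]|[kap [bE ck] ->]|[dis ->]] := gconv_cells R ab cd.
- subst c; have kd : ftgt kap = ftgt d by rewrite -cd ftgt_fcat.
  have ak : ftgt a = fsrc kap by rewrite ab.
  rewrite gconv_cellind; last by rewrite ftgt_fcat.
  case: asboolP => [cak|ncak].
    have /(cyl_fcat _ ak)[ca ck] := cak.
    rewrite asboolT// asboolT ?swap_swap_ext//.
    have [-> _ _] := swapP ca ab; have t := cyl_tgt ca; rewrite ab in t.
    by apply/(cyl_fcat _ bk); rewrite shift_icat//; split => //; exact: cyl_icat.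
  case: asboolP => // ca; rewrite asboolF//.
  have [-> _ _] := swapP ca ab; have t := cyl_tgt ca; rewrite ab in t.
  move=> /(cyl_fcat _ bk)[_]; rewrite shift_icat// => ck; apply: ncak.
  by apply/(cyl_fcat _ ak).
- subst b; have ak : ftgt a = ftgt kap by rewrite ab ftgt_fcat.
  have dk : ftgt d = fsrc kap by rewrite -cd.
  rewrite gconv_cellind; last by rewrite ftgt_fcat.
  case: asboolP => // ca; have t := cyl_tgt ca; rewrite ak in t.
  rewrite asboolT ?swap_swap_restr//.
  have [-> _ _] := swapP ca ab; rewrite icat_fcat//.
  by apply: cyl_icat; rewrite isrc_icat.
- rewrite /gconv fsbig1; last by move=> p _; rewrite mul0r.
  case: asboolP => // ca; rewrite asboolF// => cc.
  exact: dis (cyl_swap ca ab) cc.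
Qed.

Lemma gconv_scale_sum (I : eqType) (r : seq I) (F : I -> G -> C) xi g :
  (forall i, i \in r -> step_fun (F i)) ->
  gconv (fun k => \sum_(i <- r) F i k) xi g = \sum_(i <- r) gconv (F i) xi g.
Proof.
elim: r => [|i r IH] H.
  by rewrite big_nil /gconv fsbig1// => p _; rewrite big_nil mul0r.
rewrite big_cons -IH; last by move=> j jr; apply: H; rewrite inE jr orbT.
rewrite -gconvDl.
- by congr (gconv _ _ _); apply/funext => k; rewrite big_cons.
- by apply: conv_finite_step; apply: H; exact: mem_head.
- by apply: conv_finite_step; apply: step_fun_sum => j jr; apply: H; rewrite inE jr orbT.
Qed.

Lemma gconvZl (z : C) f xi g : gconv (fun k => z * f k) xi g = z * gconv f xi g.
Proof. by rewrite /gconv mulr_fsumr; apply: eq_fsbigr => p _; rewrite mulrA. Qed.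

Lemma gconv_cellind_sum (I : Type) (r : seq I) (z : I -> C) (X : I -> G -> C) a b g :
  ftgt a = ftgt b -> gconv (cellind a b) (fun k => \sum_(i <- r) z i * X i k) g =
  \sum_(i <- r) z i * gconv (cellind a b) (X i) g.
Proof.
move=> ab; rewrite gconv_cellind//; under [RHS]eq_bigr do rewrite gconv_cellind//.
by case: asboolP => // _; rewrite big1// => i _; rewrite mulr0.
Qed.

Lemma gconv_assoc f h xi : step_fun f -> step_fun h ->
  gconv (gconv f h) xi = gconv f (gconv h xi).
Proof.
move=> [l lv ->] [m mv ->]; apply/funext => g.
have E1 : gconv (comb l) (comb m) = fun k => \sum_(t <- l) \sum_(s <- m)
    t.1 * s.1 * gconv (cellind t.2.1 t.2.2) (cellind s.2.1 s.2.2) k.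
  apply/funext => k; rewrite gconv_comb//; apply: eq_big_seq => t tl.
  rewrite -(gconv_cellind (comb m) k (lv t tl)) gconv_cellind_sum; last exact: lv.
  by rewrite mulr_sumr; apply: eq_bigr => s _; rewrite mulrA.
have E2 : gconv (comb m) xi = fun k => \sum_(s <- m) s.1 * gconv (cellind s.2.1 s.2.2) xi k.
  apply/funext => k; rewrite gconv_comb//; apply: eq_big_seq => s sm.
  by rewrite gconv_cellind//; exact: mv.
rewrite E1 E2 gconv_comb// gconv_scale_sum.
  apply: eq_big_seq => t tl.
  rewrite -(gconv_cellind (fun k => \sum_(s <- m) s.1 * gconv (cellind s.2.1 s.2.2) xi k) g (lv t tl)).
  rewrite gconv_cellind_sum; last exact: lv.
  rewrite gconv_scale_sum; last first.
    move=> s sm; apply: step_funZ; apply: step_fun_gconv => //; apply: step_fun_cell;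
    by [exact: lv|exact: mv].
  rewrite mulr_sumr; apply: eq_big_seq => s sm.
  by rewrite gconvZl gconv_assoc_cells ?mulrA//; [exact: lv|exact: mv].
move=> t tl; apply: step_fun_sum => s sm; apply: step_funZ; apply: step_fun_gconv => //;
apply: step_fun_cell; by [exact: lv|exact: mv].
Qed.

Definition finsupp xi := finite_set [set g | xi g != 0].

(** Used with finitely supported xi, which keeps it a finite sum; general vectors are reached by
    truncation in [reduced_norm_sq_le]. *)
Definition gip xi eta : C := \sum_(g \in [set: G]) (xi g)^* * eta g.

Lemma finsupp_cell a b xi : ftgt a = ftgt b -> finsupp xi -> finsupp (gconv (cellind a b) xi).
Proof.
move=> ab fx; apply: sub_finite_set (finite_image (swap b a) fx).
move=> g /=; rewrite gconv_cellind//; case: asboolP; last by rewrite eqxx.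
by move=> ca xg; exists (swap a b g) => //; rewrite swapK.
Qed.

Lemma gip_cell a b xi eta : ftgt a = ftgt b ->
  gip (gconv (cellind a b) xi) eta = gip xi (gconv (cellind b a) eta).
Proof.
move=> ab; rewrite /gip.
rewrite -(@fsbig_widen _ _ _ _ [set g | cyl a (gr g)])//; last first.
  move=> g [_ /= nc]; rewrite gconv_cellind// asboolF// conjC0 mul0r.
  by [].
rewrite -[RHS](@fsbig_widen _ _ _ _ [set g | cyl b (gr g)])//; last first.
  by move=> g [_ /= nc]; rewrite gconv_cellind// asboolF// mulr0.
rewrite (reindex_fsbig (swap b a) [set g | cyl b (gr g)] [set g | cyl a (gr g)]).
  apply: eq_fsbigr => g; rewrite in_setE /= => cb.
  have ca : cyl a (gr (swap b a g)) by exact: cyl_swap.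
  by rewrite gconv_cellind// asboolT// swapK// gconv_cellind// asboolT.
split.
- by move=> g /= cb; exact: cyl_swap.
- by move=> g k; rewrite !in_setE /= => cg ck e; rewrite -(swapK cg (esym ab)) e swapK.
- by move=> g /= ca; exists (swap a b g); [exact: cyl_swap|rewrite swapK].
Qed.

Lemma gipDl xi1 xi2 eta : finsupp xi1 -> finsupp xi2 ->
  gip (fun k => xi1 k + xi2 k) eta = gip xi1 eta + gip xi2 eta.
Proof.
move=> f1 f2; rewrite /gip -fsbigD_supp.
- by apply: eq_fsbigr => g _; rewrite rmorphD mulrDl.
- apply: sub_finite_set f1 => g [_ /=]; rewrite mulf_eq0 negb_or conjC_eq0.
  by move=> /andP[].
- apply: sub_finite_set f2 => g [_ /=]; rewrite mulf_eq0 negb_or conjC_eq0.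
  by move=> /andP[].
Qed.

Lemma gipDr xi eta1 eta2 : finsupp xi ->
  gip xi (fun k => eta1 k + eta2 k) = gip xi eta1 + gip xi eta2.
Proof.
move=> fx; rewrite /gip -fsbigD_supp.
- by apply: eq_fsbigr => g _; rewrite mulrDr.
- apply: sub_finite_set fx => g [_ /=]; rewrite mulf_eq0 negb_or conjC_eq0.
  by move=> /andP[].
- apply: sub_finite_set fx => g [_ /=]; rewrite mulf_eq0 negb_or conjC_eq0.
  by move=> /andP[].
Qed.

Lemma gipZl (z : C) xi eta : gip (fun k => z * xi k) eta = z^* * gip xi eta.
Proof. by rewrite /gip mulr_fsumr; apply: eq_fsbigr => g _; rewrite rmorphM mulrA. Qed.

Lemma gipZr (z : C) xi eta : gip xi (fun k => z * eta k) = z * gip xi eta.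
Proof. by rewrite /gip mulr_fsumr; apply: eq_fsbigr => g _; rewrite mulrCA. Qed.

Lemma finsuppZ (z : C) xi : finsupp xi -> finsupp (fun k => z * xi k).
Proof.
by apply: sub_finite_set => g /=; rewrite mulf_eq0 negb_or => /andP[].
Qed.

Lemma finsuppD xi1 xi2 : finsupp xi1 -> finsupp xi2 -> finsupp (fun k => xi1 k + xi2 k).
Proof.
move=> f1 f2; have : finite_set ([set g | xi1 g != 0] `|` [set g | xi2 g != 0]).
  by rewrite finite_setU.
apply: sub_finite_set => g /= H; have [e|] := eqVneq (xi1 g) 0; last by left.
by right; rewrite e add0r in H.
Qed.

Lemma gconv_comb_cons t l xi : valid (t :: l) ->
  gconv (comb (t :: l)) xi =
  fun k => t.1 * gconv (cellind t.2.1 t.2.2) xi k + gconv (comb l) xi k.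
Proof.
move=> tlv; have lv : valid l by move=> s sl; apply: tlv; rewrite inE sl orbT.
have tv : ftgt t.2.1 = ftgt t.2.2 by apply: tlv; exact: mem_head.
by apply/funext => k; rewrite !gconv_comb// big_cons gconv_cellind.
Qed.

Lemma gip_adjoint f xi eta : step_fun f -> finsupp xi ->
  finsupp (gconv f xi) /\ gip (gconv f xi) eta = gip xi (gconv (ginvol f) eta).
Proof.
move=> [l lv ->] fx.
have -> : ginvol (comb l) = comb [seq (t.1^*, (t.2.2, t.2.1)) | t <- l].
  apply/funext => g; rewrite /ginvol /comb big_map rmorph_sum; apply: eq_bigr => t _ /=.
  by rewrite rmorphM /= -[in RHS]ginvol_cellind.
elim: l lv => [|t l IH] lv.
  have -> : gconv (comb [::]) xi = fun=> 0 by apply/funext => g; rewrite gconv_comb// big_nil.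
  split; first by rewrite /finsupp (_ : [set _ | _] = set0)//; apply/seteqP; split => // g /=; rewrite eqxx.
  rewrite /gip !fsbig1// => g _; first by rewrite gconv_comb// big_nil mulr0.
  by rewrite conjC0 mul0r.
have lv' : valid l by move=> s sl; apply: lv; rewrite inE sl orbT.
have tv : ftgt t.2.1 = ftgt t.2.2 by apply: lv; exact: mem_head.
have [IH1 IH2] := IH lv'.
rewrite gconv_comb_cons// [map _ _]/= gconv_comb_cons; last first.
  by move=> s; rewrite inE => /predU1P[->|/mapP[s' /lv' sv ->]].
have ft := finsuppZ t.1 (finsupp_cell tv fx).
split; first exact: finsuppD.
by rewrite gipDl// gipDr// gipZl gipZr gip_cell// IH2.
Qed.

Lemma gip_self xi : finsupp xi -> ((complex.Re (gip xi xi))%:E = nrm2 xi)%E /\ 0 <= complex.Re (gip xi xi).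
Proof.
move=> fx; set X := [set g | xi g != 0].
have gE : gip xi xi = (\sum_(g \in X) rnorm (xi g) ^+ 2)%:C.
  rewrite /gip -(@fsbig_widen _ _ _ _ X)//; last first.
    by move=> g [_ /=] /negP; rewrite negbK => /eqP ->; rewrite mulr0.
  rewrite !fsbig_finite// rmorph_sum; apply: eq_bigr => g _ /=; exact: mul_conj_rnorm.
rewrite gE /=; split; last by apply: fsumr_ge0 => g _; exact: sqr_ge0.
rewrite /nrm2 -fsumEFin// -esum_fset//; last by move=> g _; rewrite lee_fin sqr_ge0.
rewrite esum_mkcond; apply: eq_esum => g _; case: ifPn => // /negP.
rewrite in_setE /X /= => /negP; rewrite negbK => /eqP ->.
by rewrite /rnorm normr0 expr0n.
Qed.

Lemma sum_le_nrm2 (X : set G) xi (c : R) : finite_set X -> (nrm2 xi <= c%:E)%E ->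
  \sum_(g \in X) rnorm (xi g) ^+ 2 <= c.
Proof.
move=> fX xc; rewrite -lee_fin; apply: le_trans xc; rewrite -fsumEFin//.
by apply: ereal_sup_ubound; exists X.
Qed.

(** The Cauchy-Schwarz inequality, through s t <= (lam s^2 + t^2 / lam) / 2 in every coordinate. *)
Lemma gip_bound xi F (c : R) : finsupp xi -> (nrm2 xi <= 1)%E -> 0 <= c ->
  (reduced_norm F <= c%:E)%E -> complex.Re (gip xi (gconv F xi)) <= c.
Proof.
move=> fx x1 c0 Fc; apply/ler_addgt0Pr => e e0.
set X := [set g | xi g != 0].
have gE : gip xi (gconv F xi) = \sum_(g \in X) (xi g)^* * gconv F xi g.
  rewrite /gip -(@fsbig_widen _ _ _ _ X)//.
  by move=> g [_ /=] /negP; rewrite negbK => /eqP ->; rewrite conjC0 mul0r.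
(* The weight lam is c + e, as c itself may be 0. *)
have lam0 : 0 < c + e by rewrite ltr_wpDl.
have b1 := sum_le_nrm2 fx x1.
have b2 := sum_le_nrm2 fx (nrm2_gconv_le Fc c0 x1).
apply: le_trans (rnormC_Re _) _; rewrite gE fsbig_finite//.
apply: le_trans (@rnorm_sum R C^o _ _ _ _) _.
have H g : rnorm ((xi g)^* * gconv F xi g) <=
    ((c + e) * rnorm (xi g) ^+ 2 + (c + e)^-1 * rnorm (gconv F xi g) ^+ 2) / 2.
  rewrite rnormM rnormC_conj; set s := rnorm _; set t := rnorm _.
  rewrite -subr_ge0.
  have -> : ((c + e) * s ^+ 2 + (c + e)^-1 * t ^+ 2) / 2 - s * t =
     (c + e)^-1 * ((c + e) * s - t) ^+ 2 / 2 by field; exact: lt0r_neq0.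
  by rewrite divr_ge0// mulr_ge0 ?sqr_ge0// invr_ge0 ltW.
apply: (@le_trans _ _ (((c + e) * 1 + (c + e)^-1 * c ^+ 2) / 2)).
  apply: (@le_trans _ _ (\sum_(g <- fset_set X) (((c + e) * rnorm (xi g) ^+ 2 +
      (c + e)^-1 * rnorm (gconv F xi g) ^+ 2) / 2))); first exact: ler_sum.
  rewrite -mulr_suml ler_pM2r ?invr_gt0// big_split /= -!mulr_sumr -!fsbig_finite//.
  by apply: lerD; rewrite ler_pM2l// invr_gt0.
rewrite mulr1 ler_pdivrMr// -subr_ge0.
have -> : (c + e) * 2 - (c + e + (c + e)^-1 * c ^+ 2) = (c + e)^-1 * ((c + e) ^+ 2 - c ^+ 2).
  by field; exact: lt0r_neq0.
rewrite mulr_ge0 ?invr_ge0 ?(ltW lam0)// subr_ge0 ler_pXn2r ?nnegrE// ?lerDl ltW//.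
Qed.

(** For a finitely supported xi, ||f xi||^2 = <xi, f* f xi> is at most the same plus ||h xi||^2,
    that is <xi, F xi> with F = f* f + h* h, which the norm of F bounds. *)
Lemma reduced_norm_sq_le f h (c : R) : step_fun f -> step_fun h -> 0 <= c ->
  (reduced_norm (fun g => (gconv (ginvol f) f g + gconv (ginvol h) h g)%R) <= c%:E)%E ->
  (reduced_norm f <= (Num.sqrt c)%:E)%E.
Proof.
move=> sf sh c0 Fc; apply: reduced_norm_le; first exact: sqrtr_ge0.
move=> xi x1; rewrite sqr_sqrtr//.
have fin_case eta : finsupp eta -> (nrm2 eta <= 1)%E -> (nrm2 (gconv f eta) <= c%:E)%E.
  move=> fe e1; have [f1 a1] := gip_adjoint (gconv f eta) sf fe.
  have [f2 a2] := gip_adjoint (gconv h eta) sh fe.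
  have [<- _] := gip_self f1; have [_ p2] := gip_self f2.
  rewrite lee_fin.
  have := gip_bound fe e1 c0 Fc.
  have -> : gconv (fun g => gconv (ginvol f) f g + gconv (ginvol h) h g) eta =
      (fun g => gconv (ginvol f) (gconv f eta) g + gconv (ginvol h) (gconv h eta) g).
    apply/funext => g; rewrite -!gconv_assoc//; try exact: step_fun_ginvol.
    by rewrite gconvDl//; apply: conv_finite_step; apply: step_fun_gconv => //; exact: step_fun_ginvol.
  rewrite gipDr// -a1 -a2 raddfD /=.
  by apply: le_trans; rewrite lerDl.
(* On a finite set X the values of f xi involve finitely many values of xi, so xi may be truncated
   to those. *)
apply: ge_ereal_sup => _ [X [fX _] <-].
have [l lv fE] := sf.
pose Y := \bigcup_(g in X) [set` [seq swap t.2.1 t.2.2 g | t <- l]].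
have fY : finite_set Y by apply: bigcup_finite => // g _; exact: finite_seq.
pose eta g := if g \in Y then xi g else 0.
have feta : finsupp eta.
  apply: sub_finite_set fY => g /=; rewrite /eta; case: ifPn; last by rewrite eqxx.
  by rewrite in_setE.
have eta1 : (nrm2 eta <= 1)%E.
  apply: le_trans x1; apply: le_esum => g _; rewrite lee_fin /eta; case: ifP => // _.
  by rewrite /rnorm normr0 expr0n sqr_ge0.
apply: le_trans (fin_case _ feta eta1).
rewrite (@eq_fsbigr _ _ _ _ _ (fun g => (rnorm (gconv f eta g) ^+ 2)%:E)).
  by apply: ereal_sup_ubound; exists X.
move=> g; rewrite in_setE => Xg; rewrite fE !gconv_comb//; congr (rnorm _ ^+ 2)%:E.
apply: eq_big_seq => t tl; case: ifP => // _; rewrite /eta ifT// in_setE.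
by exists g => //=; apply/mapP; exists t.
Qed.

Section Completion.
Variables (A : cstarAlgType R) (iota : (G -> C) -> A).
Hypothesis gA : is_groupoid_cstar iota.
Local Notation "x ** y" := (cmul x y) (at level 40, left associativity).
Local Notation "x ^#" := (cstar x) (at level 2, format "x ^#").

Lemma rnorm_sq_le_step f h : step_fun f -> step_fun h ->
  rnorm (iota f) ^+ 2 <= rnorm ((iota f)^# ** iota f + (iota h)^# ** iota h).
Proof.
move=> sf sh; have sff := step_fun_gconv (step_fun_ginvol sf) sf.
have shh := step_fun_gconv (step_fun_ginvol sh) sh.
set c := rnorm (_ + _); have c0 : 0 <= c := rnorm_ge0 _.
rewrite -[c]sqr_sqrtr// ler_pXn2r// ?nnegrE ?rnorm_ge0 ?sqrtr_ge0//.
apply: (rnorm_iota gA); first exact: step_fun_Cc.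
apply: (reduced_norm_sq_le sf sh c0).
have sF : step_fun (fun g => gconv (ginvol f) f g + gconv (ginvol h) h g).
  have := step_fun_lin 1 sff shh; congr step_fun; apply/funext => g; by rewrite mul1r.
rewrite -(iota_norm gA (step_fun_Cc rf sF)) (iotaD gA); try exact: step_fun_Cc.
by rewrite !(iota_gconv rf gA)//; try exact: step_fun_ginvol; rewrite !(iota_ginvol rf gA).
Qed.

(** By density from the case of step functions. It says that an entry of a column has at most the
    norm of the column, which is what the norm on M_2(A) requires. *)
Theorem rnorm_sq_le_sum (x y : A) : rnorm x ^+ 2 <= rnorm (x^# ** x + y^# ** y).
Proof.
apply/ler_addgt0Pr => e e0.
pose K := 2 * (rnorm x + rnorm y) + 2.
have K0 : 0 < K by rewrite ltr_wpDl// mulr_ge0// addr_ge0// rnorm_ge0.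
pose d := Num.min 1 (e / (4 * K)).
have d0 : 0 < d by rewrite lt_min ltr01 divr_gt0// mulr_gt0.
have d1 : d <= 1 by rewrite ge_min lexx.
(* Passing to step functions changes x* x and y* y by at most d K, and three such errors add up
   below. *)
have dK : 4 * (d * K) <= e.
  have : d <= e / (4 * K) by rewrite ge_min lexx orbT.
  by rewrite ler_pdivlMr ?mulr_gt0//; lra.
have [f sf xf] := step_fun_dense rf gA x d0; have [h sh yh] := step_fun_dense rf gA y d0.
have diff (u v : A) : rnorm (u - v) < d -> rnorm u <= K / 2 - 1 ->
    rnorm (u^# ** u - v^# ** v) <= d * K.
  move=> uv uK; have -> : u^# ** u - v^# ** v = (u - v)^# ** u + v^# ** (u - v).
    by rewrite cstarB cmulBl cmulBr subrKA.
  have vK : rnorm v <= K / 2.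
    rewrite -[v](subrK u); apply: le_trans (rnormD _ _) _; rewrite rdistC.
    by move: uv uK d1; lra.
  apply: le_trans (rnormD _ _) _.
  have h1 : rnorm ((u - v)^# ** u) <= d * (K / 2).
    apply: le_trans (rnorm_cmul _ _) _; rewrite rnorm_cstar.
    by apply: ler_pM; rewrite ?rnorm_ge0 ?ltW//; move: uK; lra.
  have h2 : rnorm (v^# ** (u - v)) <= K / 2 * d.
    apply: le_trans (rnorm_cmul _ _) _; rewrite rnorm_cstar.
    by apply: ler_pM; [exact: rnorm_ge0|exact: rnorm_ge0|exact: vK|exact: ltW].
  by move: h1 h2; lra.
have x0 := rnorm_ge0 x; have y0 := rnorm_ge0 y.
have dx := diff x (iota f) xf; have dy := diff y (iota h) yh.
have {}dx : rnorm (x^# ** x - (iota f)^# ** iota f) <= d * K by apply: dx; rewrite /K; lra.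
have {}dy : rnorm (y^# ** y - (iota h)^# ** iota h) <= d * K by apply: dy; rewrite /K; lra.
have := rnorm_sq_le_step sf sh.
rewrite -!rnorm_cstar_cmul.
set a := x^# ** x; set b := y^# ** y; set a' := _ ** iota f; set b' := _ ** iota h => H.
have H1 : rnorm a <= rnorm a' + d * K.
  by have := rnormD (a - a') a'; rewrite subrK; move: dx; lra.
have H2 : rnorm (a' + b') <= rnorm (a + b) + (d * K + d * K).
  have := rnormD (a' + b' - (a + b)) (a + b); rewrite subrK.
  have := rnormD (a' - a) (b' - b); rewrite opprD addrACA (rdistC a') (rdistC b').
  by move: dx dy; lra.
move: H H1 H2 dK; lra.
Qed.

End Completion.
End Positivity.

(** * Schur multipliers *)

Section SchurMultiplier.
Variables (R : realType) (E : digraph).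
Hypothesis rf : row_finite E.
Local Notation G := (path_groupoid E).
Local Notation C := R[i].
Implicit Types (a b c d kap mu : finpath E) (u f xi eta : G -> C) (g h w : G).
Local Notation cellind := (@cellind R E).

(** An arrow (x, k, y) is moved along its orbit, to the i-th shift of x. Its first n shifts form a
    window W_g, and the Schur multiplier compares windows. *)
Definition gshift i g := marrow (ishift i (gr g)) (gk g + i%:Z) (gd g) g.

Lemma gshiftP i g : [/\ gr (gshift i g) = ishift i (gr g), gk (gshift i g) = gk g + i%:Z &
  gd (gshift i g) = gd g].
Proof.
apply: marrowP; apply/tail_eqP; have [p [q [k e]]] := arrowP g.
exists p, (q + i)%N; split; first by rewrite k; lia.
by rewrite shift_shift addnC -shift_shift e shift_shift.
Qed.

Lemma gshift_inj g i j : gshift i g = gshift j g -> i = j.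
Proof.
move=> e; have [_ k1 _] := gshiftP i g; have [_ k2 _] := gshiftP j g.
by move: k1; rewrite e k2 => /addrI [].
Qed.

(** Decides whether the i-th shift from a z and the j-th shift from b z give the same arrow, which
    depends on a and b only and not on z. *)
Definition meet_at a b (i j : nat) : bool :=
  (i + flen b == j + flen a)%N && (drop i (fedges a) == drop j (fedges b)).

Lemma gshift_swap a b g i j : cyl a (gr g) -> ftgt a = ftgt b ->
  (gshift j (swap a b g) == gshift i g) = meet_at a b i j.
Proof.
move=> ca ab; have [r1 k1 d1] := swapP ca ab.
have [r2 k2 d2] := gshiftP i g; have [r3 k3 d3] := gshiftP j (swap a b g).
rewrite r1 in r3; rewrite k1 in k3; rewrite d1 in d3.
have t := cyl_tgt ca; rewrite ab in t; have ta := cyl_tgt ca.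
set z := ishift (flen a) (gr g) in r3 t ta *.
have gE : gr g = icat a z by rewrite icat_shift.
apply/eqP/idP => [e|/andP[/eqP ij /eqP e]].
  have ij : (i + flen b)%N = (j + flen a)%N.
    by have := congr1 (@gk E) e; rewrite k2 k3; lia.
  rewrite /meet_at ij eqxx /=; apply/eqP.
  have er : ishift j (icat b z) = ishift i (icat a z).
    by have := congr1 (@gr E) e; rewrite r2 r3 gE.
  apply: (@eq_from_nth _ (iedge z 0)); rewrite !size_drop -/(flen a) -/(flen b); first by lia.
  move=> m ml; rewrite !nth_drop.
  rewrite -(iedge_icat_lt (iedge z 0) ta); last by lia.
  rewrite -(iedge_icat_lt (iedge z 0) t); last by lia.
  by rewrite -!iedge_shift er.
apply: arrow_eq; rewrite ?r2 ?r3 ?k2 ?k3 ?d2 ?d3//; last by lia.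
rewrite gE; apply: ipath_eq => m; rewrite !iedge_shift.
have [il|il] := ltnP (i + m) (flen a).
  rewrite (iedge_icat_lt (iedge z 0) t); last by lia.
  rewrite (iedge_icat_lt (iedge z 0) ta)// -!nth_drop e.
  by [].
have -> : (i + m = flen a + (i + m - flen a))%N by lia.
have -> : (j + m = flen b + (i + m - flen a))%N by lia.
by rewrite -!iedge_shift !shift_icat.
Qed.

Lemma sum_exists (n : nat) (P : pred 'I_n) : (forall j k, P j -> P k -> j = k) ->
  (\sum_(j < n) P j)%N = [exists j, P j].
Proof.
move=> uP; case: existsP => [[j Pj]|nP].
  rewrite (bigD1 j)//= Pj big1// => k kj; apply/eqP; rewrite eqb0; apply/negP => Pk.
  by move/eqP: kj; apply; exact: uP.
by rewrite big1// => j _; apply/eqP; rewrite eqb0; apply/negP => Pj; apply: nP; exists j.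
Qed.

(** The kernel |W_g & W_h| / n (intersection of windows of length n) for g in Z(a) and h =
    [swap a b g]. For n > 0 it is positive definite with value 1 on the diagonal, hence contractive;
    it tends to 1 as n grows. *)
Definition schur_coef n a b : C :=
  (\sum_(i < n) \sum_(j < n) meet_at a b i j)%:R / n%:R.

Definition schur n (l : seq (C * (finpath E * finpath E))) :=
  [seq (t.1 * schur_coef n t.2.1 t.2.2, t.2) | t <- l].

Definition shift_mask n w xi : G -> C :=
  fun h => if [exists j : 'I_n, gshift j h == w] then xi h else 0.

(** The size of the intersection counts the w in W_g for which h survives the mask at w; so the
    multiplier averages l applied to masked vectors. *)
Lemma gconv_schur n l xi g : valid l -> gconv (comb (schur n l)) xi g =
  n%:R^-1 * \sum_(i < n) gconv (comb l) (shift_mask n (gshift i g) xi) g.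
Proof.
move=> lv; rewrite gconv_comb; last by move=> _ /mapP[t /lv tv ->].
under [X in _ * X]eq_bigr do rewrite gconv_comb//.
rewrite exchange_big /= mulr_sumr big_map; apply: eq_big_seq => t tl /=.
rewrite -mulr_sumr; case: asboolP => [ca|_]; last by rewrite big1// !mulr0.
set x := xi _; have tv := lv t tl.
have -> : \sum_(i < n) shift_mask n (gshift i g) xi (swap t.2.1 t.2.2 g) =
    (\sum_(i < n) \sum_(j < n) meet_at t.2.1 t.2.2 i j)%:R * x.
  rewrite natr_sum mulr_suml; apply: eq_bigr => i _; rewrite /shift_mask.
  rewrite (_ : (\sum_(j < n) meet_at t.2.1 t.2.2 i j)%N =
    [exists j : 'I_n, gshift j (swap t.2.1 t.2.2 g) == gshift i g]).
    by case: existsP => _; rewrite ?mul1r ?mul0r.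
  rewrite -sum_exists; first by apply: eq_bigr => j _; rewrite gshift_swap.
  by move=> j k /eqP j1 /eqP k1; apply/val_inj/(@gshift_inj (swap t.2.1 t.2.2 g)); rewrite j1 k1.
by rewrite /schur_coef; set q := _%:R; rewrite -mulrA mulrCA mulrA mulrC; ring.
Qed.

Lemma sqr_sum_le (n : nat) (x : 'I_n -> R) :
  (\sum_(i < n) x i) ^+ 2 <= n%:R * \sum_(i < n) x i ^+ 2.
Proof.
have : 0 <= \sum_(i < n) \sum_(j < n) (x i - x j) ^+ 2.
  by apply: sumr_ge0 => i _; apply: sumr_ge0 => j _; exact: sqr_ge0.
have -> : \sum_(i < n) \sum_(j < n) (x i - x j) ^+ 2 =
   2 * (n%:R * \sum_(i < n) x i ^+ 2 - (\sum_(i < n) x i) ^+ 2).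
  have -> : \sum_(i < n) \sum_(j < n) (x i - x j) ^+ 2 =
     \sum_(i < n) (n%:R * x i ^+ 2 + \sum_(j < n) x j ^+ 2 - 2 * (x i * \sum_(j < n) x j)).
    apply: eq_bigr => i _; rewrite mulr_sumr mulr_sumr -[n in n%:R]card_ord.
    rewrite -sumr_const mulr_suml -big_split -sumrB /=; apply: eq_bigr => j _; ring.
  rewrite sumrB big_split /= -mulr_sumr -mulr_sumr -mulr_suml sumr_const card_ord.
  by rewrite -mulr_natl; ring.
by rewrite pmulr_rge0// subr_ge0.
Qed.

Lemma esum_exchange (T1 T2 : choiceType) (F : T1 -> T2 -> \bar R) :
  (forall x y, 0 <= F x y)%E ->
  (\esum_(x in [set: T1]) \esum_(y in [set: T2]) F x y =
   \esum_(y in [set: T2]) \esum_(x in [set: T1]) F x y)%E.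
Proof.
move=> F0; rewrite (esum_esum (J := fun=> setT))// (esum_esum (J := fun=> setT))//.
rewrite (@reindex_esum _ _ _ ([set: T2] `*`` (fun=> [set: T1])) _ (fun p => (p.2, p.1)))//.
split => // [[y x] [y' x'] _ _ [-> ->]//|[x y] _]; by exists (y, x).
Qed.

Lemma nrm2Z_le (z : C) xi : (nrm2 (fun k => (z * xi k)%R) <= (rnorm z ^+ 2)%:E * nrm2 xi)%E.
Proof.
apply: (le_trans _ (esumZl_le _ (sqr_ge0 (rnorm z)) _)); last by move=> g; rewrite lee_fin sqr_ge0.
by apply: le_esum => g _; rewrite -EFinM lee_fin rnormM exprMn.
Qed.

Lemma nrm2_gconv_lam l (c lam : R) xi : valid l -> 0 <= c -> 0 < lam ->
  (reduced_norm (comb l) <= c%:E)%E -> (nrm2 xi <= lam%:E)%E ->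
  (nrm2 (gconv (comb l) xi) <= (lam * c ^+ 2)%:E)%E.
Proof.
move=> lv c0 lam0 lc xl; set s := Num.sqrt lam.
have s0 : 0 < s by rewrite sqrtr_gt0.
have s2 : s ^+ 2 = lam by rewrite sqr_sqrtr// ltW.
have s0' : 0 <= s^-1 by rewrite invr_ge0 ltW.
have h1 : (nrm2 (fun k => ((s^-1)%:C * xi k)%R) <= 1)%E.
  apply: le_trans (nrm2Z_le _ _) _; rewrite rnormC_real (ger0_norm s0').
  apply: (@le_trans _ _ ((s^-1 ^+ 2)%:E * lam%:E)%E).
    by apply: lee_wpmul2l => //; rewrite lee_fin sqr_ge0.
  by rewrite -EFinM lee_fin exprVn s2 mulVf// lt0r_neq0.
have h2 := nrm2_gconv_le lc c0 h1.
have -> : gconv (comb l) xi = fun k => s%:C * gconv (comb l) (fun k => (s^-1)%:C * xi k) k.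
  apply/funext => k; rewrite !gconv_comb// mulr_sumr; apply: eq_bigr => t _.
  case: asboolP => _; last by rewrite !mulr0.
  rewrite mulrCA [s%:C * _]mulrA -rmorphM /= mulfV ?mul1r// lt0r_neq0//.
apply: le_trans (nrm2Z_le _ _) _; rewrite rnormC_real (ger0_norm (ltW s0)) s2 EFinM.
by apply: lee_wpmul2l => //; rewrite lee_fin ltW.
Qed.

Lemma nrm2_gconv_fin l (c : R) xi : valid l -> 0 <= c ->
  (reduced_norm (comb l) <= c%:E)%E -> (nrm2 xi <= 1)%E ->
  (nrm2 (gconv (comb l) xi) <= (c ^+ 2)%:E * nrm2 xi)%E.
Proof.
move=> lv c0 lc x1.
have [r rE] : exists r, nrm2 xi = r%:E.
  case: (nrm2 xi) x1 (nrm2_ge0 xi) => [r| |] //=; first by exists r.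
have r0 : 0 <= r by rewrite -lee_fin -rE nrm2_ge0.
rewrite rE -EFinM; apply/lee_addgt0Pr => e e0.
(* The slack keeps lam positive when xi = 0, so that rescaling is possible. *)
pose lam := r + e / (c ^+ 2 + 1).
have c1 : 0 < c ^+ 2 + 1 by rewrite ltr_wpDl// sqr_ge0.
have l0 : 0 < lam by rewrite ltr_wpDl// divr_gt0.
have xl : (nrm2 xi <= lam%:E)%E by rewrite rE lee_fin lerDl divr_ge0// ltW.
apply: le_trans (nrm2_gconv_lam lv c0 l0 lc xl) _; rewrite -EFinD lee_fin /lam mulrDl.
by rewrite [c ^+ 2 * r]mulrC lerD2l mulrAC ler_pdivrMr// ler_pM2l// lerDl.
Qed.

(** With windows of length m, Cauchy-Schwarz bounds the square norm of the image by 1/m times the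
    sum over w of ||l (mask_w xi)||^2, hence by c^2 / m times the sum of ||mask_w xi||^2. Every
    arrow lies under m masks, which cancels 1/m. *)
Theorem schur_contractive n l (c : R) : valid l -> 0 <= c ->
  (reduced_norm (comb l) <= c%:E)%E -> (reduced_norm (comb (schur n.+1 l)) <= c%:E)%E.
Proof.
move=> lv c0 lc; apply: reduced_norm_le => // xi x1.
pose m : R := n.+1%:R; have m0 : 0 < m by rewrite ltr0n.
pose F w g : \bar R := (rnorm (gconv (comb l) (shift_mask n.+1 w xi) g) ^+ 2)%:E.
have F0 w g : (0 <= F w g)%E by rewrite lee_fin sqr_ge0.
have step1 g : ((rnorm (gconv (comb (schur n.+1 l)) xi g) ^+ 2)%:E <=
    (m^-1)%:E * \esum_(w in [set: G]) F w g)%E.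
  rewrite gconv_schur// rnormM exprMn.
  have -> : rnorm (n.+1%:R^-1 : C) = m^-1.
    have -> : (n.+1%:R^-1 : C) = (m^-1)%:C by rewrite fmorphV rmorph_nat.
    by rewrite rnormC_real ger0_norm// invr_ge0 ltW.
  have H : ((\sum_(i < n.+1) rnorm (gconv (comb l) (shift_mask n.+1 (gshift i g) xi) g) ^+ 2)%:E
      <= \esum_(w in [set: G]) F w g)%E.
    rewrite -sumEFin.
    pose X : {fset G} := [fset gshift (i : 'I_n.+1) g | i : 'I_n.+1]%fset.
    apply: (@le_trans _ _ (\sum_(w \in [set` X]) F w g)%E); last first.
      by apply: ereal_sup_ubound; exists [set` X] => //; split => //; exact: finite_fset.
    rewrite -(fsbig_seq) ?fset_uniq//= big_imfset//=.
      by rewrite big_enum_cond /=.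
    by move=> i j _ _ /gshift_inj/val_inj.
  apply: le_trans (lee_wpmul2l _ H); last by rewrite lee_fin invr_ge0 ltW.
  rewrite -EFinM lee_fin; set X := \sum_(i < _) _ ^+ 2.
  have : rnorm (\sum_(i < n.+1) gconv (comb l) (shift_mask n.+1 (gshift i g) xi) g) ^+ 2 <= m * X.
    apply: le_trans (sqr_sum_le _); rewrite ler_pXn2r ?nnegrE ?rnormC_ge0 ?sumr_ge0//.
      exact: (@rnorm_sum R C^o).
    by move=> i _; exact: rnormC_ge0.
  rewrite -(@ler_pM2l _ (m^-1 ^+ 2)) ?exprn_gt0 ?invr_gt0// => /le_trans; apply.
  by rewrite le_eqVlt; apply/orP; left; apply/eqP; field; exact: lt0r_neq0.
apply: (@le_trans _ _ ((m^-1)%:E * \esum_(g in [set: G]) \esum_(w in [set: G]) F w g)%E).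
  apply: (le_trans _ (esumZl_le _ _ _)); first exact: le_esum.
    by rewrite invr_ge0 ltW.
  by move=> g; exact: esum_ge0.
rewrite esum_exchange//.
have mask1 w : (nrm2 (shift_mask n.+1 w xi) <= 1)%E.
  apply: le_trans x1; apply: le_esum => g _; rewrite lee_fin /shift_mask; case: ifP => // _.
  by rewrite /rnorm normr0 expr0n sqr_ge0.
apply: (@le_trans _ _ ((m^-1)%:E * ((c ^+ 2)%:E * (m%:E * nrm2 xi)))%E).
  apply: lee_wpmul2l; first by rewrite lee_fin invr_ge0 ltW.
  apply: (@le_trans _ _ ((c ^+ 2)%:E * \esum_(w in [set: G]) nrm2 (shift_mask n.+1 w xi))%E).
    apply: (le_trans _ (esumZl_le _ (sqr_ge0 c) _)); last by move=> w; exact: nrm2_ge0.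
    by apply: le_esum => w _; exact: nrm2_gconv_fin.
  apply: lee_wpmul2l; first by rewrite lee_fin sqr_ge0.
  rewrite /nrm2 esum_exchange; last by move=> *; rewrite lee_fin sqr_ge0.
  apply: (le_trans _ (esumZl_le _ (ltW m0) _)); last by move=> g; rewrite lee_fin sqr_ge0.
  apply: le_esum => g _; set x := rnorm (xi g) ^+ 2.
  apply: (@le_trans _ _ (\esum_(w in [set: G]) \sum_(j < n.+1) (if gshift j g == w then x%:E else 0))%E).
    apply: le_esum => w _; rewrite /shift_mask; case: existsP => [[j jw]|_].
      rewrite (bigD1 j)//= jw leeDl// sume_ge0// => i _; case: ifP => // _.
      by rewrite lee_fin sqr_ge0.
    rewrite /rnorm normr0 expr0n /= sume_ge0// => i _; case: ifP => // _.
    by rewrite lee_fin sqr_ge0.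
  rewrite esum_sum; last by move=> w i _ _; case: ifP => // _; rewrite lee_fin sqr_ge0.
  rewrite (eq_bigr (fun=> x%:E)); first by rewrite sumEFin sumr_const card_ord -EFinM /m mulr_natl.
  move=> j _; rewrite -[RHS](@esum_set1 _ _ (gshift j g) (fun=> x%:E)) ?lee_fin ?sqr_ge0//.
  rewrite [RHS]esum_mkcond; apply: eq_esum => w _.
  case: eqP => [<-|ne]; first by rewrite mem_set.
  by rewrite memNset//= => e; apply: ne; rewrite e.
have [r rE] : exists r, nrm2 xi = r%:E.
  by case: (nrm2 xi) x1 (nrm2_ge0 xi) => [r| |] //= _ _; exists r.
move: x1; rewrite rE -!EFinM !lee_fin => r1.
have -> : m^-1 * (c ^+ 2 * (m * r)) = c ^+ 2 * r by field; exact: lt0r_neq0.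
by rewrite ler_piMr// sqr_ge0.
Qed.

(** Each i meets at most one j. An i past the end of a meets j = i + |b| - |a|, both remainders
    being empty, as long as j < n; at most |a| + |b| indices fail this. *)
Lemma meet_at_count n a b : (\sum_(i < n) \sum_(j < n) meet_at a b i j <= n)%N /\
  (n <= \sum_(i < n) \sum_(j < n) meet_at a b i j + (flen a + flen b))%N.
Proof.
split.
  rewrite -[leqRHS]card_ord -sum1_card; apply: leq_sum => i _.
  rewrite sum_exists ?leq_b1// => j k /andP[/eqP e1 _] /andP[/eqP e2 _].
  by apply/val_inj; move: e1; rewrite e2 => /addIn.
have le1 (i : 'I_n) : (flen a <= i)%N -> (i + flen b < n + flen a)%N ->
    (1 <= \sum_(j < n) meet_at a b i j)%N.
  move=> ai ib; have jn : (i + flen b - flen a < n)%N by lia.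
  rewrite (bigD1 (Ordinal jn))//= {1}/meet_at /=.
  rewrite !drop_oversize ?eqxx ?andbT -/(flen a) -/(flen b)//; last by lia.
  by rewrite (_ : (i + flen b == i + flen b - flen a + flen a)%N) //; apply/eqP; lia.
have : (\sum_(i < n) ((flen a <= i) && (i + flen b < n + flen a)) <=
    \sum_(i < n) \sum_(j < n) meet_at a b i j)%N.
  apply: leq_sum => i _; case: (boolP (_ && _)) => // /andP[h1 h2]; exact: le1.
suff : (n <= \sum_(i < n) ((flen a <= i) && (i + flen b < n + flen a)) + (flen a + flen b))%N.
  by move=> h1 h2; apply: leq_trans h1 _; rewrite leq_add2r.
have lo k : (\sum_(i < k) (i < flen a) <= flen a)%N.
  suff -> : (\sum_(i < k) (i < flen a) = minn k (flen a))%N by rewrite geq_minr.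
  by elim: k => [|k IH]; rewrite ?big_ord0 ?min0n// big_ord_recr /= IH; lia.
have hi k : (\sum_(i < k) (n - flen b <= i) = k - (n - flen b))%N.
  by elim: k => [|k IH]; rewrite ?big_ord0// big_ord_recr /= IH; lia.
have : (n <= \sum_(i < n) (((flen a <= i) && (i + flen b < n + flen a)) +
    (i < flen a) + (n - flen b <= i)))%N.
  rewrite -[leqLHS]card_ord -sum1_card; apply: leq_sum => i _; have := ltn_ord i; lia.
rewrite !big_split /= hi; have := lo n.
set S1 := (\sum_(i < n) (i < _))%N; set S2 := (\sum_(i < n) (_ && _))%N.
by move: S1 S2 => S1 S2; lia.
Qed.

End SchurMultiplier.

(** * Normal forms of step functions *)

Section NormalForm.
Variables (R : realType) (E : digraph).
Hypotheses (rf : row_finite E) (ns : no_sinks E).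
Local Notation G := (path_groupoid E).
Local Notation C := R[i].
Local Notation cell := (finpath E * finpath E)%type.
Implicit Types (a b kap mu : finpath E) (u f xi eta : G -> C) (g h w : G).
Local Notation cellind := (@cellind R E).

Lemma cellind_refine a b n : ftgt a = ftgt b -> exists2 s : seq (finpath E), uniq s &
  (forall kap, kap \in s -> ftgt a = fsrc kap /\ flen kap = n) /\
  forall g, cellind a b g = \sum_(kap <- s) cellind (fcat a kap) (fcat b kap) g.
Proof.
move=> ab; have [s us sE] := finite_set_seq (@finite_paths E rf (ftgt a) n).
exists s => //; split; first by move=> kap /sE[].
move=> g; have [cg|ncg] := pselect (gcyl a b g); last first.
  rewrite cellind0// big1_seq// => kap /= /sE[ka _]; rewrite cellind0//.
  by move=> /(gcyl_fcat _ ab (esym ka))[].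
have /gcylP[ca _ _ _] := cg; pose z := ishift (flen a) (gr g).
have za : isrc z = ftgt a by rewrite (cyl_tgt ca).
have zs : ipre z n \in s by apply/sE; split => //; exact: flen_ipre.
rewrite cellind1// (bigD1_seq (ipre z n))//= big1_seq ?addr0.
  rewrite cellind1//; apply/(gcyl_fcat _ ab); first by have [] := proj1 (sE _) zs.
  by split => //; exact: cyl_ipre.
move=> kap /andP[kz kaps]; rewrite cellind0//.
have [ka kn] := proj1 (sE _) kaps.
move=> /(gcyl_fcat _ ab (esym ka))[_ /cylE zk]; move/eqP: kz; apply.
by rewrite -zk kn.
Qed.

(** Distinct cells of equal maximal length are disjoint: a common arrow fixes the difference of the
    two lengths, the maximum then fixes both, and its ends fix the paths. Coefficients are thus
    values of the function. *)
Definition normal n (l : seq (C * cell)) := [/\ valid l, uniq (map snd l) &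
  forall t, t \in l -> maxn (flen t.2.1) (flen t.2.2) = n].

Lemma comb_cons (t : C * cell) l : comb (t :: l) = fun g => t.1 * cellind t.2.1 t.2.2 g + comb l g.
Proof. by apply/funext => g; rewrite /comb big_cons. Qed.

Lemma comb_cat (l m : seq (C * cell)) : comb (l ++ m) = fun g => comb l g + comb m g :> C.
Proof. by apply/funext => g; rewrite /comb big_cat. Qed.

Lemma comb_merge (l : seq (C * cell)) :
  comb l = comb [seq (\sum_(t <- l | t.2 == c) t.1, c) | c <- undup (map snd l)].
Proof.
apply/funext => g; rewrite /comb big_map /=.
under [RHS]eq_bigr do rewrite mulr_suml big_mkcond.
rewrite exchange_big /=; apply: eq_big_seq => t tl.
rewrite (bigD1_seq t.2)/= ?undup_uniq ?mem_undup ?map_f// eqxx big1 ?addr0//.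
by move=> c ct; rewrite eq_sym (negbTE ct).
Qed.

Lemma comb_depth (l : seq (C * cell)) : valid l -> exists N0 : nat, forall n, (N0 <= n)%N -> exists l',
  [/\ valid l', comb l' = comb l & forall t, t \in l' -> maxn (flen t.2.1) (flen t.2.2) = n].
Proof.
move=> lv; elim: l lv => [|t l IH] lv; first by exists 0%N => n _; exists [::].
have [|N0 H] := IH; first by move=> s sl; apply: lv; rewrite inE sl orbT.
have tv : ftgt t.2.1 = ftgt t.2.2 by apply: lv; exact: mem_head.
exists (maxn N0 (maxn (flen t.2.1) (flen t.2.2))) => n nN.
have [|l' [l1 l2 l3]] := H n; first by move: nN; rewrite geq_max => /andP[].
have [s us [sP sE]] := cellind_refine (n - maxn (flen t.2.1) (flen t.2.2)) tv.
exists ([seq (t.1, (fcat t.2.1 kap, fcat t.2.2 kap)) | kap <- s] ++ l'); split.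
- move=> q; rewrite mem_cat => /orP[/mapP[kap /sP[ka _] ->] /=|/l1//].
  by rewrite !ftgt_fcat// -tv.
- rewrite comb_cat comb_cons l2; apply/funext => g; congr (_ + _).
  by rewrite /comb big_map sE mulr_sumr.
- move=> q; rewrite mem_cat => /orP[/mapP[kap /sP[ka kn] ->] /=|/l3//].
  by rewrite !flen_fcat -?tv// kn; lia.
Qed.

Lemma normal_form f : step_fun f -> exists N0 : nat, forall n, (N0 <= n)%N ->
  exists l, normal n l /\ f = comb l.
Proof.
move=> [l lv ->]; have [N0 H] := comb_depth lv; exists N0 => n /H[l' [v' e' n']].
rewrite -e' (comb_merge l'); eexists; split; last by reflexivity.
split.
- by move=> _ /mapP[c + ->]; rewrite mem_undup => /mapP[t /v' tv ->].
- by rewrite -map_comp map_id_in ?undup_uniq// => c.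
- by move=> _ /mapP[c + ->]; rewrite mem_undup => /mapP[t /n' tn ->].
Qed.

Lemma normal_disjoint n (c c' : cell) g : maxn (flen c.1) (flen c.2) = n ->
  maxn (flen c'.1) (flen c'.2) = n -> gcyl c.1 c.2 g -> gcyl c'.1 c'.2 g -> c = c'.
Proof.
case: c c' => [a b] [a' b'] /= m m' /gcylP[ca cb k _] /gcylP[ca' cb' k' _].
have la : flen a = flen a' by lia.
have lb : flen b = flen b' by lia.
by move: ca cb ca' cb' => /cylE <- /cylE <- /cylE <- /cylE <-; rewrite la lb.
Qed.

Lemma comb_normal n l t g : normal n l -> t \in l -> gcyl t.2.1 t.2.2 g -> comb l g = t.1.
Proof.
move=> [lv lu ln] tl cg; rewrite /comb (bigD1_seq t)//=; last exact: map_uniq lu.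
rewrite cellind1// mulr1 big1_seq ?addr0// => s /andP[st sl].
rewrite cellind0 ?mulr0// => cs; move/eqP: st; apply.
have e : s.2 = t.2 by apply: normal_disjoint cs cg; apply: ln.
have ls : (index s l < size l)%N by rewrite index_mem.
have lt_ : (index t l < size l)%N by rewrite index_mem.
suff st : index s l = index t l by rewrite -(nth_index t sl) st nth_index.
apply/eqP; rewrite -(nth_uniq t.2 _ _ lu) ?size_map//.
by rewrite !(nth_map t)// !nth_index// e.
Qed.

Lemma normal_swap n (l : seq (C * cell)) : normal n l ->
  normal n [seq (t.1^*, (t.2.2, t.2.1)) | t <- l].
Proof.
move=> [lv lu ln]; split.
- by move=> _ /mapP[t /lv tv ->].
- rewrite -map_comp (_ : map _ l = map (fun c : cell => (c.2, c.1)) (map snd l)).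
    by rewrite map_inj_uniq// => -[x y] [x' y'] [-> ->].
  by rewrite -map_comp; apply: eq_map.
- by move=> _ /mapP[t /ln tn ->]; rewrite maxnC.
Qed.

Lemma ginvol_comb (l : seq (C * cell)) :
  ginvol (comb l) = comb [seq (t.1^*, (t.2.2, t.2.1)) | t <- l] :> (G -> C).
Proof.
apply/funext => g; rewrite /ginvol /comb big_map rmorph_sum; apply: eq_bigr => t _ /=.
by rewrite rmorphM /= -[in RHS]ginvol_cellind.
Qed.

Lemma ginvK g : ginv (ginv g) = g.
Proof. by apply: arrow_eq => //=; rewrite opprK. Qed.

Lemma ginvolK f : ginvol (ginvol f) = f.
Proof. by apply/funext => g; rewrite /ginvol ginvK conjCK. Qed.

(** At the unit of y, f f* sums |f|^2 over the arrows with range y, and each cell holds at most one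
    of these. *)
Lemma square_at_unit n l y : normal n l ->
  gconv (comb l) (ginvol (comb l)) (gunit y) =
  (\sum_(t <- l) rnorm t.1 ^+ 2 * (`[< cyl t.2.1 y >])%:R)%:C.
Proof.
move=> nl; have [lv _ _] := nl; rewrite gconv_comb// rmorph_sum; apply: eq_big_seq => t tl /=.
have tv := lv t tl; case: asboolP => [ca|_]; last by rewrite !mulr0.
rewrite mulr1 -mul_conj_rnorm mulrC; congr (_ * _); rewrite /ginvol; congr (_^*).
apply: (comb_normal nl tl); apply/gcyl_ginv.
have [r k d] := swapP (ca : cyl t.2.1 (gr (gunit y))) tv.
apply/gcylP; rewrite r k d /=; split => //.
- by apply: cyl_icat; rewrite -tv; exact: cyl_tgt.
- by rewrite shift_icat// -tv; exact: cyl_tgt.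
Qed.

Lemma square_at_unit_r n l y : normal n l ->
  gconv (ginvol (comb l)) (comb l) (gunit y) =
  (\sum_(t <- l) rnorm t.1 ^+ 2 * (`[< cyl t.2.2 y >])%:R)%:C.
Proof.
move=> nl; rewrite -{2}[comb l]ginvolK ginvol_comb (square_at_unit _ (normal_swap nl)).
by rewrite big_map /=; congr (_%:C); apply: eq_bigr => t _; rewrite rnormC_conj.
Qed.

End NormalForm.

(** * Cuntz subequivalence for diagonal sums *)

Section CuntzSubequivalence.
Variables (R : realType) (A : cstarAlgType R).
Implicit Types a x y : A.
Local Notation "x ** y" := (cmul x y) (at level 40, left associativity).
Local Notation "x ^#" := (cstar x) (at level 2, format "x ^#").

(** True in every C*-algebra by spectral theory; here an assumption, which [rnorm_sq_le_sum]
    discharges for the groupoid algebra. *)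
Hypothesis rnorm_sq_sum : forall x y : A, rnorm x ^+ 2 <= rnorm (x^# ** x + y^# ** y).

Lemma ord2P (i : 'I_(1 + 1)) : i = ord0 \/ i = ord_max.
Proof. by case: i => -[|[|//]] h; [left|right]; apply: val_inj. Qed.

Lemma cvnorm2 (v : 'cV[A]_(1 + 1)) (x := v ord0 0) (y := v ord_max 0) :
  cvnorm v ^+ 2 = rnorm (x^# ** x + y^# ** y).
Proof.
rewrite /cvnorm sqr_sqrtr ?rnorm_ge0// !mxE big_ord_recl big_ord1 !mxE.
by rewrite (_ : lift _ _ = ord_max)//; apply: val_inj.
Qed.

Lemma cvnorm_entry (v : 'cV[A]_(1 + 1)) i : rnorm (v i 0) <= cvnorm v.
Proof.
rewrite -ler_sqr ?nnegrE ?rnorm_ge0 ?sqrtr_ge0// cvnorm2.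
have [->|->] := ord2P i.
- exact: rnorm_sq_sum.
- by rewrite addrC; exact: rnorm_sq_sum.
Qed.

(** The bound is tested at u = a* / ||a||, where the C*-identity gives ||a u|| = ||a||. *)
Lemma rnorm_left_bound a (e : R) : 0 <= e ->
  (forall u, rnorm u <= 1 -> rnorm (a ** u) <= e) -> rnorm a <= e.
Proof.
move=> e0 H; have [->|a0] := eqVneq a 0; first by rewrite rnorm0.
have n0 : 0 < rnorm a by rewrite lt_neqAle rnorm_ge0 eq_sym rnorm_eq0 a0.
have := H (((rnorm a)^-1)%:C *: a^#); rewrite rnormZ rnormC_real.
rewrite ger0_norm ?invr_ge0 ?rnorm_ge0// rnorm_cstar mulVf ?gt_eqF// => /(_ (lexx _)).
rewrite -cscalerAr rnormZ rnormC_real ger0_norm ?invr_ge0 ?rnorm_ge0//.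
have := rnorm_cstar_cmul a^#; rewrite cstarK rnorm_cstar => ->.
by rewrite expr2 mulrA mulVf ?gt_eqF// mul1r.
Qed.

Lemma cmxnorm_entry (M : 'M[A]_(1 + 1)) (e : R) i j : 0 <= e ->
  (cmxnorm M <= e%:E)%E -> rnorm (M i j) <= e.
Proof.
move=> e0 Me; apply: rnorm_left_bound => // u u1.
pose v : 'cV[A]_(1 + 1) := \col_k (if k == j then u else 0).
have vj : rnorm (v j 0) <= 1 by rewrite mxE eqxx.
have v1 : cvnorm v <= 1.
  rewrite -(ler_sqr _ _) ?nnegrE ?sqrtr_ge0// cvnorm2 expr1n.
  have u2 : rnorm (u^# ** u) <= 1.
    by rewrite rnorm_cstar_cmul -(expr1n _ 2) ler_sqr ?nnegrE ?rnorm_ge0.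
  have [ej|ej] := ord2P j.
  - by rewrite /v !mxE ej /= cmul0r addr0.
  - by rewrite /v !mxE ej /= cmul0r add0r.
have : ((cvnorm (cmulmx M v))%:E <= cmxnorm M)%E by apply: ereal_sup_ubound; exists v.
move=> /le_trans/(_ Me); rewrite lee_fin; apply: le_trans.
suff -> : M i j ** u = cmulmx M v i 0 by exact: cvnorm_entry.
rewrite mxE (bigD1 j)//= mxE eqxx big1 ?addr0// => k kj.
by rewrite mxE (negbTE kj) cmul0r.
Qed.

(** Each entry of M v has norm at most 2 e, so the column has norm at most sqrt 8 e; 4 is a round
    bound for sqrt 8. *)
Lemma cmxnorm_le (M : 'M[A]_(1 + 1)) (e : R) : (forall i j, rnorm (M i j) <= e) ->
  (cmxnorm M <= (4 * e)%:E)%E.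
Proof.
move=> Me; have e0 : 0 <= e by exact: le_trans (rnorm_ge0 _) (Me 0 0).
apply: ge_ereal_sup => _ [v /= v1 <-]; rewrite lee_fin.
have en i : rnorm (cmulmx M v i 0) <= 2 * e.
  rewrite mxE; apply: le_trans (rnorm_sum _ _ _) _.
  apply: (@le_trans _ _ (\sum_(k < 1 + 1) e)).
    apply: ler_sum => k _; apply: le_trans (rnorm_cmul _ _) _; rewrite -[e]mulr1.
    apply: ler_pM; rewrite ?rnorm_ge0//; exact: le_trans (cvnorm_entry _ _) v1.
  by rewrite sumr_const card_ord mulr_natl.
rewrite -ler_sqr ?nnegrE ?sqrtr_ge0// ?mulr_ge0// cvnorm2.
apply: le_trans (rnormD _ _) _; rewrite !rnorm_cstar_cmul.
have sq i : rnorm (cmulmx M v i 0) ^+ 2 <= (2 * e) ^+ 2.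
  by rewrite ler_sqr ?nnegrE ?rnorm_ge0// mulr_ge0.
have := sq ord0; have := sq ord_max; have := sqr_ge0 e; nra.
Qed.

Lemma cmxnorm_ge0 n (M : 'M[A]_n) : (0 <= cmxnorm M)%E.
Proof.
apply: ereal_sup_ubound; exists 0; rewrite /= /cvnorm ?mxE big1 ?rnorm0 ?sqrtr0//.
- by move=> k _; rewrite !mxE cmul0r.
- by move=> k _; rewrite !mxE big1 ?cmul0r// => j _; rewrite !mxE cmul0r.
Qed.

Lemma cuntz_double_entry (a : A) (r : 'M[A]_(1, 1 + 1)) i j (a1 : 'M[A]_1 := const_mx a) :
  (cmulmx (cmulmx (cstarmx r) a1) r - cdirsum a1 a1) i j =
  (r 0 i)^# ** a ** r 0 j - (if i == j then a else 0).
Proof.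
rewrite !mxE big_ord1 !mxE big_ord1 !mxE; congr (_ - _).
by case: splitP => i' ei; rewrite mxE; case: splitP => j' ej; rewrite !mxE -val_eqE /= ei ej;
  rewrite (ord1 i') (ord1 j').
Qed.

(** On M_2(A) the norm is equivalent to the maximum of the entries. This removes matrices from the
    rest of the proof: a + a <= a means two approximate solutions r* a r = a with small mixed
    products. *)
Theorem cuntz_doubleP (a : A) (a1 : 'M[A]_1 := const_mx a) :
  cuntz_le (cdirsum a1 a1) a1 <-> forall e : R, 0 < e ->
  exists r1 r2, [/\ rnorm (r1^# ** a ** r1 - a) < e, rnorm (r2^# ** a ** r2 - a) < e,
     rnorm (r1^# ** a ** r2) < e & rnorm (r2^# ** a ** r1) < e].
Proof.
split=> [[r rP] e e0|H].
  have e2 : 0 < e / 2 by rewrite divr_gt0.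
  have : nbhs (0%E : \bar R) [set y | (y < (e / 2)%:E)%E].
    by apply: open_nbhs_nbhs; split; [exact: open_ereal_lt_ereal|rewrite /= lte_fin].
  move=> /rP[N _ /(_ N (leqnn N))] /= /ltW rN.
  have en i j := cmxnorm_entry i j (ltW e2) rN.
  have ee : e / 2 < e by rewrite ltr_pdivrMr// ltr_pMr// ltr1n.
  exists (r N 0 ord0), (r N 0 ord_max); split.
  - by have := en ord0 ord0; rewrite cuntz_double_entry eqxx => /le_lt_trans; apply.
  - by have := en ord_max ord_max; rewrite cuntz_double_entry eqxx => /le_lt_trans; apply.
  - by have := en ord0 ord_max; rewrite cuntz_double_entry /= subr0 => /le_lt_trans; apply.
  - by have := en ord_max ord0; rewrite cuntz_double_entry /= subr0 => /le_lt_trans; apply.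
have step n : exists r : 'M[A]_(1, 1 + 1),
    (cmxnorm (cmulmx (cmulmx (cstarmx r) a1) r - cdirsum a1 a1) <= (harmonic n)%:E)%E.
  have h0 : 0 < harmonic n / 4 :> R by rewrite divr_gt0// harmonic_gt0.
  have [r1 [r2 [h1 h2 h3 h4]]] := H _ h0.
  exists (\row_k (if k == ord0 then r1 else r2)).
  rewrite [harmonic n](_ : _ = 4 * (harmonic n / 4)); last by rewrite mulrC divfK.
  apply: cmxnorm_le => i j; rewrite cuntz_double_entry !mxE; apply: ltW.
  by case: i j => -[|[|//]] hi [] [|[|//]] hj; rewrite -!val_eqE //= subr0.
have [r rP] := choice step; exists r.
apply: (squeeze_cvge _ (cvg_cst _) (_ : (harmonic n)%:E @[n --> \oo] --> 0%E)).
  by near=> n; rewrite cmxnorm_ge0 rP.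
by apply: cvg_EFin; [near=> n|exact: cvg_harmonic].
Unshelve. all: by end_near. Qed.

End CuntzSubequivalence.

(** * Pure infiniteness excludes stable vertices *)

Section FiniteTrace.
Variables (R : realType) (E : digraph).
Hypotheses (rf : row_finite E) (ns : no_sinks E).
Local Notation G := (path_groupoid E).
Local Notation C := R[i].
Local Notation cell := (finpath E * finpath E)%type.
Implicit Types (a b mu : finpath E) (f : G -> C) (x y : ipath E) (v : vertex E).
Local Notation cellind := (@cellind R E).

Lemma normal_filter n (l : seq (C * cell)) (P : pred (C * cell)) :
  normal n l -> normal n [seq t <- l | P t].
Proof.
move=> [lv lu ln]; split.
- by move=> t; rewrite mem_filter => /andP[_ /lv].
- by apply: subseq_uniq lu; apply: map_subseq; exact: filter_subseq.
- by move=> t; rewrite mem_filter => /andP[_ /ln].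
Qed.

Lemma gcyl_neq0 a b : ftgt a = ftgt b -> gcyl a b !=set0.
Proof.
move=> ab; have [x xa] := cyl_neq0 ns a; have [_ _ h] := sliceP xa ab.
by exists (slice a b x).
Qed.

(** Terms with coefficient 0 are dropped, as their cells could start elsewhere; every remaining cell
    contains an arrow, where f is nonzero. *)
Lemma normal_corner f v : step_fun f ->
  (forall g, f g != 0 -> isrc (gr g) = v /\ isrc (gd g) = v) ->
  exists n l, [/\ normal n l, f = comb l &
    forall t, t \in l -> fsrc t.2.1 = v /\ fsrc t.2.2 = v].
Proof.
move=> /(normal_form rf)[n /(_ n (leqnn n))[l [ln fl]]] fv.
exists n, [seq t <- l | t.1 != 0]; split; first exact: normal_filter.
  rewrite fl; apply/funext => g; rewrite /comb [RHS]big_filter [RHS]big_mkcond.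
  by apply: eq_bigr => t _; case: eqVneq => // ->; rewrite mul0r.
move=> t; rewrite mem_filter => /andP[t0 tl].
have [lv _ _] := ln; have [g gt] := gcyl_neq0 (lv t tl).
have [|sr sd] := fv g; first by rewrite fl (comb_normal ln tl gt).
by have [ca cb _ _] := gt; rewrite -(isrc_cyl ca) -(isrc_cyl cb).
Qed.

Lemma sum_indicator_count (I : Type) (l : seq I) (k : I -> R) (a : I -> finpath E)
    (S : seq (ipath E)) :
  \sum_(y <- S) \sum_(t <- l) k t * (`[< cyl (a t) y >])%:R =
  \sum_(t <- l) k t * (count (fun y => `[< cyl (a t) y >]) S)%:R.
Proof.
rewrite exchange_big; apply: eq_bigr => t _ /=.
rewrite -mulr_sumr -sum1_count natr_sum [in RHS]big_mkcond; congr (_ * _).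
by apply: eq_bigr => y _; case: asboolP.
Qed.

(** Both sides weight |coefficient|^2 of a cell (a, b) by the number of points of S, in Z(a) on the
    left and in Z(b) on the right; stability equates these numbers. *)
Lemma stable_trace n v f (l : seq (C * cell)) Pi S : normal n l -> f = comb l ->
  (forall t, t \in l -> fsrc t.2.1 = v /\ fsrc t.2.2 = v) ->
  {subset map snd l <= Pi} -> stable_set v Pi S ->
  \sum_(y <- S) complex.Re (gconv f (ginvol f) (gunit y)) =
  \sum_(y <- S) complex.Re (gconv (ginvol f) f (gunit y)).
Proof.
move=> ln -> lv lPi sS; have [vl _ _] := ln.
under eq_bigr do rewrite (square_at_unit _ ln) /=.
under [RHS]eq_bigr do rewrite (square_at_unit_r _ ln) /=.
rewrite !sum_indicator_count; apply: eq_big_seq => t tl; congr (_ * _%:R).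
have [va vb] := lv t tl; apply: (stable_count sS) => //; last exact: vl.
by apply: lPi; rewrite -surjective_pairing; exact: map_f.
Qed.

Variables (A : cstarAlgType R) (iota : (G -> C) -> A).
Hypothesis gA : is_groupoid_cstar iota.
Local Notation "x ** y" := (cmul x y) (at level 40, left associativity).
Local Notation "x ^#" := (cstar x) (at level 2, format "x ^#").

Lemma pcyl_neq0 mu : pcyl iota mu != 0.
Proof.
have [x xm] := cyl_neq0 ns mu; rewrite -rnorm_eq0 gt_eqF//.
apply: lt_le_trans (iota_ge rf gA (gunit x) (step_fun_cell R (erefl (ftgt mu)))).
by rewrite cellind1; [rewrite (rnormC_real 1) normr1|exact: gcyl_unit].
Qed.

Lemma rnorm_sandwich_sub (p r s r' s' : A) (d N : R) : projection p -> 0 <= d -> d <= 1 ->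
  rnorm (r - s) <= d -> rnorm (r' - s') <= d -> rnorm r <= N -> rnorm r' <= N ->
  rnorm ((p ** s ** p)^# ** (p ** s' ** p) - p ** (r^# ** p ** r') ** p) <= d * (2 * N + 1) :> R.
Proof.
move=> pp d0 d1 rs rs' rN rN'; have [ps p2] := pp.
have N0 : 0 <= N by exact: le_trans (rnorm_ge0 r) rN.
have -> : (p ** s ** p)^# ** (p ** s' ** p) - p ** (r^# ** p ** r') ** p =
    p ** (s^# ** p ** s' - r^# ** p ** r') ** p.
  rewrite !cstarM ps cmulBr cmulBl !cmulA; congr (_ - _).
  by rewrite -[_ ** p ** p]cmulA p2.
apply: le_trans (rnorm_projection_sandwich _ pp) _.
have -> : s^# ** p ** s' - r^# ** p ** r' =
    (s - r)^# ** (p ** (s' - r')) + (s - r)^# ** (p ** r') + r^# ** (p ** (s' - r')).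
  rewrite -{1}[s](subrK r) -{1}[s'](subrK r') cstarD !cmulDl !cmulDr !cmulA.
  by rewrite addrA addrK.
have M (x y : A) (u w : R) : rnorm x <= u -> rnorm y <= w -> rnorm (x^# ** (p ** y)) <= u * w.
  move=> xu yw; apply: le_trans (rnorm_cmul _ _) _; rewrite rnorm_cstar.
  by apply: ler_pM; rewrite ?rnorm_ge0//; exact: le_trans (rnorm_projection_mul _ pp) yw.
rewrite rdistC in rs; rewrite rdistC in rs'.
have h1 := M _ _ _ _ rs rs'; have h2 := M _ _ _ _ rs rN'; have h3 := M _ _ _ _ rN rs'.
apply: le_trans (rnormD _ _) _; have := rnormD ((s - r)^# ** (p ** (s' - r'))) ((s - r)^# ** (p ** r')).
by nra.
Qed.

(* Averaging over a finite set stable under the cells that occur in [f1, f2]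
   is a trace on them, which rules out [f1* f1 ~ f2* f2 ~ p ⊥ f1* f2]. *)
Theorem purely_infinite_not_stable v : purely_infinite A -> ~ stable_vertex v.
Proof.
move=> pinf sv; set vp := vpath v; set P := pcyl iota vp.
have PP : projection P by exact: pcyl_projection.
have [Ps P2] := PP.
have pos : cpositive P by exists P; rewrite Ps P2.
have [|r1 [r2 [h11 h22 h12 h21]]] := proj1 (cuntz_doubleP (rnorm_sq_le_sum rf gA) P)
  (pinf P (pcyl_neq0 _) pos) 128^-1; first by rewrite invr_gt0.
set N := rnorm r1 + rnorm r2; have N0 : 0 <= N by rewrite addr_ge0 ?rnorm_ge0.
have rN1 : rnorm r1 <= N by rewrite lerDl rnorm_ge0.
have rN2 : rnorm r2 <= N by rewrite lerDr rnorm_ge0.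
(* Replacing r1 and r2 by step functions then costs 1/128, which with the 1/128 of the Cuntz
   relation gives the 1/64 needed below. *)
pose d : R := (128 * (2 * N + 1))^-1.
have N1 : 0 < 2 * N + 1 by lra.
have d0 : 0 < d by rewrite invr_gt0 mulr_gt0.
have dN : d * (2 * N + 1) = 128^-1 by rewrite /d invfM divfK// gt_eqF.
have d1 : d <= 1 by rewrite invf_le1 ?mulr_gt0//; lra.
have [s1 s1s s1d] := step_fun_dense rf gA r1 d0.
have [s2 s2s s2d] := step_fun_dense rf gA r2 d0.
set pf : G -> C := cellind vp vp.
have pfs : step_fun pf by exact: step_fun_cell.
pose f s : G -> C := gconv pf (gconv s pf).
have fs s : step_fun s -> step_fun (f s).
  by move=> ss; rewrite /f; apply: step_fun_gconv => //; exact: step_fun_gconv.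
have fE s : step_fun s -> iota (f s) = P ** iota s ** P.
  by move=> ss; rewrite !(iota_gconv rf gA)//; [rewrite cmulA|exact: step_fun_gconv].
have fv s g : f s g != 0 -> isrc (gr g) = v /\ isrc (gd g) = v.
  rewrite /f gconv_diag_l gconv_diag_r; case: asboolP; last by rewrite eqxx.
  move=> /isrc_cyl ->; case: asboolP; last by rewrite eqxx.
  by move=> /isrc_cyl ->.
have [n1 [l1 [nl1 fl1 lv1]]] := normal_corner (fs _ s1s) (@fv s1).
have [n2 [l2 [nl2 fl2 lv2]]] := normal_corner (fs _ s2s) (@fv s2).
(* S can be chosen only now that the cells of both functions are known. *)
have [S sS] := sv (map snd l1 ++ map snd l2).
have t1 := stable_trace nl1 fl1 lv1 _ sS.
have t2 := stable_trace nl2 fl2 lv2 _ sS.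
have Q r r' s s' D : rnorm (r^# ** P ** r' - D) < 128^-1 -> P ** D ** P = D -> step_fun s -> step_fun s' ->
    rnorm (r - iota s) < d -> rnorm (r' - iota s') < d -> rnorm r <= N -> rnorm r' <= N ->
    rnorm ((iota (f s))^# ** iota (f s') - D) <= 64^-1.
  move=> rD PD ss ss' rs rs' rn rn'.
  have h := rnorm_sandwich_sub PP (ltW d0) d1 (ltW rs) (ltW rs') rn rn'.
  rewrite !fE//; apply: le_trans (rdist_triangle (P ** (r^# ** P ** r') ** P) _ _) _.
  rewrite dN in h; have : rnorm (P ** (r^# ** P ** r') ** P - D) <= 128^-1.
    rewrite -[X in _ - X]PD -cmulBl -cmulBr; apply: le_trans _ (ltW rD).
    exact: rnorm_projection_sandwich.
  by move: h; lra.
have PPP : P ** P ** P = P by rewrite !P2.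
have P0P : P ** 0 ** P = 0 by rewrite cmul0r cmul0l.
have q11 := Q _ _ _ _ _ h11 PPP s1s s1s s1d s1d rN1 rN1.
have q22 := Q _ _ _ _ _ h22 PPP s2s s2s s2d s2d rN2 rN2.
rewrite -[r1^# ** _ ** _]subr0 in h12; rewrite -[r2^# ** _ ** _]subr0 in h21.
have q12 := Q _ _ _ _ _ h12 P0P s1s s2s s1d s2d rN1 rN2.
have q21 := Q _ _ _ _ _ h21 P0P s2s s1s s2d s1d rN2 rN1.
rewrite subr0 in q12; rewrite subr0 in q21.
have FP s : step_fun s -> iota (f s) ** P = iota (f s).
  by move=> ss; rewrite fE// -cmulA P2.
have e64 : 0 <= 64^-1 :> R by rewrite invr_ge0.
have B := orthogonal_isometries_bound e64 (lexx _) PP (FP _ s1s) (FP _ s2s) q11 q22 q12 q21.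
pose sq s := gconv (f s) (ginvol (f s)); pose sq' s := gconv (ginvol (f s)) (f s).
have sqs s : step_fun s -> step_fun (sq s).
  by move=> ss; apply: step_fun_gconv; [|apply: step_fun_ginvol]; exact: fs.
have sqs' s : step_fun s -> step_fun (sq' s).
  by move=> ss; apply: step_fun_gconv; [apply: step_fun_ginvol|]; exact: fs.
have sqE s : step_fun s -> iota (sq s) = iota (f s) ** (iota (f s))^#.
  move=> /fs ss; rewrite /sq (iota_gconv rf gA ss (step_fun_ginvol ss)).
  by rewrite (iota_ginvol rf gA ss).
have sqE' s : step_fun s -> iota (sq' s) = (iota (f s))^# ** iota (f s).
  move=> /fs ss; rewrite /sq' (iota_gconv rf gA (step_fun_ginvol ss) ss).
  by rewrite (iota_ginvol rf gA ss).
have up y : complex.Re (sq s1 (gunit y)) + complex.Re (sq s2 (gunit y)) <= 3 / 2.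
  have st : step_fun (fun g => 1 * sq s1 g + sq s2 g) by apply: step_fun_lin; exact: sqs.
  have := iota_ge rf gA (gunit y) st; rewrite mul1r => h.
  have e : (fun g => 1 * sq s1 g + sq s2 g) = (fun g => sq s1 g + sq s2 g) :> (G -> C).
    by apply/funext => g; rewrite mul1r.
  have Csq s : step_fun s -> Cc (sq s) by move=> /sqs /(step_fun_Cc rf).
  rewrite e (iotaD gA (Csq _ s1s) (Csq _ s2s)) in h.
  rewrite -raddfD; apply: le_trans (rnormC_Re _) _; apply: le_trans h _.
  by rewrite (sqE _ s1s) (sqE _ s2s).
have low s y : y \in S -> step_fun s -> rnorm ((iota (f s))^# ** iota (f s) - P) <= 64^-1 ->
    63 / 64 <= complex.Re (sq' s (gunit y)).
  move=> yS ss h; have [_ _ Sv _] := sS.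
  have st : step_fun (fun g => (- 1) * sq' s g + pf g) by apply: step_fun_lin => //; exact: sqs'.
  have := iota_ge rf gA (gunit y) st.
  have e : (fun g => (- 1) * sq' s g + pf g) = (fun g => pf g - sq' s g) :> (G -> C).
    by apply/funext => g; rewrite mulN1r addrC.
  rewrite e (iotaB gA); [|exact: (step_fun_Cc rf)|by apply: (step_fun_Cc rf); exact: sqs'].
  rewrite -/P -/vp -/pf -/(pcyl iota vp) -/P rdistC => k.
  rewrite mulN1r addrC in k.
  have pu : pf (gunit y) = 1.
    by apply: cellind1; apply: gcyl_unit; apply/cyl_vpath; exact: Sv.
  rewrite pu in k.
  have := le_trans (rnormC_Re _) k; rewrite raddfB /= => k'.
  have : rnorm (iota (sq' s) - P) <= 64^-1.
    by rewrite sqE'.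
  by move: k'; lra.
have [_ Sn _ _] := sS.
(* Per point of S, f1* f1 + f2* f2 contributes at least 63/32 and f1 f1* + f2 f2* at most 3/2, while
   the trace property equates their sums. *)
have : \sum_(y <- S) (63 / 64 + 63 / 64) <= \sum_(y <- S) (3 / 2) :> R.
  apply: (@le_trans _ _ (\sum_(y <- S) (complex.Re (sq' s1 (gunit y)) + complex.Re (sq' s2 (gunit y))))).
    by rewrite !big_seq; apply: ler_sum => y yS; apply: lerD; exact: low.
  rewrite big_split /= -t1 -?t2 -?big_split; first by apply: ler_sum => y _; exact: up.
  - by move=> t; rewrite mem_cat => ->; rewrite orbT.
  - by move=> t; rewrite mem_cat => ->.
rewrite !big_const_seq !iter_addr_0 count_predT lerMn2r size_eq0 (negbTE Sn) /=.
by lra.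
Qed.

Theorem purely_infinite_K_DL : purely_infinite A -> condK E /\ condDL E.
Proof.
move=> pinf; apply: contrapT => /(not_K_DL_stable rf ns)[v].
exact: purely_infinite_not_stable.
Qed.

End FiniteTrace.

(** * Properly infinite cylinder projections *)

Section WitnessSum.
Variables (R : realType) (A : cstarAlgType R).
Implicit Types p q s t : A.
Local Notation "a ** b" := (cmul a b) (at level 40, left associativity).
Local Notation "a ^#" := (cstar a) (at level 2, format "a ^#").

Lemma projectionD p q : projection p -> projection q -> p ** q = 0 -> projection (p + q).
Proof.
move=> [ps p2] [qs q2] pq; have qp : q ** p = 0 by rewrite -ps -qs -cstarM pq cstar0.
by split; rewrite ?cstarD ?ps ?qs// cmulDl !cmulDr p2 q2 pq qp addr0 add0r.
Qed.

Lemma properly_infinite_witness_add p s t q s' t' : projection p -> projection q ->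
  p ** q = 0 -> properly_infinite_witness p s t -> properly_infinite_witness q s' t' ->
  properly_infinite_witness (p + q) (s + s') (t + t').
Proof.
move=> [ps p2] [qs q2] pq [s1 t1 ss tt st] [s1' t1' ss' tt' st'].
have qp : q ** p = 0 by rewrite -ps -qs -cstarM pq cstar0.
have cross x y : p ** x = x -> q ** y = y ->
    [/\ p ** y = 0, q ** x = 0, x^# ** y = 0 & y^# ** x = 0].
  move=> px qy; have e : x^# ** y = 0.
    by rewrite -px -qy cstarM ps cmulA -[_ ** p ** q]cmulA pq cmul0r cmul0l.
  split; [by rewrite -qy cmulA pq cmul0l|by rewrite -px cmulA qp cmul0l|exact: e|].
  by rewrite -(cstarK x) -cstarM e cstar0.
have [c1 c2 c3 c4] := cross _ _ s1 s1'; have [d1 d2 d3 d4] := cross _ _ t1 t1'.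
have [_ _ e3 e4] := cross _ _ s1 t1'; have [_ _ _ f4] := cross _ _ t1 s1'.
split; rewrite ?cstarD cmulDl !cmulDr.
- by rewrite s1 s1' c1 c2 addr0 add0r.
- by rewrite t1 t1' d1 d2 addr0 add0r.
- by rewrite ss ss' c3 c4 addr0 add0r.
- by rewrite tt tt' d3 d4 addr0 add0r.
- by rewrite st st' e3 f4 !addr0.
Qed.

End WitnessSum.

(** * Projections of finite disjoint unions of cylinders *)

Section CylinderProjections.
Variables (R : realType) (E : digraph).
Hypotheses (rf : row_finite E) (ns : no_sinks E).
Local Notation G := (path_groupoid E).
Local Notation C := R[i].
Implicit Types (a b mu nu : finpath E) (s : seq (finpath E)) (g : G).
Local Notation cellind := (@cellind R E).
Variables (A : cstarAlgType R) (iota : (G -> C) -> A).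
Hypothesis gA : is_groupoid_cstar iota.
Local Notation "x ** y" := (cmul x y) (at level 40, left associativity).
Local Notation "x ^#" := (cstar x) (at level 2, format "x ^#").

(** Distinct paths of equal length have disjoint cylinders, so the p_nu are orthogonal and their sum
    is a projection. *)
Definition level m s := uniq s /\ forall nu, nu \in s -> flen nu = m.

Definition qsum s : A := \sum_(nu <- s) pcyl iota nu.

Lemma level_cons m nu s : level m (nu :: s) -> [/\ nu \notin s, flen nu = m & level m s].
Proof.
move=> [/= /andP[ns' us] H]; split => //; first by apply: H; exact: mem_head.
by split => // k ks; apply: H; rewrite inE ks orbT.
Qed.

Lemma cyl_inj_len a b (x : ipath E) : flen a = flen b -> cyl a x -> cyl b x -> a = b.
Proof. by move=> ab /cylE <- /cylE <-; rewrite ab. Qed.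

Lemma qsum_ecell0 s a b : ftgt a = ftgt b ->
  (forall nu x, nu \in s -> cyl nu x -> cyl a x -> False) -> qsum s ** ecell iota a b = 0.
Proof.
move=> ab H; rewrite /qsum cmul_suml big1_seq// => nu /= nus.
by apply: (ecell_mul0 rf gA) => // x; exact: H.
Qed.

Lemma qsum_ecell m s nu a b : level m s -> nu \in s -> ftgt a = ftgt b ->
  cyl a `<=` cyl nu -> qsum s ** ecell iota a b = ecell iota a b.
Proof.
move=> [us sm] nus ab an; rewrite /qsum cmul_suml (bigD1_seq nu)//=.
rewrite (pcyl_ecell rf gA)// big1_seq ?addr0// => k /andP[kn ks].
apply: (ecell_mul0 rf gA) => // x kx /an nx; move/eqP: kn; apply.
by apply: cyl_inj_len kx nx; rewrite !sm.
Qed.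

Lemma pcyl_qsum0 m nu s : level m (nu :: s) -> pcyl iota nu ** qsum s = 0.
Proof.
move=> /level_cons[nns nm [us sm]]; rewrite /qsum cmul_sumr big1_seq// => k /= ks.
apply: (ecell_mul0 rf gA) => // x nx kx; move/negP: nns; apply.
by rewrite (cyl_inj_len _ nx kx)// nm sm.
Qed.

Lemma qsum_cons nu s : qsum (nu :: s) = pcyl iota nu + qsum s.
Proof. by rewrite /qsum big_cons. Qed.

Lemma qsum_projection m s : level m s -> projection (qsum s).
Proof.
elim: s => [|nu s IH] ls; first by rewrite /qsum big_nil; split; rewrite ?cstar0 ?cmul0r.
have [_ _ ls'] := level_cons ls; rewrite qsum_cons; apply: projectionD (IH ls') _.
  exact: (pcyl_projection rf gA).
exact: pcyl_qsum0 ls.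
Qed.

Lemma pcyl_partition n mu (be : 'I_n -> finpath E) :
  \bigcup_k cyl (be k) = cyl mu -> trivIset setT (fun k => cyl (be k)) ->
  pcyl iota mu = \sum_k pcyl iota (be k).
Proof.
move=> Ub tri; rewrite /pcyl /ecell -(iota_sum rf gA); last first.
  by move=> k _; exact: Cc_cellind.
congr iota; apply/funext => g.
have [gm|ngm] := pselect (gcyl mu mu g).
  have [gE] := gcyl_diag gm; rewrite -Ub => -[k _ ck].
  rewrite cellind1// (bigD1 k)//= cellind1; last by rewrite gE; exact: gcyl_unit.
  rewrite big1 ?addr0// => j jk; apply: cellind0 => /gcyl_diag[_ cj].
  by move/eqP: jk; apply; apply: tri => //; exists (gd g).
rewrite cellind0// big1// => k _; apply: cellind0 => /gcyl_diag[gE ck].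
by apply: ngm; rewrite gE; apply: gcyl_unit; rewrite -Ub; exists k.
Qed.

Lemma sum_ecell_mul n (al be ga : 'I_n -> finpath E) :
  (forall k, ftgt (al k) = ftgt (be k) /\ ftgt (ga k) = ftgt (be k)) ->
  (forall j k x, j <> k -> cyl (al j) x -> cyl (ga k) x -> False) ->
  (\sum_k ecell iota (al k) (be k))^# ** (\sum_k ecell iota (ga k) (be k)) =
  \sum_k (ecell iota (al k) (be k))^# ** ecell iota (ga k) (be k).
Proof.
move=> tg dis; rewrite cstar_sum cmul_suml; apply: eq_bigr => j _.
rewrite cmul_sumr (bigD1 j)//= big1 ?addr0// => k kj.
have [tj _] := tg j; have [_ tk] := tg k; rewrite (ecell_star rf gA)//.
by apply: (ecell_mul0 rf gA) => // x; apply: dis => jk; rewrite jk eqxx in kj.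
Qed.

(** Each half of the paradoxical partition sums to an isometry of the corner at p_mu; disjointness
    of the halves makes the ranges orthogonal. *)
Lemma pcyl_properly_infinite mu : condDI E ->
  exists x y, properly_infinite_witness (pcyl iota mu) x y.
Proof.
move=> /(DI_paradoxical_partition ns mu)[n [al [be [ga [tg [Ub tb] sub tri]]]]].
have ta k : ftgt (al k) = ftgt (be k) by have [] := tg k.
have tc k : ftgt (ga k) = ftgt (be k) by have [] := tg k.
have dis (j k : 'I_n + 'I_n) x :
    match j with inl j => cyl (al j) | inr j => cyl (ga j) end x ->
    match k with inl k => cyl (al k) | inr k => cyl (ga k) end x -> j = k.
  by move=> jx kx; apply: tri => //; exists x.
exists (\sum_k ecell iota (al k) (be k)), (\sum_k ecell iota (ga k) (be k)).
split.
- rewrite cmul_sumr; apply: eq_bigr => k _.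
  by apply: (pcyl_ecell rf gA) => //; have [] := sub k.
- rewrite cmul_sumr; apply: eq_bigr => k _.
  by apply: (pcyl_ecell rf gA) => //; have [] := sub k.
- rewrite sum_ecell_mul//.
    rewrite (pcyl_partition Ub tb); apply: eq_bigr => k _.
    by rewrite (ecell_star rf gA)// (ecell_mul_id rf gA).
  by move=> j k x jk jx kx; apply: jk; have [] := dis (inl j) (inl k) x jx kx.
- rewrite sum_ecell_mul//.
    rewrite (pcyl_partition Ub tb); apply: eq_bigr => k _.
    by rewrite (ecell_star rf gA)// (ecell_mul_id rf gA).
  by move=> j k x jk jx kx; apply: jk; have [] := dis (inr j) (inr k) x jx kx.
- rewrite sum_ecell_mul//; last by move=> j k x _ jx kx; have := dis (inl j) (inr k) x jx kx.
  rewrite big1// => k _; rewrite (ecell_star rf gA)//; apply: (ecell_mul0 rf gA) => // x jx kx.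
  by have := dis (inl k) (inr k) x jx kx.
Qed.

Lemma qsum_properly_infinite m s : condDI E -> level m s ->
  exists x y, properly_infinite_witness (qsum s) x y.
Proof.
move=> DI; elim: s => [|nu s IH] ls.
  by exists 0, 0; rewrite /qsum big_nil; split; rewrite ?cmul0r.
have [_ _ ls'] := level_cons ls; have [x [y xy]] := IH ls'.
have [x' [y' xy']] := pcyl_properly_infinite nu DI.
exists (x' + x), (y' + y); rewrite qsum_cons; apply: properly_infinite_witness_add => //.
- exact: (pcyl_projection rf gA).
- exact: qsum_projection ls'.
- exact: pcyl_qsum0 ls.
Qed.

(** [le_source_add] needs room inside one of the two summands, and under (DI) every p_nu provides
    it. *)
Lemma le_source_qsum m s (b : A) : condDI E -> level m s ->
  (forall nu, nu \in s -> le_source b (pcyl iota nu)) -> le_source b (qsum s).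
Proof.
move=> DI; elim: s => [|nu s IH] ls H.
  exists 0; rewrite /qsum big_nil cmul0r; split => //.
  by rewrite -(cmul0r b); exact: in_right_ideal_mul.
have [_ _ ls'] := level_cons ls; rewrite qsum_cons.
have [x' [y' xy']] := pcyl_properly_infinite nu DI.
apply: le_source_add xy' _ _; first exact: (pcyl_projection rf gA).
  by apply: H; exact: mem_head.
by apply: IH => // k ks; apply: H; rewrite inE ks orbT.
Qed.

Lemma le_source_extend (b : A) mu nu : cyl nu `<=` cyl mu ->
  le_source b (pcyl iota mu) -> le_source b (pcyl iota nu).
Proof.
move=> nm bm; have [ps p2] := pcyl_projection rf gA nu.
by apply: (le_source_conj bm (s := pcyl iota nu)); rewrite ps -cmulA (pcyl_mul rf gA).
Qed.

Lemma le_source_transport (b : A) mu al be : cyl al `<=` cyl mu -> ftgt al = ftgt be ->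
  le_source b (pcyl iota mu) -> le_source b (pcyl iota be).
Proof.
move=> am ab bm; apply: (le_source_conj bm (s := ecell iota al be)).
by rewrite -cmulA (pcyl_ecell rf gA)// (ecell_star rf gA)// (ecell_mul_id rf gA).
Qed.

End CylinderProjections.

(** * The set of cylinders below b* b *)

Section Compression.
Variables (R : realType) (A : cstarAlgType R).
Implicit Types p b f : A.
Local Notation "a ** b" := (cmul a b) (at level 40, left associativity).
Local Notation "a ^#" := (cstar a) (at level 2, format "a ^#").

(** Scaling b p by lam^(-1/2) leaves a defect of norm at most e / lam < 1, from which the Newton
    iteration starts. *)
Lemma le_source_compression p b f (lam e : R) : projection p -> 0 <= e -> e < lam ->
  rnorm (b^# ** b - f) <= e -> p ** f ** p = lam%:C *: p -> le_source b p.
Proof.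
move=> pp e0 el bf pfp; have [ps p2] := pp; have lam0 : 0 < lam by exact: le_lt_trans el.
pose c : R := (Num.sqrt lam)^-1; have c0 : 0 <= c by rewrite invr_ge0 sqrtr_ge0.
have c2 : c * c = lam^-1 by rewrite -expr2 exprVn sqr_sqrtr// ltW.
apply: (@newton_partial_isometry _ _ p b (c%:C *: p)) => //.
rewrite -cscalerAr -cscalerAl -cmulA p2 cstarZ cstarM ps.
have -> : (c%:C^*)%R = c%:C by exact: conjc_real.
rewrite -cscalerAr -cscalerAl scalerA -rmorphM /= c2.
have -> : p ** b^# ** (b ** p) = p ** (b^# ** b - f) ** p + lam%:C *: p.
  by rewrite cmulBr cmulBl pfp subrK !cmulA.
rewrite scalerDr scalerA -rmorphM /= mulVf ?gt_eqF// scale1r rdistC addrK.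
rewrite rnormZ rnormC_real ger0_norm ?invr_ge0 ?(ltW lam0)//.
rewrite -(@mulVf _ lam) ?gt_eqF// ltr_pM2l ?invr_gt0//; apply: le_lt_trans el.
exact: le_trans (rnorm_projection_sandwich _ pp) bf.
Qed.

Lemma rnorm_square_sub b f : rnorm (b^# ** b - f^# ** f) <= rnorm (b - f) * (rnorm b + rnorm f).
Proof.
have -> : b^# ** b - f^# ** f = b^# ** (b - f) + (b - f)^# ** f.
  by rewrite cmulBr cstarB cmulBl addrA subrK.
apply: le_trans (rnormD _ _) _; rewrite mulrDr; apply: lerD.
  by rewrite mulrC; apply: le_trans (rnorm_cmul _ _) _; rewrite rnorm_cstar.
by apply: le_trans (rnorm_cmul _ _) _; rewrite rnorm_cstar.
Qed.

End Compression.

Lemma seq_eventually (T : eqType) (l : seq T) (P : T -> nat -> Prop) :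
  (forall t, t \in l -> exists k0, forall k, (k0 <= k)%N -> P t k) ->
  exists k0, forall k, (k0 <= k)%N -> forall t, t \in l -> P t k.
Proof.
elim: l => [|t l IH] H; first by exists 0%N.
have [|k1 k1P] := IH; first by move=> u ul; apply: H; rewrite inE ul orbT.
have [|k2 k2P] := H t; first exact: mem_head.
exists (maxn k1 k2) => k; rewrite geq_max => /andP[kk1 kk2] u; rewrite inE => /predU1P[->|ul].
  exact: k2P.
exact: k1P.
Qed.

(** * Compression at aperiodic points *)

Section AperiodicCompression.
Variables (R : realType) (E : digraph).
Hypotheses (rf : row_finite E) (ns : no_sinks E).
Local Notation G := (path_groupoid E).
Local Notation C := R[i].
Implicit Types (a b mu nu : finpath E) (x y z : ipath E) (g : G) (f h : G -> C).
Local Notation cellind := (@cellind R E).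

Definition aperiodic x := forall p q, ishift p x = ishift q x -> p = q.

Lemma cyl_ipre_iff a x y k : (flen a <= k)%N -> cyl (ipre x k) y -> cyl a y <-> cyl a x.
Proof. by move=> ak /cyl_ipreP/(ipre_le ak) e; rewrite !cylE e. Qed.

(** If |a| and |b| differ, aperiodicity yields an index where the corresponding tails of y disagree;
    an arrow of Z(a, b) with both ends agreeing with y beyond that index cannot exist. *)
Lemma aperiodic_cell y a b : aperiodic y -> exists k0, forall k, (k0 <= k)%N -> forall g,
  gcyl a b g -> cyl (ipre y k) (gr g) -> cyl (ipre y k) (gd g) -> a = b.
Proof.
move=> ay; have [ab|ab] := eqVneq (flen a) (flen b).
  exists (flen a) => k ak g /gcylP[ca cb _ _] yr yd.
  move: ca cb; rewrite (cyl_ipre_iff ak yr) (cyl_ipre_iff _ yd) -?ab//.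
  by move=> /cylE <- /cylE <-; rewrite ab.
have [m ym] : exists m, iedge y (flen a + m) <> iedge y (flen b + m).
  apply: contrapT => H; move/eqP: ab; apply; apply: ay; apply: ipath_eq => m.
  by rewrite !iedge_shift; apply: contrapT => e; apply: H; exists m.
exists (flen a + flen b + m).+1 => k mk g [_ _ _ e] /cyl_ipreP/ipreP[_ yr] /cyl_ipreP/ipreP[_ yd].
by exfalso; apply: ym; rewrite -yr -?yd ?e//; lia.
Qed.

(** Among the cells of f, a long cylinder around y sees only diagonal ones on both sides, and it
    lies entirely inside or outside each of these. *)
Lemma aperiodic_compression f y : step_fun f -> aperiodic y -> exists k,
  let p := cellind (ipre y k) (ipre y k) in
  gconv p (gconv f p) = fun g => f (gunit y) * p g.
Proof.
move=> [l lv ->] ay.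
have [k0 k0P] : exists k0, forall k, (k0 <= k)%N -> forall t, t \in l ->
    (flen t.2.1 <= k)%N /\ forall g, gcyl t.2.1 t.2.2 g -> cyl (ipre y k) (gr g) ->
      cyl (ipre y k) (gd g) -> t.2.1 = t.2.2.
  apply: seq_eventually => t tl; have [k0 H] := aperiodic_cell t.2.1 t.2.2 ay.
  exists (maxn k0 (flen t.2.1)) => k; rewrite geq_max => /andP[h1 h2]; split => //.
  exact: H.
exists k0 => p; apply/funext => g; rewrite gconv_diag_l gconv_diag_r /p; set mu := ipre y k0.
have cy : cyl mu y by exact: cyl_ipre.
have unit_const t z z' : t \in l -> cyl mu z -> cyl mu z' ->
    gcyl t.2.1 t.2.2 (gunit z) -> gcyl t.2.1 t.2.2 (gunit z').
  move=> tl cz cz' tz; have [ln eq] := k0P _ (leqnn k0) _ tl.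
  have e := eq _ tz cz cz; rewrite -e in tz *; apply: gcyl_unit.
  have [_] := gcyl_diag tz; rewrite /= (cyl_ipre_iff ln cz).
  by rewrite (cyl_ipre_iff ln cz').
have [gm|ngm] := pselect (gcyl mu mu g).
  have [gE cg] := gcyl_diag gm; rewrite cellind1// mulr1 gE /=.
  case: asboolP => // _; rewrite /comb; apply: eq_big_seq => t tl; congr (_ * _).
  have [tz|tz] := pselect (gcyl t.2.1 t.2.2 (gunit y)).
    by rewrite !cellind1//; exact: unit_const tz.
  by rewrite !cellind0// => tz'; apply: tz; exact: unit_const tz'.
rewrite (cellind0 _ ngm) mulr0; case: asboolP => // cr; case: asboolP => // cd.
rewrite /comb big1_seq// => t /= tl; rewrite cellind0 ?mulr0// => gt.
have [ln eq] := k0P _ (leqnn k0) _ tl; have e := eq _ gt cr cd; rewrite -e in gt.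
by have [gE _] := gcyl_diag gt; apply: ngm; rewrite gE; apply: gcyl_unit.
Qed.

Lemma unit_value_locally_constant f x : step_fun f ->
  exists n, forall y, cyl (ipre x n) y -> f (gunit y) = f (gunit x).
Proof.
move=> [l lv ->].
have [k0 k0P] : exists k0, forall k, (k0 <= k)%N -> forall t, t \in l -> forall y,
    cyl (ipre x k) y -> cellind t.2.1 t.2.2 (gunit y) = cellind t.2.1 t.2.2 (gunit x).
  apply: seq_eventually => t tl; exists (maxn (flen t.2.1) (flen t.2.2)) => k.
  rewrite geq_max => /andP[k1 k2] y xy.
  have unit_cell z : gcyl t.2.1 t.2.2 (gunit z) <->
      [/\ cyl t.2.1 z, cyl t.2.2 z & t.2.1 = t.2.2].
    split=> [/gcylP[/= ca cb k' _]|[ca cb <-]]; last exact: gcyl_unit.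
    by split => //; apply: cyl_inj_len ca cb; lia.
  rewrite /cellind; congr (if _ then _ else _); apply: asbool_equiv_eq.
  have i1 := cyl_ipre_iff k1 xy; have i2 := cyl_ipre_iff k2 xy.
  by rewrite !unit_cell; split => -[/i1 ? /i2 ?].
exists k0 => y xy; rewrite /comb; apply: eq_big_seq => t tl.
by rewrite (k0P _ (leqnn _) _ tl _ xy).
Qed.

Variables (A : cstarAlgType R) (iota : (G -> C) -> A).
Hypothesis gA : is_groupoid_cstar iota.
Local Notation "x ** y" := (cmul x y) (at level 40, left associativity).
Local Notation "x ^#" := (cstar x) (at level 2, format "x ^#").

Definition source_set (b : A) : set (ipath E) :=
  [set x | exists2 mu, le_source b (pcyl iota mu) & cyl mu x].

Lemma closed_source_setC (b : A) : closed (~` source_set b).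
Proof.
apply: open_closedC; apply: open_cylP => x [mu bm xm]; exists (flen mu).
by rewrite (proj1 (cylE _ _) xm) => y ym; exists mu.
Qed.

(** A cell around g whose source side lies in Z(mu) gives a partial isometry that transports
    [le_source] to a cylinder around the range of g. *)
Lemma ginvariant_source_set (b : A) : ginvariant (source_set b).
Proof.
move=> g [mu bm gm]; have [p [q [_ e]]] := arrowP g.
pose al := ipre (gd g) (q + flen mu); pose be := ipre (gr g) (p + flen mu).
have ab : ftgt al = ftgt be.
  by rewrite !ftgt_ipre -!isrc_shift -!shift_shift e.
exists be; last exact: cyl_ipre.
apply: (le_source_transport rf gA _ ab bm) => x /cyl_ipreP xa.
apply/cylE; rewrite -[RHS](proj1 (cylE _ _) gm); apply: ipre_le xa; exact: leq_addl.
Qed.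

Lemma ginvariantC (D : set (ipath E)) : ginvariant D -> ginvariant (~` D).
Proof. by move=> iD g nd r; apply: nd; exact: (iD (ginv g)). Qed.

Lemma source_setC_unit_bound (b : A) f x (e : R) : condK E -> step_fun f -> 0 <= e ->
  rnorm (b^# ** b - iota f) <= e -> ~ source_set b x ->
  f (gunit x) = (complex.Re (f (gunit x)))%:C -> complex.Re (f (gunit x)) <= e.
Proof.
move=> K fs e0 bf nx fx; rewrite leNgt; apply/negP => fe.
have [n nP] := unit_value_locally_constant x fs.
(* The aperiodic point must lie in the complement of U itself, so that putting it in U is a
   contradiction; this is why (K) enters through all closed invariant sets. *)
have := K_essentially_principal ns K (closed_source_setC (b := b))
  (ginvariantC (ginvariant_source_set (b := b))) nx.
move=> /(_ (cyl (ipre x n)))[|y [[ny ty] /nP fy]].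
  by apply: open_nbhs_nbhs; split; [exact: open_cyl|exact: cyl_ipre].
have ay : aperiodic y.
  move=> p q /ex_arrow[g [gr_ gd_ gk_]].
  have : g = gunit y by apply: ty => //; rewrite /reduction /= gd_.
  by move=> /(congr1 (@gk E)); rewrite gk_ /=; lia.
have [k kP] := aperiodic_compression fs ay; set mu := ipre y k in kP.
apply: ny; exists mu; last exact: cyl_ipre.
apply: (@le_source_compression _ _ _ _ (iota f) (complex.Re (f (gunit x))) e) => //.
  exact: (pcyl_projection rf gA).
have pC := step_fun_cell R (erefl (ftgt mu)).
rewrite -cmulA -(iota_gconv rf gA)// -(iota_gconv rf gA)//; last exact: step_fun_gconv.
rewrite kP (iotaZ rf gA); last exact: Cc_cellind.
by rewrite fy fx.
Qed.

(** |h(g)|^2 is one of the nonnegative terms of h* h at the source of g, and b* b differs from h* h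
    by at most e (2 ||b|| + e). *)
Lemma source_setC_bound (b : A) h (e d : R) : condK E -> step_fun h -> 0 <= d ->
  rnorm (b - iota h) <= e -> e * (2 * rnorm b + e) <= d ^+ 2 ->
  forall g, ~ source_set b (gd g) -> rnorm (h g) <= d.
Proof.
move=> K hs d0 be ed g ng; have e0 : 0 <= e by exact: le_trans (rnorm_ge0 _) be.
have [N0 /(_ _ (leqnn _))[l [ln hl]]] := normal_form rf hs.
have [h0|h0] := eqVneq (h g) 0; first by rewrite h0 (rnormC_real 0) normr0.
have [t tl tg] : exists2 t, t \in l & gcyl t.2.1 t.2.2 g.
  apply: contrapT => H; move/eqP: h0; apply; rewrite hl /comb big1_seq// => t /= tl.
  by rewrite cellind0 ?mulr0// => tg; apply: H; exists t.
have hg : h g = t.1 by rewrite hl; exact: comb_normal ln tl tg.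
have fs : step_fun (gconv (ginvol h) h) by apply: step_fun_gconv => //; exact: step_fun_ginvol.
rewrite -ler_sqr ?nnegrE ?rnormC_ge0//.
apply: (@le_trans _ _ (complex.Re (gconv (ginvol h) h (gunit (gd g))))); last first.
  apply: le_trans ed; apply: (source_setC_unit_bound K fs _ _ ng).
  - by rewrite mulr_ge0// addr_ge0// mulr_ge0// rnorm_ge0.
  - rewrite (iota_gconv rf gA) ?(iota_ginvol rf gA)//; last exact: step_fun_ginvol.
    apply: le_trans (rnorm_square_sub _ _) _; apply: ler_pM => //; first exact: rnorm_ge0.
      by rewrite addr_ge0 ?rnorm_ge0.
    have := rdist_triangle b (iota h) 0; rewrite !subr0 rdistC; lra.
  - by rewrite hl (square_at_unit_r _ ln).
rewrite hl (square_at_unit_r _ ln) /= -hl hg (bigD1_seq t)//=; last first.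
  by have [_ lu _] := ln; exact: map_uniq lu.
have /gcylP[_ cb _ _] := tg; rewrite asboolT// mulr1 lerDl.
by apply: sumr_ge0 => s _; rewrite mulr_ge0 ?sqr_ge0.
Qed.

End AperiodicCompression.

(** * Approximation by Schur multipliers *)

Section Approximation.
Variables (R : realType) (E : digraph).
Hypotheses (rf : row_finite E) (ns : no_sinks E).
Local Notation G := (path_groupoid E).
Local Notation C := R[i].
Local Notation cell := (finpath E * finpath E)%type.
Implicit Types (a b mu nu : finpath E) (x y z : ipath E) (g : G) (f h : G -> C)
  (l : seq (C * cell)).
Local Notation cellind := (@cellind R E).

(** When the windows meet at (i, j), the paths a and b coincide past these depths, so the cell lies
    inside one cut at i and j. A multiplier of fixed length thus keeps only what sits in cells of
    bounded length. *)
Lemma meet_at_gcyl a b i j : meet_at a b i j -> ftgt a = ftgt b -> exists al be,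
  [/\ fsrc al = fsrc a, fsrc be = fsrc b, ftgt al = ftgt be &
      [/\ (flen al <= i)%N, (flen be <= j)%N & gcyl a b `<=` gcyl al be]].
Proof.
move=> /andP[/eqP ij /eqP dr] ab; have [ia|ai] := leqP i (flen a); last first.
  by exists a, b; do !split => //; [exact: ltnW|lia].
have jb : (j <= flen b)%N by lia.
have H g : gcyl a b g -> ishift i (gr g) = ishift j (gd g).
  move=> /gcylP[ca cb _ e]; apply: ipath_eq => m; rewrite !iedge_shift.
  have [ma|am] := ltnP (i + m) (flen a).
    move: ca cb => /cylE cra /cylE crb.
    have := congr1 (fun s => nth (iedge (gr g) 0) s m) dr; rewrite !nth_drop.
    rewrite -cra -[in RHS]crb !fedges_ipre !nth_mkseq//; lia.
  have : iedge (ishift (flen a) (gr g)) (i + m - flen a) =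
    iedge (ishift (flen b) (gd g)) (i + m - flen a) by rewrite e.
  by rewrite !iedge_shift subnKC// (_ : flen b + (i + m - flen a) = j + m)%N//; lia.
have [g0 g0P] := gcyl_neq0 ns ab; have /gcylP[ca0 cb0 k0 _] := g0P.
exists (ipre (gr g0) i), (ipre (gd g0) j); rewrite !flen_ipre !fsrc_ipre !ftgt_ipre.
rewrite (isrc_cyl ca0) (isrc_cyl cb0) -!isrc_shift H//; split => //; split => // g gP.
have /gcylP[ca cb k _] := gP; apply/gcylP; rewrite !flen_ipre k; split; last exact: H.
- apply/(cyl_ipreP (gr g0) (gr g)); apply: (ipre_le ia).
  by rewrite (proj1 (cylE _ _) ca) (proj1 (cylE _ _) ca0).
- apply/(cyl_ipreP (gd g0) (gd g)); apply: (ipre_le jb).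
  by rewrite (proj1 (cylE _ _) cb) (proj1 (cylE _ _) cb0).
- lia.
Qed.

Lemma schur_coefE n a b : exists2 r : R, schur_coef R n.+1 a b = r%:C &
  [/\ 0 <= r, r <= 1 & 1 - r <= (flen a + flen b)%:R / n.+1%:R].
Proof.
have [m1 m2] := meet_at_count n.+1 a b; rewrite /schur_coef.
set m := (\sum_(i < _) _)%N in m1 m2 *.
exists (m%:R / n.+1%:R); first by rewrite rmorphM fmorphV !rmorph_nat.
have n0 : 0 < n.+1%:R :> R by rewrite ltr0n.
split; first by rewrite divr_ge0.
  by rewrite ler_pdivrMr// mul1r ler_nat.
rewrite -{1}(@mulfV _ n.+1%:R) ?gt_eqF// -mulrBl ler_pM2r ?invr_gt0//.
by rewrite lerBlDl -natrD ler_nat.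
Qed.

Lemma rnorm_schur_coef n a b : rnorm (schur_coef R n.+1 a b) <= 1.
Proof. by have [r -> [r0 r1 _]] := schur_coefE n a b; rewrite rnormC_real ger0_norm. Qed.

Lemma normal_recoef n l (k : C * cell -> C) : normal n l -> normal n [seq (k t, t.2) | t <- l].
Proof.
move=> [lv lu ln]; split.
- by move=> _ /mapP[t /lv tv ->].
- by rewrite -map_comp.
- by move=> _ /mapP[t /ln tn ->].
Qed.

Lemma comb_bound n l (d : R) g : normal n l -> 0 <= d ->
  (forall t, t \in l -> rnorm t.1 <= d) -> rnorm (comb l g) <= d.
Proof.
move=> ln d0 ld; have [[t tl tg]|H] := pselect (exists2 t, t \in l & gcyl t.2.1 t.2.2 g).
  by rewrite (comb_normal ln tl tg); exact: ld.
rewrite /comb big1_seq ?(rnormC_real 0) ?normr0// => t /= tl.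
by rewrite cellind0 ?mulr0// => tg; apply: H; exists t.
Qed.

Variables (A : cstarAlgType R) (iota : (G -> C) -> A).
Hypothesis gA : is_groupoid_cstar iota.
Local Notation "x ** y" := (cmul x y) (at level 40, left associativity).
Local Notation "x ^#" := (cstar x) (at level 2, format "x ^#").

Lemma schur_valid n l : valid l -> valid (schur n l).
Proof. by move=> lv _ /mapP[t /lv tv ->]. Qed.

Lemma rnorm_schur n l : valid l -> rnorm (iota (comb (schur n.+1 l))) <= rnorm (iota (comb l)).
Proof.
move=> lv; have lC : Cc (comb l) by apply: (step_fun_Cc rf); exists l.
apply: (rnorm_iota gA).
  by apply: (step_fun_Cc rf); exists (schur n.+1 l) => //; exact: schur_valid.
by apply: schur_contractive; rewrite ?rnorm_ge0// -(iota_norm gA).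
Qed.

(** For a fixed list each coefficient is within (|a| + |b|) / (n + 1) of 1; no uniformity in l is
    claimed. *)
Lemma schur_approx l (e : R) : valid l -> 0 < e ->
  exists n, rnorm (iota (comb l) - iota (comb (schur n.+1 l))) <= e.
Proof.
move=> lv e0; pose s := \sum_(t <- l) rnorm t.1 * (flen t.2.1 + flen t.2.2)%:R : R.
have s0 : 0 <= s by apply: sumr_ge0 => t _; rewrite mulr_ge0// rnormC_ge0.
have [n sn] : exists n : nat, s / e <= n.+1%:R.
  by exists (Num.truncn (s / e)); apply/ltW/truncnS_gt.
exists n; have n0 : 0 < n.+1%:R :> R by rewrite ltr0n.
apply: (@le_trans _ _ (s / n.+1%:R)); last first.
  by rewrite ler_pdivrMr// mulrC -ler_pdivrMr.
rewrite !(iota_comb rf gA)//; last exact: schur_valid.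
rewrite big_map -sumrB /s mulr_suml.
apply: le_trans (rnorm_sum _ _ _) _; rewrite !big_seq; apply: ler_sum => t tl.
rewrite -scalerBl rnormZ (_ : t.1 - _ = t.1 * (1 - schur_coef R n.+1 t.2.1 t.2.2)) ?rnormM.
  2: by rewrite mulrBr mulr1.
have [r -> [r0 r1 r2]] := schur_coefE n t.2.1 t.2.2.
rewrite -!mulrA; apply: ler_wpM2l; first exact: rnormC_ge0.
rewrite -[leRHS]mulr1; apply: ler_pM; rewrite ?rnorm_ge0 ?rnormC_ge0//.
  by rewrite (_ : 1 - r%:C = (1 - r)%:C) ?rnormC_real ?ger0_norm ?subr_ge0// rmorphB.
by apply: (rnorm_ecell rf gA); exact: lv.
Qed.

(** K counts the pairs of paths of length at most n with matching targets and sources in F, before l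
    is known. Every cell that survives the multiplier lies in one of these bisections, and on each
    of them the supremum bounds the norm. *)
Lemma schur_small n (F : seq (vertex E)) : exists K : nat, forall N l (d : R),
  normal N l -> 0 <= d ->
  (forall t, t \in l -> [/\ fsrc t.2.1 \in F, fsrc t.2.2 \in F & rnorm t.1 <= d]) ->
  rnorm (iota (comb (schur n.+1 l))) <= K%:R * d.
Proof.
have [T TP] : exists T : seq cell, uniq T /\ forall al be, fsrc al \in F -> fsrc be \in F ->
    ftgt al = ftgt be -> (flen al <= n)%N -> (flen be <= n)%N -> (al, be) \in T.
  have fin : finite_set (\bigcup_(v in [set` F]) [set al : finpath E | fsrc al = v /\ (flen al < n.+1)%N]).
    by apply: bigcup_finite; [exact: finite_seq|move=> v _; exact: finite_pathsW].
  have [P _ PE] := finite_set_seq fin.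
  exists (undup [seq c <- [seq (al, be) | al <- P, be <- P] | ftgt c.1 == ftgt c.2]).
  split; first exact: undup_uniq.
  move=> al be aF bF ab an bn; rewrite mem_undup mem_filter /= ab eqxx /=.
  by apply: allpairs_f; apply/PE; [exists (fsrc al)|exists (fsrc be)].
exists (size T) => N l d ln d0 ld; have [lv _ _] := ln.
pose T' := [seq c <- T | ftgt c.1 == ftgt c.2].
have step (t : C * cell) : exists c : cell, t \in l -> schur_coef R n.+1 t.2.1 t.2.2 != 0 ->
    c \in T' /\ gcyl t.2.1 t.2.2 `<=` gcyl c.1 c.2.
  have [tl|tl] := boolP (t \in l); last by exists t.2.
  have [k0|k0] := eqVneq (schur_coef R n.+1 t.2.1 t.2.2) 0; first by exists t.2.
  have [i [j ij]] : exists i j : 'I_n.+1, meet_at t.2.1 t.2.2 i j.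
    apply: contrapT => H; move/eqP: k0; apply; rewrite /schur_coef big1 ?mul0r// => i _.
    by rewrite big1// => j _; apply/eqP; rewrite eqb0; apply/negP => ij; apply: H; exists i, j.
  have [al [be [s1 s2 ab [li lj sub]]]] := meet_at_gcyl ij (lv t tl).
  have [tF tF' _] := ld t tl.
  exists (al, be) => _ _; split => //; rewrite mem_filter /= ab eqxx /=.
  have [_ TP'] := TP; apply: TP'; rewrite ?s1 ?s2//.
    by apply: leq_trans li _; rewrite -ltnS.
  by apply: leq_trans lj _; rewrite -ltnS.
have [phi phiP] := choice step.
pose part c := [seq (t.1 * schur_coef R n.+1 t.2.1 t.2.2, t.2) | t <- l & phi t == c].
have npart c : normal N (part c).
  by apply: (@normal_recoef _ _ (fun t => t.1 * schur_coef R n.+1 t.2.1 t.2.2)); exact: normal_filter.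
have bpart c g : rnorm (comb (part c) g) <= d.
  apply: (comb_bound _ (npart c)) => // _ /mapP[t + ->] /=; rewrite mem_filter => /andP[_ tl].
  have [_ _ td] := ld t tl; rewrite rnormM -[leRHS]mulr1; apply: ler_pM => //.
  - exact: rnormC_ge0.
  - exact: rnormC_ge0.
  - exact: rnorm_schur_coef.
have Cpart c : Cc (comb (part c)).
  by apply: (step_fun_Cc rf); exists (part c) => //; have [] := npart c.
have -> : comb (schur n.+1 l) = fun g => \sum_(c <- T') comb (part c) g.
  apply/funext => g; rewrite /comb /schur big_map.
  under [RHS]eq_bigr do rewrite big_map big_filter big_mkcond.
  rewrite exchange_big /=; apply: eq_big_seq => t tl.
  have [k0|k0] := eqVneq (schur_coef R n.+1 t.2.1 t.2.2) 0.
    by rewrite big1 k0 ?mulr0 ?mul0r// => c _; case: ifP.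
  have [cT _] := phiP t tl k0.
  rewrite (bigD1_seq (phi t))//= ?eqxx ?big1 ?addr0//; last by apply: filter_uniq; have [] := TP.
  by move=> c; rewrite eq_sym => /negbTE ->.
rewrite (iota_sum rf gA)//; apply: le_trans (rnorm_sum _ _ _) _.
apply: (@le_trans _ _ (\sum_(c <- T') d)).
  rewrite !big_seq; apply: ler_sum => c; rewrite mem_filter => /andP[/eqP cv _].
  apply: (rnorm_iota_cell gA d0 cv (Cpart c)) (bpart c) => g.
  have [H0 _|H] := pselect (gcyl c.1 c.2 g); first by [].
  rewrite /comb /part big_map big_filter big1_seq ?eqxx// => t /andP[/eqP tc tl] /=.
  have [k0|k0] := eqVneq (schur_coef R n.+1 t.2.1 t.2.2) 0; first by rewrite k0 mulr0 mul0r.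
  rewrite cellind0 ?mulr0// => /(proj2 (phiP t tl k0)); rewrite tc; exact: H.
rewrite big_const_seq iter_addr_0 count_predT -[d *+ _]mulr_natl; apply: ler_wpM2r => //; rewrite ler_nat.
by rewrite size_filter count_size.
Qed.

End Approximation.

(** * Approximation of b by q b *)

Section SourceApproximation.
Variables (R : realType) (E : digraph).
Hypotheses (rf : row_finite E) (ns : no_sinks E).
Local Notation G := (path_groupoid E).
Local Notation C := R[i].
Local Notation cell := (finpath E * finpath E)%type.
Implicit Types (a mu nu : finpath E) (x y z : ipath E) (g : G) (f h : G -> C)
  (l : seq (C * cell)) (F : seq (vertex E)).
Variables (A : cstarAlgType R) (iota : (G -> C) -> A).
Hypothesis gA : is_groupoid_cstar iota.
Local Notation "x ** y" := (cmul x y) (at level 40, left associativity).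
Local Notation "x ^#" := (cstar x) (at level 2, format "x ^#").

(** Cutting by this projection on both sides leaves only cells with both sources in the finite set
    F, as [schur_small] requires. *)
Definition vcut F : A := qsum iota (map (@vpath E) F).

Lemma vcut_level F : uniq F -> level 0 (map (@vpath E) F).
Proof.
move=> uF; split; last by move=> nu /mapP[v _ ->].
by rewrite map_inj_uniq// => v w /(congr1 (@fsrc E)).
Qed.

Lemma vcut_ecell F a c : uniq F -> ftgt a = ftgt c ->
  vcut F ** ecell iota a c = if fsrc a \in F then ecell iota a c else 0.
Proof.
move=> uF ac; case: ifPn => aF.
  apply: (qsum_ecell rf gA (vcut_level uF) (nu := vpath (fsrc a))) => //; first exact: map_f.
  by move=> x /isrc_cyl xa; apply/cyl_vpath.
apply: (qsum_ecell0 rf gA) => // nu x /mapP[v vF ->] /cyl_vpath xv /isrc_cyl xa.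
by move: aF; rewrite -xa xv vF.
Qed.

Lemma vcut_comb F l : uniq F -> valid l -> vcut F ** iota (comb l) ** vcut F =
  iota (comb [seq t <- l | (fsrc t.2.1 \in F) && (fsrc t.2.2 \in F)]).
Proof.
move=> uF lv; rewrite !(iota_comb rf gA)//; last first.
  by move=> t; rewrite mem_filter => /andP[_ /lv].
have cE a c (ac : ftgt a = ftgt c) := vcut_ecell uF ac.
have [ps _] : projection (vcut F) := qsum_projection rf gA (vcut_level uF).
move: (vcut F) cE ps => P cE ps.
rewrite cmul_sumr cmul_suml big_filter [RHS]big_mkcond; apply: eq_big_seq => t tl.
have tv := lv t tl; rewrite -cscalerAr -cscalerAl cE//.
case: ifP => _; last by rewrite cmul0l scaler0.
rewrite -[ecell _ _ _ ** _]cstarK cstarM ps (ecell_star rf gA)// cE//.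
by case: ifP => _; rewrite ?cstar0 ?scaler0// (ecell_star rf gA).
Qed.

(** The cylinders in question are compact and covered by cylinders below b* b, so one depth M serves
    them all. *)
Lemma source_cover_depth (b : A) (l : seq cell) :
  (forall t, t \in l -> forall x, cyl t.1 x -> source_set iota b x) ->
  exists M, forall t, t \in l -> (flen t.1 <= M)%N /\
    forall x, cyl t.1 x -> le_source b (pcyl iota (ipre x M)).
Proof.
move=> H; pose P a nu := (flen a <= flen nu)%N /\
  (cyl nu `<=` cyl a -> le_source b (pcyl iota nu)).
have Pmon a x m n : (m <= n)%N -> P a (ipre x m) -> P a (ipre x n).
  rewrite /P !flen_ipre => mn [am Pm]; split; first exact: leq_trans mn.
  move=> /(_ x (cyl_ipre x n)) xa.
  have sub k y : (k <= n)%N -> cyl (ipre x n) y -> cyl (ipre x k) y.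
    by move=> kn /cyl_ipreP/(ipre_le kn) e; apply/cyl_ipreP.
  apply: (le_source_extend rf gA (mu := ipre x m)); first by move=> y; exact: sub.
  by apply: Pm => y xy; apply/(cyl_ipre_iff am xy).
have [M MP] : exists M, forall k, (M <= k)%N -> forall t, t \in l ->
    forall x, isrc x = fsrc t.1 -> P t.1 (ipre x k).
  apply: seq_eventually => t tl; have [x m n|x xt|N NP] := @fan E rf (fsrc t.1) (P t.1).
  - exact: Pmon.
  - have [xa|xa] := pselect (cyl t.1 x); last first.
      exists (flen t.1); split; first by rewrite flen_ipre.
      by move=> /(_ x (cyl_ipre x _)).
    have [mu bm xm] := H t tl x xa; exists (maxn (flen t.1) (flen mu)).
    split=> [|_]; first by rewrite flen_ipre leq_maxl.
    apply: (le_source_extend rf gA) bm => y xy.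
    by apply/(cyl_ipre_iff _ xy) => //; exact: leq_maxr.
  - by exists N => k Nk x xt; apply: Pmon Nk _; exact: NP.
exists M => t tl; split.
  have [x xt] := cyl_neq0 ns t.1.
  by have [] := MP _ (leqnn M) _ tl x (isrc_cyl xt); rewrite flen_ipre.
move=> x xt; have [tM] := MP _ (leqnn M) _ tl x (isrc_cyl xt); apply.
rewrite flen_ipre in tM.
by move=> y xy; apply/(cyl_ipre_iff tM xy).
Qed.

Lemma source_level (b : A) F M : exists s, level M s /\ forall nu, nu \in s <->
  [/\ fsrc nu \in F, flen nu = M & le_source b (pcyl iota nu)].
Proof.
have fin : finite_set (\bigcup_(v in [set` F]) [set al : finpath E | fsrc al = v /\ flen al = M]).
  by apply: bigcup_finite; [exact: finite_seq|move=> v _; exact: finite_paths].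
have [T uT TP] := finite_set_seq fin.
exists [seq nu <- T | `[< le_source b (pcyl iota nu) >]].
have memP nu : nu \in [seq nu <- T | `[< le_source b (pcyl iota nu) >]] <->
    [/\ fsrc nu \in F, flen nu = M & le_source b (pcyl iota nu)].
  rewrite mem_filter; split=> [/andP[/asboolP bn /TP[v vF [nv nM]]]|[nF nM bn]].
    by rewrite nv.
  by rewrite asboolT//=; apply/TP; exists (fsrc nu).
by split; [split; [exact: filter_uniq|move=> nu /memP[]]|].
Qed.

Lemma schur_cat n l l' : schur n (l ++ l') = schur n l ++ schur n l' :> seq (C * cell).
Proof. by rewrite /schur map_cat. Qed.

Lemma iota_comb_cat l l' : valid l -> valid l' ->
  iota (comb (l ++ l')) = iota (comb l) + iota (comb l').
Proof.
move=> lv lv'; rewrite !(iota_comb rf gA)//; first by rewrite big_cat.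
by move=> t; rewrite mem_cat => /orP[/lv|/lv'].
Qed.

(** Contractivity applied to the difference, which is a single list once the second one is
    negated. *)
Lemma rnorm_schur_sub n l l' : valid l -> valid l' ->
  rnorm (iota (comb (schur n.+1 l)) - iota (comb (schur n.+1 l'))) <=
  rnorm (iota (comb l) - iota (comb l')).
Proof.
move=> lv lv'; pose neg l := [seq (- t.1, t.2) | t <- l] : seq (C * cell).
have nv k : valid k -> valid (neg k) by move=> kv _ /mapP[t /kv tv ->].
have nE k : valid k -> iota (comb (neg k)) = - iota (comb k).
  move=> kv; rewrite !(iota_comb rf gA)//; last exact: nv.
  by rewrite big_map -sumrN; apply: eq_bigr => t _; rewrite scaleNr.
have sn : schur n.+1 (neg l') = neg (schur n.+1 l').
  by rewrite /schur /neg -!map_comp; apply: eq_map => t /=; rewrite mulNr.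
have vv : valid (l ++ neg l').
  by move=> t; rewrite mem_cat => /orP[/lv|/(nv _ lv')].
have sv k : valid k -> valid (schur n.+1 k) by exact: schur_valid.
rewrite -!nE//; last exact: sv.
rewrite -sn -!iota_comb_cat//; [|exact: nv|exact: sv|by rewrite sn; apply: nv; exact: sv].
by rewrite -schur_cat; apply: (rnorm_schur rf gA).
Qed.

(** Every cell is refined until its range path has length M; that path then belongs to s, so q fixes
    the refined cell. *)
Lemma qsum_comb M s l n : level M s -> valid l ->
  (forall t, t \in l -> (flen t.2.1 <= M)%N /\ forall x, cyl t.2.1 x -> ipre x M \in s) ->
  qsum iota s ** iota (comb (schur n l)) = iota (comb (schur n l)) :> A.
Proof.
move=> ls lv H; rewrite (iota_comb rf gA); last exact: schur_valid.
have qE nu a c (nus : nu \in s) := @qsum_ecell _ _ rf _ _ gA _ _ nu a c ls nus.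
move: (qsum iota s) qE => q qE.
rewrite cmul_sumr !big_map; apply: eq_big_seq => t tl /=; rewrite -cscalerAr; congr (_ *: _).
have tv := lv t tl; have [tM ts] := H t tl.
have [K uK [KP KE]] := cellind_refine R rf (M - flen t.2.1) tv.
have -> : ecell iota t.2.1 t.2.2 = \sum_(k <- K) ecell iota (fcat t.2.1 k) (fcat t.2.2 k).
  rewrite /ecell -(iota_sum rf gA); first by congr iota; apply/funext => g; rewrite KE.
  move=> k kK; apply: Cc_cellind => //; have [tk _] := KP k kK.
  by rewrite !ftgt_fcat// -tv.
rewrite cmul_sumr; apply: eq_big_seq => k kK; have [tk kM] := KP k kK.
have kt : ftgt (fcat t.2.1 k) = ftgt (fcat t.2.2 k) by rewrite !ftgt_fcat// -tv.
apply: (qE (fcat t.2.1 k)) => //.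
have [x xk] := cyl_neq0 ns (fcat t.2.1 k).
have /ts : cyl t.2.1 x by have /(cyl_fcat _ tk)[] := xk.
have -> : M = flen (fcat t.2.1 k) by rewrite flen_fcat// kM subnKC.
by rewrite (proj1 (cylE _ _) xk).
Qed.

Lemma iota_schur_split n l (P : pred (C * cell)) : valid l ->
  iota (comb (schur n l)) = iota (comb (schur n [seq t <- l | P t])) +
    iota (comb (schur n [seq t <- l | ~~ P t])).
Proof.
move=> lv; have fv (Q : pred (C * cell)) : valid (schur n [seq t <- l | Q t]).
  by apply: schur_valid => t; rewrite mem_filter => /andP[_ /lv].
rewrite !(iota_comb rf gA)//; last exact: schur_valid.
by rewrite !big_map !big_filter (bigID P).
Qed.

(** The crude approximant l0 determines n, F and k; only then is the accuracy eta of the fine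
    approximant h fixed. Cut down to F and multiplied, h is still close to b; its large coefficients
    live over U and its small ones are negligible in norm. *)
Theorem source_approximation (b : A) (d : R) : condK E -> 0 < d -> exists M s,
  [/\ level M s, forall nu, nu \in s -> le_source b (pcyl iota nu) &
      rnorm (b - qsum iota s ** b) < d].
Proof.
(* In the end b - q b is bounded by 4 e + 4 e + 2 e, below d = 12 e. *)
move=> K d0; pose e := d / 12; have e0 : 0 < e by rewrite divr_gt0.
have [_ [l0 l0v ->] bl0] := step_fun_dense rf gA b e0.
have [n nP] := schur_approx rf gA l0v e0.
pose F := undup ([seq fsrc t.2.1 | t <- l0] ++ [seq fsrc t.2.2 | t <- l0]).
have uF : uniq F by exact: undup_uniq.
have [k kP] := schur_small rf ns gA n F.
pose dl : R := e / k.+1%:R; have dl0 : 0 < dl by rewrite divr_gt0// ltr0n.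
have b1 : 0 < 2 * rnorm b + 1 by have := rnorm_ge0 b; lra.
(* Small enough that h is at most dl off U; with at most k bisections such coefficients contribute
   no more than e. *)
pose eta := Num.min e (Num.min 1 (dl ^+ 2 / (2 * rnorm b + 1))).
have eta0 : 0 < eta by rewrite !lt_min e0 ltr01 divr_gt0// exprn_gt0.
have etae : eta <= e by rewrite ge_min lexx.
have eta1 : eta <= 1 by rewrite !ge_min lexx orbT.
have etad : eta * (2 * rnorm b + eta) <= dl ^+ 2.
  apply: (@le_trans _ _ (eta * (2 * rnorm b + 1))).
    by apply: ler_wpM2l; [exact: ltW|rewrite lerD2l].
  by rewrite -ler_pdivlMr// !ge_min lexx !orbT.
have [h hs bh] := step_fun_dense rf gA b eta0.
have hD := source_setC_bound rf ns gA K hs (ltW dl0) (ltW bh) etad.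
have [N /(_ _ (leqnn N))[l [ln hl]]] := normal_form rf hs; have [lv _ _] := ln.
pose l1 := [seq t <- l | (fsrc t.2.1 \in F) && (fsrc t.2.2 \in F)].
have l1n : normal N l1 by exact: normal_filter.
have [l1v _ _] := l1n.
have cut0 : vcut F ** iota (comb l0) ** vcut F = iota (comb l0).
  rewrite vcut_comb// (_ : [seq t <- l0 | _] = l0)//; apply/all_filterP/allP => t tl.
  rewrite /F !mem_undup !mem_cat (map_f (fun t : C * cell => fsrc t.2.1) tl).
  by rewrite (map_f (fun t : C * cell => fsrc t.2.2) tl) orbT.
have cut1 : vcut F ** iota h ** vcut F = iota (comb l1) by rewrite hl vcut_comb.
have l01 : rnorm (iota (comb l0) - iota (comb l1)) <= 2 * e.
  rewrite -cut0 -cut1 -cmulBl -cmulBr.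
  apply: le_trans (rnorm_projection_sandwich _ (qsum_projection rf gA (vcut_level uF))) _.
  have := rdist_triangle b (iota (comb l0)) (iota h); rewrite rdistC in bl0.
  by move: bl0 bh etae; lra.
pose f := iota (comb (schur n.+1 l1)).
have bf : rnorm (b - f) <= 4 * e.
  have s1 := rnorm_schur_sub n l0v l1v.
  have t1 := rdist_triangle (iota (comb l0)) b f.
  have t2 := rdist_triangle (iota (comb (schur n.+1 l0))) (iota (comb l0)) f.
  by move: bl0 nP l01 s1 t1 t2; rewrite -/f; lra.
(* A coefficient above dl is a value of h throughout its cell, so the whole cell must lie over U. *)
pose big := [seq t <- l1 | dl < rnorm t.1]; pose small := [seq t <- l1 | ~~ (dl < rnorm t.1)].
have bv : valid big by have [] := normal_filter (fun t => dl < rnorm t.1) l1n.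
have smn : normal N small by exact: normal_filter.
have [sv _ _] := smn.
have fE : f = iota (comb (schur n.+1 big)) + iota (comb (schur n.+1 small)).
  exact: iota_schur_split.
have sm : rnorm (iota (comb (schur n.+1 small))) <= e.
  have := kP N small dl smn (ltW dl0); rewrite /dl => H.
  apply: (@le_trans _ _ (k%:R * (e / k.+1%:R))).
    apply: H => t; rewrite !mem_filter -leNgt => /andP[td /andP[/andP[t1 t2] _]].
    by split.
  by rewrite mulrCA ler_piMr ?(ltW e0)// ler_pdivrMr ?ltr0n// mul1r ler_nat.
have bigP t : t \in big -> forall x, cyl t.2.1 x -> source_set iota b x.
  rewrite mem_filter => /andP[td tl1] x xt; apply: contrapT => nx.
  have tl : t \in l by move: tl1; rewrite mem_filter => /andP[].
  have [gr_ gd_ gt] := sliceP xt (lv t tl); set g := slice _ _ x in gr_ gd_ gt.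
  have : rnorm (h g) <= dl.
    apply: hD => ng; apply: nx; rewrite -gr_.
    exact: (ginvariant_source_set rf gA ng).
  by rewrite hl (comb_normal ln tl gt) leNgt td.
have [M MP] : exists M, forall c, c \in map snd big -> (flen c.1 <= M)%N /\
    forall x, cyl c.1 x -> le_source b (pcyl iota (ipre x M)).
  by apply: source_cover_depth => c /mapP[t tb ->]; exact: bigP.
have [s [sl sP]] := source_level b F M.
exists M, s; split => //; first by move=> nu /sP[].
have qb : qsum iota s ** iota (comb (schur n.+1 big)) = iota (comb (schur n.+1 big)).
  apply: (qsum_comb n.+1 sl bv) => t tb; have [tM tP] := MP _ (map_f snd tb).
  split => // x xt; apply/sP; rewrite flen_ipre fsrc_ipre (isrc_cyl xt); split => //.
  - by move: tb; rewrite !mem_filter => /andP[_ /andP[/andP[]]].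
  - exact: tP.
have qle (w : A) : rnorm (qsum iota s ** w) <= rnorm w.
  exact: rnorm_projection_mul (qsum_projection rf gA sl).
have -> : b - qsum iota s ** b = (b - f) - qsum iota s ** (b - f) + (f - qsum iota s ** f).
  by rewrite cmulBr opprB addrAC !addrA !subrK.
have fq : rnorm (f - qsum iota s ** f) <= 2 * e.
  rewrite fE cmulDr qb opprD addrACA subrr add0r.
  have := rnormB (iota (comb (schur n.+1 small))) (qsum iota s ** iota (comb (schur n.+1 small))).
  by have := qle (iota (comb (schur n.+1 small))); move: sm; lra.
have h1 := rnormD ((b - f) - qsum iota s ** (b - f)) (f - qsum iota s ** f).
have h2 := rnormB (b - f) (qsum iota s ** (b - f)).
have h3 := qle (b - f).
by have : e = d / 12 by []; move: bf fq h1 h2 h3 d0; lra.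
Qed.

Theorem K_DI_purely_infinite : condK E -> condDI E -> purely_infinite A.
Proof.
move=> K DI a _ [b ab]; apply/(cuntz_doubleP (rnorm_sq_le_sum rf gA)) => e e0.
have d0 : 0 < e / (2 * (rnorm b + 1)).
  by rewrite divr_gt0// mulr_gt0// ltr_wpDl ?rnorm_ge0.
have [M [s [ls sb bd]]] := source_approximation b K d0.
have [x [y xy]] := qsum_properly_infinite rf ns gA DI ls.
apply: (properly_infinite_cuntz ab _ _ xy e0 bd).
- exact: (le_source_qsum rf ns gA DI ls).
- exact: (qsum_projection rf gA ls).
Qed.

End SourceApproximation.

(** Both (1) and (2) give (K) and (DL) by excluding stable vertices, and under (K) the conditions
    (DI) and (DL) coincide. *)
Theorem theorem3p14 (R : realType) (E : digraph)
    (Erow_finite : row_finite E) (Eno_sinks : no_sinks E)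
    (A : cstarAlgType R) (iota : (path_groupoid E -> R[i]%C) -> A)
    (A_CstarG : is_groupoid_cstar iota) :
  [<-> purely_infinite A;
      essentially_principal E /\
         (forall alpha : finpath E, paradoxical alpha);
       condK E /\ condDI E;
       condK E /\ condDL E].
Proof.
tfae.
- move=> /(purely_infinite_K_DL Erow_finite Eno_sinks A_CstarG)[K DL].
  split; first exact: K_essentially_principal.
  by move=> alpha; apply: DI_paradoxical => //; exact/(condK_DI_DL Eno_sinks K).
- move=> [_ para].
  have [K DL] : condK E /\ condDL E.
    apply: contrapT => /(not_K_DL_stable Erow_finite Eno_sinks)[v].
    exact: paradoxical_not_stable.
  by split => //; exact/(condK_DI_DL Eno_sinks K).
- by move=> [K DI]; split => //; exact/(condK_DI_DL Eno_sinks K).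
- move=> [K DL]; apply: (K_DI_purely_infinite Erow_finite Eno_sinks A_CstarG K).
  exact/(condK_DI_DL Eno_sinks K).
Qed.
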